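(* Let $\alpha>0$, let $\Phi:\{1,2,3,\dots\}\to(0,\infty)$ be an increasing positive function, and let $H>0$. Then $$\lim_{N\to\infty}\ \min_{|a_n|\le\Phi(n)}\ \int_0^H\left|\alpha^{it-1}+\sum_{n=1}^N a_n(n+\alpha)^{it-1}\right|^2dt>0$$ if and only if $$\sum_{n=2}^\infty\frac{\log\Phi(n)}{n\log^2 n}<\infty .$$
   Context: For each $N$ the minimum is taken over all complex numbers $a_1,\dots,a_N$ with $|a_n|\le\Phi(n)$ for $1\le n\le N$. *)

(* Defs.v *)
From Stdlib Require Import Reals.
From Coquelicot Require Import Coquelicot.
Open Scope R_scope.

Definition Cexp (z : C) : C := (exp (Re z) * cos (Im z), exp (Re z) * sin (Im z)).

(* Principal complex power of a positive real base; only meaningful for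
   [0 < x], since [ln x = 0] for [x <= 0]. *)
Definition Rcpow (x : R) (s : C) : C := Cexp (s * RtoC (ln x))%C.

(* Only the coefficients [a 1, ..., a N] matter, here and below. *)
Definition hurwitz_poly (alpha : R) (a : nat -> C) (N : nat) (t : R) : C :=
  (Rcpow alpha (Ci * RtoC t - 1) +
   sum_n_m (fun n => a n * Rcpow (INR n + alpha) (Ci * RtoC t - 1)) 1 N)%C.

Definition mean_square (alpha H : R) (N : nat) (a : nat -> C) : R :=
  RInt (fun t => Cmod (hurwitz_poly alpha a N t) ^ 2) 0 H.

Definition admissible (Phi : nat -> R) (N : nat) (a : nat -> C) : Prop :=
  forall n : nat, (1 <= n <= N)%nat -> Cmod (a n) <= Phi n.

(* [m] is the minimum (attained, not just the infimum) of [F] over [A]. *)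
Definition is_min_over {T : Type} (A : T -> Prop) (F : T -> R) (m : R) : Prop :=
  (exists a, A a /\ F a = m) /\ (forall a, A a -> m <= F a).

(* Main.v *)
Require Import Defs.
From Stdlib Require Import Reals.
From Coquelicot Require Import Coquelicot.
From Stdlib Require Import ZArith Lra Lia List ClassicalEpsilon FunctionalExtensionality.
Open Scope R_scope.

(** Write [nu_n = ln ((n + alpha) / alpha)]; up to a unimodular factor the polynomial is
    [1 / alpha + sum c_n e^{i nu_n t}] with [|c_n| <= Phi n / (n + alpha)], and by condensation the
    series condition says that [ln (Phi (2^(2^k))) / 2^k] is summable.

    Both directions rest on the same identity.  If [G] is a finite product of factors
    [(z - c + 2 i e) / (z - c + i e)] and [P] is the Poisson kernel of the upper half plane at [i y],
    then the integral of [e^{ixt} G(x) P(x)] over the line is [e^{-yt} G(iy)] for all [t >= 0].  When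
    [|G|] is bounded off [[A, B]] but large at [i y], dividing by [G(iy)] yields a function [phi] on
    [[A, B]] with [int phi(x) e^{ixt} dx] close to [e^{-yt}], uniformly in [t >= 0].  To stay with
    integrals over compact intervals, the identity is proved for [z] on the unit circle, through
    [w = e^{i tau z}] with [tau] small.

    If the series converges, iterated averages over lengths [24 / 2^k] (Ingham's construction) multiply
    [c_n] by factors that make [sum |c_n|] bounded while keeping [c_0 = 1 / alpha]; then one applies
    [phi] with [[A, B] = [0, H / 2]] and [y] large, which sends [e^{i nu t}] to nearly [e^{- y nu}].

    If it diverges, one places the centers [c] in [[J0, J1]] with multiplicities dictated by [ln Phi], so
    that [|phi|] is dominated by [Phi] while [|G(iy)|] is as large as desired with [y] small; the integrals
    of [- phi / alpha] over [[nu_n, nu_(n+1)]] are then admissible [c_n] that nearly cancel [1 / alpha]. *)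

(** * Complex-valued integrals *)

(** What decides is a budget of length. For [tower k <= n < tower (S k)] the frequencies have size
    about 2^k, so one average over a length C / 2^k gains a fixed factor, and undoing [Phi] there
    takes about ln Phi averages: the block consumes a length of order ln Phi / 2^k. Convergence says
    that all blocks from some index on fit into any given interval; the finitely many remaining n
    only change constants, which is why every H leads to the same criterion.

    Conversely, j centers of radius 1/j and multiplicity m in [j, j+1) raise |G|^2 on the nearby
    line by a factor e^{O(m+1)}, but add a multiple of y m / j^2 to |G(iy)|^2, because a single
    factor loses e^2 on the line and gains e at iy. With m proportional to ln Phi, a dyadic block of
    j contributes ln Phi / 2^k, the same quantity again.

    Analyticity enters only as a reproducing property for w^k g(w), k >= 0. It is preserved when g
    is multiplied by (1 - b w) / (1 - a w), and this follows from a recurrence in k, without contour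
    integrals. *)

Definition cis (x : R) : C := (cos x, sin x).
Arguments cis x%_R.

Lemma cis_plus (x y : R) : cis (x + y) = (cis x * cis y)%C.
Proof. unfold cis, Cmult; simpl. rewrite cos_plus, sin_plus. f_equal; ring. Qed.

Lemma cis_0 : cis 0 = 1%C.
Proof. unfold cis. rewrite cos_0, sin_0. reflexivity. Qed.

Lemma Cmod_sqr (z : C) : Cmod z ^ 2 = fst z ^ 2 + snd z ^ 2.
Proof. rewrite Cmod2_alt. reflexivity. Qed.

Lemma Cmod_le_sqr (z : C) (M : R) : 0 <= M -> Cmod z ^ 2 <= M ^ 2 -> Cmod z <= M.
Proof. intros HM Hz. pose proof (Cmod_ge_0 z). nra. Qed.

Lemma Cmod_cis (x : R) : Cmod (cis x) = 1.
Proof.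
  unfold Cmod, cis; simpl fst; simpl snd.
  replace (cos x ^ 2 + sin x ^ 2) with 1.
  - apply sqrt_1.
  - pose proof (sin2_cos2 x) as E. unfold Rsqr in E. nra.
Qed.

Lemma sin_sqr_le (u : R) : sin u ^ 2 <= u ^ 2.
Proof.
  assert (P : forall v, 0 <= v -> sin v ^ 2 <= v ^ 2).
  { intros v Hv. destruct (Rle_lt_dec 1 v).
    - pose proof (SIN_bound v). nra.
    - assert (0 <= sin v) by (apply sin_ge_0; pose proof PI2_1; lra).
      destruct (Req_dec v 0) as [->|]. { rewrite sin_0. lra. }
      pose proof (sin_lt_x v ltac:(lra)). nra. }
  destruct (Rle_lt_dec 0 u); [auto|].
  specialize (P (- u) ltac:(lra)). rewrite sin_neg in P. nra.
Qed.

Lemma one_minus_cos (u : R) : 1 - cos u = 2 * sin (u / 2) ^ 2.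
Proof.
  replace u with (2 * (u / 2)) at 1 by field. rewrite cos_2a_sin. ring.
Qed.

Lemma Cmod_cis_sub (x y : R) : Cmod (cis x - cis y) <= Rabs (x - y).
Proof.
  apply Cmod_le_sqr. { apply Rabs_pos. }
  rewrite pow2_abs, Cmod_sqr. unfold cis; simpl fst; simpl snd.
  pose proof (one_minus_cos (x - y)) as E. rewrite cos_minus in E.
  pose proof (sin_sqr_le ((x - y) / 2)).
  pose proof (sin2_cos2 x) as E1. pose proof (sin2_cos2 y) as E2. unfold Rsqr in *. nra.
Qed.

Definition Rcont (f : R -> R) : Prop := forall t : R, continuous f t.

Lemma Rcont_const (c : R) : Rcont (fun _ => c).
Proof. intro t. apply continuous_const. Qed.

Lemma Rcont_id : Rcont (fun t => t).
Proof. intro t. apply continuous_id. Qed.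

Lemma Rcont_plus (f g : R -> R) : Rcont f -> Rcont g -> Rcont (fun t => f t + g t).
Proof. intros Hf Hg t. apply (continuous_plus f g); auto. Qed.

Lemma Rcont_minus (f g : R -> R) : Rcont f -> Rcont g -> Rcont (fun t => f t - g t).
Proof. intros Hf Hg t. apply (continuous_minus f g); auto. Qed.

Lemma Rcont_mult (f g : R -> R) : Rcont f -> Rcont g -> Rcont (fun t => f t * g t).
Proof. intros Hf Hg t. apply (continuous_mult f g); auto. Qed.

Lemma Rcont_pow (f : R -> R) (n : nat) : Rcont f -> Rcont (fun t => f t ^ n).
Proof.
  intro Hf. induction n as [|n IH]; simpl.
  - apply Rcont_const.
  - apply Rcont_mult; auto.
Qed.

Lemma Rcont_inv (f : R -> R) : (forall t, f t <> 0) -> Rcont f -> Rcont (fun t => / f t).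
Proof. intros Hn Hf t. apply continuous_Rinv_comp; auto. Qed.

Lemma Rcont_comp (f g : R -> R) : Rcont f -> Rcont g -> Rcont (fun t => f (g t)).
Proof. intros Hf Hg t. apply (continuous_comp g f); auto. Qed.

Lemma Rcont_cos : Rcont cos.
Proof. intro t. apply (continuous_cos_comp (fun u => u)), continuous_id. Qed.

Lemma Rcont_sin : Rcont sin.
Proof. intro t. apply (continuous_sin_comp (fun u => u)), continuous_id. Qed.

Lemma Rcont_ext (f g : R -> R) : (forall t, f t = g t) -> Rcont f -> Rcont g.
Proof. intros E Hf t. apply (continuous_ext f); auto. Qed.

Lemma Rcont_ex_RInt (f : R -> R) (a b : R) : Rcont f -> ex_RInt f a b.
Proof. intro Hf. apply (ex_RInt_continuous f). intros; apply Hf. Qed.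

Definition Ccont (f : R -> C) : Prop := Rcont (fun t => fst (f t)) /\ Rcont (fun t => snd (f t)).

Lemma Ccont_const (c : C) : Ccont (fun _ => c).
Proof. split; apply Rcont_const. Qed.

Lemma Ccont_RtoC (f : R -> R) : Rcont f -> Ccont (fun t => RtoC (f t)).
Proof. intro Hf. split; simpl; [exact Hf | apply Rcont_const]. Qed.

Lemma Ccont_plus (f g : R -> C) : Ccont f -> Ccont g -> Ccont (fun t => f t + g t)%C.
Proof. intros [F1 F2] [G1 G2]. split; simpl; apply Rcont_plus; auto. Qed.

Lemma Ccont_mult (f g : R -> C) : Ccont f -> Ccont g -> Ccont (fun t => f t * g t)%C.
Proof.
  intros [F1 F2] [G1 G2]. split; simpl.
  - apply Rcont_minus; apply Rcont_mult; auto.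
  - apply Rcont_plus; apply Rcont_mult; auto.
Qed.

Lemma Ccont_minus (f g : R -> C) : Ccont f -> Ccont g -> Ccont (fun t => f t - g t)%C.
Proof.
  intros [F1 F2] [G1 G2].
  split; [apply (Rcont_minus _ _ F1 G1) | apply (Rcont_minus _ _ F2 G2)].
Qed.

Lemma Rcont_Cmod_sqr (f : R -> C) : Ccont f -> Rcont (fun t => Cmod (f t) ^ 2).
Proof.
  intros [F1 F2]. apply (Rcont_ext (fun t => fst (f t) ^ 2 + snd (f t) ^ 2)).
  - intro t. symmetry. apply Cmod_sqr.
  - apply Rcont_plus; apply Rcont_pow; auto.
Qed.

Lemma Rcont_Cmod (f : R -> C) : Ccont f -> Rcont (fun t => Cmod (f t)).
Proof.
  intros Hf t. apply (continuous_sqrt_comp (fun u => fst (f u) ^ 2 + snd (f u) ^ 2)).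
  apply (Rcont_ext (fun t => Cmod (f t) ^ 2)).
  - intro u. apply Cmod_sqr.
  - apply Rcont_Cmod_sqr, Hf.
Qed.

Lemma Cmod_sqr_neq_0 (z : C) : z <> 0%C -> fst z ^ 2 + snd z ^ 2 <> 0.
Proof.
  intro Hz. rewrite <- Cmod_sqr. apply Cmod_gt_0 in Hz. nra.
Qed.

Lemma Ccont_inv (f : R -> C) : (forall t, f t <> 0%C) -> Ccont f -> Ccont (fun t => / f t)%C.
Proof.
  intros Hn [F1 F2].
  assert (K : Rcont (fun t => / (fst (f t) ^ 2 + snd (f t) ^ 2))).
  { apply Rcont_inv. - intro t. apply Cmod_sqr_neq_0, Hn.
    - apply Rcont_plus; apply Rcont_pow; auto. }
  split; simpl; unfold Rdiv.
  - apply Rcont_mult; auto.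
  - apply Rcont_mult; auto.
    apply (Rcont_ext (fun t => 0 - snd (f t))). { intro; ring. }
    apply Rcont_minus; auto. apply Rcont_const.
Qed.

Lemma Ccont_cis (f : R -> R) : Rcont f -> Ccont (fun t => cis (f t)).
Proof.
  intro Hf. split; simpl.
  - apply (Rcont_comp cos); auto. apply Rcont_cos.
  - apply (Rcont_comp sin); auto. apply Rcont_sin.
Qed.

Lemma Ccont_comp (f : R -> C) (g : R -> R) : Ccont f -> Rcont g -> Ccont (fun t => f (g t)).
Proof.
  intros [F1 F2] Hg.
  split; [apply (Rcont_comp _ g F1 Hg) | apply (Rcont_comp _ g F2 Hg)].
Qed.

Lemma Rcont_lin (a : R) : Rcont (fun t => a * t).
Proof. apply Rcont_mult; [apply Rcont_const | apply Rcont_id]. Qed.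

Create HintDb cont.
#[local] Hint Resolve Ccont_const Ccont_RtoC Ccont_plus Ccont_mult Ccont_minus Ccont_cis Rcont_const
  Rcont_id Rcont_plus Rcont_minus Rcont_mult Rcont_lin Rcont_Cmod : cont.

Definition CI (f : R -> C) (a b : R) : C :=
  (RInt (fun t => fst (f t)) a b, RInt (fun t => snd (f t)) a b).

Lemma CI_ext (f g : R -> C) (a b : R) :
  a <= b -> (forall t, a <= t <= b -> f t = g t) -> CI f a b = CI g a b.
Proof.
  intros Hab E. unfold CI. f_equal; apply RInt_ext; intros t Ht;
    rewrite Rmin_left, Rmax_right in Ht by lra; rewrite E; auto; lra.
Qed.

Lemma CI_plus (f g : R -> C) (a b : R) : Ccont f -> Ccont g ->
  CI (fun t => f t + g t)%C a b = (CI f a b + CI g a b)%C.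
Proof.
  intros [F1 F2] [G1 G2]. unfold CI, Cplus; simpl.
  f_equal; [apply (RInt_plus (fun t => fst (f t)) (fun t => fst (g t)))
    | apply (RInt_plus (fun t => snd (f t)) (fun t => snd (g t)))]; apply Rcont_ex_RInt; auto.
Qed.

Lemma RInt_scal_R (f : R -> R) (c a b : R) : Rcont f ->
  RInt (fun t => c * f t) a b = c * RInt f a b.
Proof. intro Hf. apply (RInt_scal f). apply Rcont_ex_RInt, Hf. Qed.

Lemma CI_scal (c : C) (f : R -> C) (a b : R) : Ccont f ->
  CI (fun t => c * f t)%C a b = (c * CI f a b)%C.
Proof.
  intros [F1 F2]. unfold CI, Cmult; simpl. rewrite <- !RInt_scal_R by auto. f_equal.
  - apply (RInt_minus (fun t => fst c * fst (f t)) (fun t => snd c * snd (f t)));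
      apply Rcont_ex_RInt; auto with cont.
  - apply (RInt_plus (fun t => fst c * snd (f t)) (fun t => snd c * fst (f t)));
      apply Rcont_ex_RInt; auto with cont.
Qed.

Lemma CI_minus (f g : R -> C) (a b : R) : Ccont f -> Ccont g ->
  CI (fun t => f t - g t)%C a b = (CI f a b - CI g a b)%C.
Proof.
  intros [F1 F2] [G1 G2].
  unfold CI, Cminus, Cplus, Copp; simpl.
  f_equal; [apply (RInt_minus (fun t => fst (f t)) (fun t => fst (g t)))
    | apply (RInt_minus (fun t => snd (f t)) (fun t => snd (g t)))]; apply Rcont_ex_RInt; auto.
Qed.

Lemma CI_Chasles (f : R -> C) (a b c : R) : Ccont f -> (CI f a b + CI f b c)%C = CI f a c.
Proof.
  intros [F1 F2]. unfold CI, Cplus; simpl.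
  f_equal; [apply (RInt_Chasles (fun t => fst (f t))) | apply (RInt_Chasles (fun t => snd (f t)))];
    apply Rcont_ex_RInt; auto.
Qed.

Lemma CI_const (c : C) (a b : R) : CI (fun _ => c) a b = (RtoC (b - a) * c)%C.
Proof.
  unfold CI. rewrite !RInt_const. unfold scal; simpl. unfold mult; simpl.
  unfold Cmult; simpl. f_equal; ring.
Qed.

Lemma CI_RtoC (f : R -> R) (a b : R) : CI (fun t => RtoC (f t)) a b = RtoC (RInt f a b).
Proof.
  unfold CI, RtoC; simpl. f_equal. rewrite RInt_const. unfold scal; simpl; unfold mult; simpl. ring.
Qed.

Lemma fst_le_Cmod (z : C) : fst z <= Cmod z.
Proof. eapply Rle_trans; [apply Rle_abs | apply (re_le_Cmod z)]. Qed.

(* Multiplying [f] by the conjugate of the integral makes the integral real. *)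
Lemma CI_le (f : R -> C) (g : R -> R) (a b : R) : a <= b -> Ccont f -> Rcont g ->
  (forall t, a <= t <= b -> Cmod (f t) <= g t) -> Cmod (CI f a b) <= RInt g a b.
Proof.
  intros Hab Hf Hg Hfg.
  set (I := CI f a b).
  assert (E : Cmod I * Cmod I = fst (CI (fun t => Cconj I * f t)%C a b)).
  { rewrite CI_scal by auto. fold I. replace (Cmod I * Cmod I) with (Cmod I ^ 2) by ring. rewrite Cmod_sqr. simpl. ring. }
  assert (B : fst (CI (fun t => Cconj I * f t)%C a b) <= Cmod I * RInt g a b).
  { rewrite <- RInt_scal_R by auto.
    apply RInt_le; auto.
    - apply Rcont_ex_RInt. apply (Ccont_mult (fun _ => Cconj I) f); auto with cont.
    - apply Rcont_ex_RInt; auto with cont.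
    - intros t Ht. eapply Rle_trans; [apply fst_le_Cmod|].
      rewrite Cmod_mult, Cmod_conj.
      apply Rmult_le_compat_l; [apply Cmod_ge_0 | apply Hfg; lra]. }
  assert (P : 0 <= RInt g a b).
  { apply RInt_ge_0; auto.
    - apply Rcont_ex_RInt; auto.
    - intros t Ht. eapply Rle_trans; [apply Cmod_ge_0 | apply Hfg; lra]. }
  pose proof (Cmod_ge_0 I). nra.
Qed.

Lemma CI_le_const (f : R -> C) (M a b : R) : a <= b -> Ccont f ->
  (forall t, a <= t <= b -> Cmod (f t) <= M) -> Cmod (CI f a b) <= (b - a) * M.
Proof.
  intros Hab Hf HM.
  replace ((b - a) * M) with (RInt (fun _ => M) a b).
  - apply CI_le; auto with cont.
  - rewrite RInt_const. reflexivity.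
Qed.

Lemma RInt_comp_scal (f : R -> R) (u a b : R) : Rcont f ->
  RInt (fun t => u * f (u * t)) a b = RInt f (u * a) (u * b).
Proof.
  intro Hf. rewrite <- (Rplus_0_r (u * a)), <- (Rplus_0_r (u * b)).
  rewrite <- (RInt_comp_lin f u 0) by (apply Rcont_ex_RInt; auto).
  apply RInt_ext. intros t _. rewrite Rplus_0_r. reflexivity.
Qed.

Lemma CI_comp_scal (f : R -> C) (u a b : R) : Ccont f ->
  CI (fun t => RtoC u * f (u * t)%R)%C a b = CI f (u * a) (u * b).
Proof.
  intros [F1 F2]. unfold CI; simpl. f_equal.
  - rewrite <- (RInt_comp_scal (fun t => fst (f t))) by auto. apply RInt_ext. intros t _. simpl. match goal with |- @eq _ ?x ?y => change (@eq R x y) end. ring.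
  - rewrite <- (RInt_comp_scal (fun t => snd (f t))) by auto. apply RInt_ext. intros t _. simpl. match goal with |- @eq _ ?x ?y => change (@eq R x y) end. ring.
Qed.

Lemma CI_cis (v a b : R) : (Ci * RtoC v * CI (fun t => cis (v * t)) a b = cis (v * b) - cis (v * a))%C.
Proof.
  assert (D1 : RInt (fun t => - v * sin (v * t)) a b = cos (v * b) - cos (v * a)).
  { apply is_RInt_unique, (is_RInt_derive (fun t => cos (v * t))).
    - intros. auto_derive; auto. ring.
    - intros t _. apply (Rcont_mult (fun _ => - v) (fun t => sin (v * t))).
      apply Rcont_const. apply (Rcont_comp sin); [apply Rcont_sin | apply Rcont_lin]. }
  assert (D2 : RInt (fun t => v * cos (v * t)) a b = sin (v * b) - sin (v * a)).
  { apply is_RInt_unique, (is_RInt_derive (fun t => sin (v * t))).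
    - intros. auto_derive; auto. ring.
    - intros t _. apply (Rcont_mult (fun _ => v) (fun t => cos (v * t))).
      apply Rcont_const. apply (Rcont_comp cos); [apply Rcont_cos | apply Rcont_lin]. }
  rewrite RInt_scal_R in D1, D2.
  2: apply (Rcont_comp cos); [apply Rcont_cos | apply Rcont_lin].
  2: apply (Rcont_comp sin); [apply Rcont_sin | apply Rcont_lin].
  unfold CI, cis, Ci, Cmult, Cminus, Cplus, Copp, RtoC; simpl. f_equal; lra.
Qed.

(** * Mean values of rational functions on the unit circle *)

(** Iteration gives [E k = a^m * E (k + m)], and boundedness lets m tend to infinity. This
    uniqueness statement takes the place of power series expansions in the computations on the
    circle. *)
Lemma backward_recurrence_zero (E : nat -> C) (a : C) (K : R) :
  Cmod a < 1 -> (forall k, Cmod (E k) <= K) -> (forall k, E k = a * E (S k))%C ->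
  forall k, E k = 0%C.
Proof.
  intros Ha HK HE k.
  assert (P : forall m, E k = (a ^ m * E (k + m)%nat)%C).
  { induction m as [|m IH]; simpl.
    - rewrite Nat.add_0_r. ring.
    - rewrite IH, (HE (k + m)%nat), <- plus_n_Sm. ring. }
  apply Cmod_eq_0. apply Rle_antisym; [|apply Cmod_ge_0].
  apply le_epsilon. intros e He.
  assert (HK0 : 0 <= K) by (eapply Rle_trans; [apply Cmod_ge_0 | apply (HK 0%nat)]).
  destruct (pow_lt_1_zero (Cmod a) ltac:(rewrite Rabs_pos_eq by apply Cmod_ge_0; auto)
    (e / (K + 1)) ltac:(apply Rdiv_lt_0_compat; lra)) as [m Hm].
  specialize (Hm m (Nat.le_refl m)).
  rewrite Rabs_pos_eq in Hm by (apply pow_le, Cmod_ge_0).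
  rewrite (P m), Cmod_mult, Cmod_pow.
  pose proof (HK (k + m)%nat).
  assert (Cmod a ^ m * (K + 1) <= e).
  { apply Rlt_le, (Rmult_le_compat_r (K + 1)) in Hm; [|lra].
    replace (e / (K + 1) * (K + 1)) with e in Hm by (field; lra). lra. }
  pose proof (pow_le (Cmod a) m (Cmod_ge_0 a)). pose proof (Cmod_ge_0 (E (k + m)%nat)). nra.
Qed.

Lemma Csub_0_eq (u v : C) : (u - v = 0)%C -> u = v.
Proof. intro E. replace u with (u - v + v)%C by ring. rewrite E. ring. Qed.

Lemma one_minus_neq_0 (z : C) : Cmod z < 1 -> (1 - z <> 0)%C.
Proof.
  intros Hz E. assert (z = 1)%C by (replace z with (1 - (1 - z))%C by ring; rewrite E; ring).
  subst. rewrite Cmod_1 in Hz. lra.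
Qed.

Lemma Cmod_mult_cis (a : C) (x : R) : Cmod (a * cis x)%C = Cmod a.
Proof. rewrite Cmod_mult, Cmod_cis. ring. Qed.

Lemma Ccont_geom (a : C) : Cmod a < 1 -> Ccont (fun x => / (1 - a * cis x))%C.
Proof.
  intro Ha. apply Ccont_inv.
  - intro t. apply one_minus_neq_0. rewrite Cmod_mult_cis. exact Ha.
  - auto with cont.
Qed.

Definition cisn (k : nat) (x : R) : C := cis (INR k * x).

Lemma cisn_S (k : nat) (x : R) : cisn (S k) x = (cis x * cisn k x)%C.
Proof. unfold cisn. rewrite <- cis_plus, S_INR. f_equal. ring. Qed.

Lemma Ccont_cisn (k : nat) : Ccont (cisn k).
Proof. unfold cisn. auto with cont. Qed.

Lemma Ccont_cis1 : Ccont cis.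
Proof. apply (Ccont_cis (fun t => t)), Rcont_id. Qed.
#[local] Hint Resolve Ccont_cisn Ccont_cis1 : cont.

(** The Poisson kernel at the point r of the disc without its factor [1 - r ^ 2]; its total mass is
    divided out later. *)
Definition poisson (r x : R) : R := / (1 - 2 * r * cos x + r ^ 2).

Section Circle.
Variable r : R.
Hypothesis Hr : 0 < r < 1.

Definition Pint (g : R -> C) (k : nat) : C :=
  CI (fun x => cisn k x * (g x * RtoC (poisson r x)))%C (- PI) PI.

Lemma poisson_pos (x : R) : 0 < poisson r x.
Proof. apply Rinv_0_lt_compat. pose proof (COS_bound x). nra. Qed.

Lemma Rcont_poisson : Rcont (poisson r).
Proof.
  apply Rcont_inv.
  - intro t. pose proof (poisson_pos t) as P. unfold poisson in P. intro E. rewrite E, Rinv_0 in P. lra.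
  - apply Rcont_plus; auto with cont. apply Rcont_minus; auto with cont.
    apply (Rcont_mult (fun _ => 2 * r) cos); auto with cont. apply Rcont_cos.
Qed.
#[local] Hint Resolve Rcont_poisson : cont.

Definition poisson_integral : R := RInt (poisson r) (- PI) PI.

Lemma poisson_integral_pos : 0 < poisson_integral.
Proof.
  apply RInt_gt_0.
  - pose proof PI_RGT_0. lra.
  - intros; apply poisson_pos.
  - intros. apply Rcont_poisson.
Qed.

Lemma CI_cisn (k : nat) : (0 < k)%nat -> CI (cisn k) (- PI) PI = 0%C.
Proof.
  intro Hk. pose proof (CI_cis (INR k) (- PI) PI) as E.
  assert (N : INR k <> 0) by (apply not_0_INR; lia).
  assert (Z : (cis (INR k * PI) - cis (INR k * - PI) = 0)%C).
  { replace (INR k * PI) with (INR k * - PI + 2 * INR k * PI) by ring.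
    unfold cis. rewrite cos_period, sin_period. ring. }
  rewrite Z in E. fold (cisn k) in E.
  change (fun t : R => cis (INR k * t)) with (cisn k) in E.
  assert (NN : (Ci * RtoC (INR k) <> 0)%C).
  { apply Cmod_gt_0. rewrite Cmod_mult, Cmod_Ci, Cmod_R. apply Rabs_pos_lt in N. lra. }
  replace (CI (cisn k) (- PI) PI) with (/ (Ci * RtoC (INR k)) * (Ci * RtoC (INR k) * CI (cisn k) (- PI) PI))%C
    by (field; split; intro F; apply NN; rewrite F; ring).
  rewrite E. ring.
Qed.

(** Multiplying by [1 - r * cis x] leaves the mean of [cisn k], which is 0; so these means satisfy
    the homogeneous recurrence of [backward_recurrence_zero]. *)
Lemma geom_mean_zero (k : nat) : (0 < k)%nat ->
  CI (fun x => cisn k x * / (1 - RtoC r * cis x))%C (- PI) PI = 0%C.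
Proof.
  intro Hk. destruct k as [|k]; [lia|]. clear Hk.
  assert (Hm : Cmod (RtoC r) < 1) by (rewrite Cmod_R, Rabs_pos_eq; lra).
  pose proof (Ccont_geom _ Hm) as Hc.
  revert k. apply (backward_recurrence_zero _ (RtoC r)
    (RInt (fun x => Cmod (/ (1 - RtoC r * cis x))%C) (- PI) PI)); auto.
  - intro k. apply CI_le; auto with cont. { pose proof PI_RGT_0; lra. }
    intros t _. unfold cisn. rewrite Cmod_mult, Cmod_cis. lra.
  - intro k. rewrite <- CI_scal by auto with cont.
    apply Csub_0_eq. rewrite <- CI_minus by auto with cont.
    rewrite <- (CI_cisn (S k)) by lia.
    apply CI_ext. { pose proof PI_RGT_0; lra. }
    intros t _. rewrite (cisn_S (S k)). field.
    apply one_minus_neq_0. rewrite Cmod_mult_cis. exact Hm.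
Qed.

Lemma poisson_factor (x : R) :
  (RtoC (poisson r x) * ((1 - RtoC r * cis x) * (1 - RtoC r * cis (- x))) = 1)%C.
Proof.
  pose proof (poisson_pos x) as P. unfold poisson in *.
  assert (D : 1 - 2 * r * cos x + r ^ 2 <> 0) by (intro E; rewrite E, Rinv_0 in P; lra).
  pose proof (sin2_cos2 x) as E. unfold Rsqr in E.
  assert (Q : ((1 - RtoC r * cis x) * (1 - RtoC r * cis (- x)))%C = RtoC (1 - 2 * r * cos x + r ^ 2)).
  { unfold cis. rewrite cos_neg, sin_neg.
    unfold Cmult, Cminus, Cplus, Copp, RtoC; simpl. f_equal; nra. }
  rewrite Q. rewrite <- RtoC_mult. rewrite Rinv_l by auto. reflexivity.
Qed.

Lemma cis_neg_r (x : R) : (cis x * cis (- x) = 1)%C.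
Proof. rewrite <- cis_plus, Rplus_opp_r. apply cis_0. Qed.

(** [Pint (S k) - r * Pint k] integrates [cisn (S k)] times [(1 - r * cis (- x)) * poisson r x],
    that is, [cisn (S k) / (1 - r * cis x)], whose mean vanishes. *)
Lemma Pint_one (k : nat) : Pint (fun _ => 1%C) k = (RtoC (r ^ k) * RtoC poisson_integral)%C.
Proof.
  induction k as [|k IH].
  - unfold Pint, poisson_integral. simpl pow. rewrite Cmult_1_l, <- CI_RtoC.
    apply CI_ext. { pose proof PI_RGT_0; lra. }
    intros t _. unfold cisn. simpl. rewrite Rmult_0_l, cis_0. ring.
  - assert (E : (Pint (fun _ => 1%C) (S k) - RtoC r * Pint (fun _ => 1%C) k = 0)%C).
    { unfold Pint. rewrite <- CI_scal, <- CI_minus by auto 8 with cont.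
      rewrite <- (geom_mean_zero (S k)) by lia.
      apply CI_ext. { pose proof PI_RGT_0; lra. }
      intros t _. pose proof (poisson_factor t) as Q. pose proof (cis_neg_r t) as N.
      assert (H1 : (1 - RtoC r * cis t <> 0)%C).
      { apply one_minus_neq_0. rewrite Cmod_mult_cis, Cmod_R, Rabs_pos_eq; lra. }
      rewrite cisn_S.
      replace (cis t * cisn k t * (1 * RtoC (poisson r t)) - RtoC r * (cisn k t * (1 * RtoC (poisson r t))))%C
        with (cis t * cisn k t * (RtoC (poisson r t) * ((1 - RtoC r * cis t) * (1 - RtoC r * cis (- t)))
               * / (1 - RtoC r * cis t)) + cisn k t * RtoC r * RtoC (poisson r t) * (cis t * cis (- t) - 1))%C
        by (field; auto).
      rewrite Q, N. ring. }
    rewrite IH in E. simpl pow. rewrite RtoC_mult.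
    replace (Pint (fun _ => 1%C) (S k)) with
      (Pint (fun _ => 1%C) (S k) - RtoC r * (RtoC (r ^ k) * RtoC poisson_integral) + RtoC r * (RtoC (r ^ k) * RtoC poisson_integral))%C by ring.
    rewrite E. ring.
Qed.

(** The real part of [Pint_one] at k = 1 evaluates the integral of [cos x * poisson r x]; inserting
    it into the integral of [(1 - 2 r cos x + r^2) * poisson r x = 1] determines the mass. *)
Lemma poisson_integral_eq : (1 - r ^ 2) * poisson_integral = 2 * PI.
Proof.
  pose proof (Pint_one 1) as E. apply (f_equal fst) in E.
  replace (fst (RtoC (r ^ 1) * RtoC poisson_integral)%C) with (r * poisson_integral) in E by (simpl; ring).
  unfold Pint, CI in E; cbn [fst] in E.
  assert (F : (1 + r ^ 2) * poisson_integral - 2 * r * (r * poisson_integral) = 2 * PI).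
  { rewrite <- E. unfold poisson_integral.
    rewrite <- !RInt_scal_R by first [apply Rcont_poisson |
      apply (Ccont_mult (cisn 1) (fun x => 1 * RtoC (poisson r x))%C); auto with cont].
    replace (2 * PI) with (RInt (fun _ => 1) (- PI) PI)
      by (rewrite RInt_const; unfold scal; simpl; unfold mult; simpl; ring).
    symmetry. erewrite RInt_ext.
    - apply (RInt_minus (fun x => (1 + r ^ 2) * poisson r x)
        (fun x => 2 * r * fst (cisn 1 x * (1 * RtoC (poisson r x)))%C)); apply Rcont_ex_RInt; auto with cont.
      apply Rcont_mult; auto with cont.
      apply (Ccont_mult (cisn 1) (fun x => 1 * RtoC (poisson r x))%C); auto with cont.
    - intros x _. unfold minus, plus, opp; simpl. rewrite Rmult_1_l.
      pose proof (poisson_pos x) as P. unfold poisson in *.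
      assert (D : 1 - 2 * r * cos x + r ^ 2 <> 0) by (intro G; rewrite G, Rinv_0 in P; lra).
      match goal with |- @eq _ ?x ?y => change (@eq R x y) end.
      simpl in D. field. exact D. }
  lra.
Qed.

(** The Poisson formula at r for the functions w^k g(w). All k are required at once because
    [mean_value_ratio] passes between k and k + 1. *)
Definition mean_value (g : C -> C) : Prop :=
  Ccont (fun x => g (cis x)) /\
  forall k, Pint (fun x => g (cis x)) k = (RtoC (r ^ k) * g (RtoC r) * RtoC poisson_integral)%C.

Lemma mean_value_one : mean_value (fun _ => 1%C).
Proof. split; auto with cont. intro k. rewrite Pint_one. ring. Qed.

(** For [g1 = g / (1 - a w)] the quantities [Pint g1 k - a * Pint g1 (S k)] are known, and the
    expected values [r^k * Q] satisfy the same relation. The difference is a bounded solution of the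
    homogeneous recurrence, hence 0; multiplication by [1 - b w] only combines k and k + 1. *)
Lemma mean_value_ratio (g : C -> C) (a b : C) : Cmod a < 1 -> mean_value g ->
  mean_value (fun w => (1 - b * w) / (1 - a * w) * g w)%C.
Proof.
  intros Ha [Gc Gm]. pose proof (Ccont_geom a Ha) as Hc.
  assert (Nr : (1 - a * RtoC r <> 0)%C).
  { apply one_minus_neq_0. rewrite Cmod_mult, Cmod_R, Rabs_pos_eq by lra.
    pose proof (Cmod_ge_0 a). nra. }
  assert (Nc : forall x, (1 - a * cis x <> 0)%C).
  { intro x. apply one_minus_neq_0. rewrite Cmod_mult_cis. auto. }
  set (g1 := fun x => (/ (1 - a * cis x) * g (cis x))%C).
  assert (G1c : Ccont g1) by (unfold g1; auto with cont).
  assert (R1 : forall k, (Pint g1 k - a * Pint g1 (S k))%C = Pint (fun x => g (cis x)) k).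
  { intro k. unfold Pint. rewrite <- CI_scal, <- CI_minus by auto 8 with cont.
    apply CI_ext. { pose proof PI_RGT_0; lra. }
    intros t _. unfold g1. rewrite cisn_S. field. apply Nc. }
  set (Q := (g (RtoC r) / (1 - a * RtoC r) * RtoC poisson_integral)%C).
  assert (Z : forall k, (Pint g1 k - RtoC (r ^ k) * Q)%C = 0%C).
  { apply (backward_recurrence_zero _ a
      (RInt (fun x => Cmod (g1 x * RtoC (poisson r x))%C) (- PI) PI + Cmod Q)); auto.
    - intro k. eapply Rle_trans; [apply Cmod_triangle|]. apply Rplus_le_compat.
      + apply CI_le; auto with cont. { pose proof PI_RGT_0; lra. }
        intros t _. unfold cisn. rewrite Cmod_mult, Cmod_cis. lra.
      + rewrite Cmod_opp, Cmod_mult, Cmod_R, Rabs_pos_eq by (apply pow_le; lra).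
        pose proof (Cmod_ge_0 Q).
        assert (r ^ k <= 1) by (rewrite <- (pow1 k); apply pow_incr; lra). nra.
    - intro k. specialize (R1 k). rewrite Gm in R1.
      replace (Pint g1 k) with (Pint g1 k - a * Pint g1 (S k) + a * Pint g1 (S k))%C by ring.
      rewrite R1. unfold Q. simpl pow. rewrite RtoC_mult. field. exact Nr. }
  split.
  - unfold Cdiv. auto with cont.
  - intro k.
    replace (Pint (fun x => ((1 - b * cis x) / (1 - a * cis x) * g (cis x))%C) k)
      with (Pint g1 k - b * Pint g1 (S k))%C.
    + replace (Pint g1 k) with (Pint g1 k - RtoC (r ^ k) * Q + RtoC (r ^ k) * Q)%C by ring.
      replace (Pint g1 (S k)) with (Pint g1 (S k) - RtoC (r ^ S k) * Q + RtoC (r ^ S k) * Q)%C by ring.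
      rewrite !Z. unfold Q. simpl pow. rewrite RtoC_mult. field. exact Nr.
    + unfold Pint. rewrite <- CI_scal, <- CI_minus by auto 8 with cont.
      apply CI_ext. { pose proof PI_RGT_0; lra. }
      intros t _. unfold g1. rewrite cisn_S. field. apply Nc.
Qed.

End Circle.

(** * Outer functions *)

(** The range 9/2 is what [tau * (x - c)] needs when [|tau * x| <= PI <= 4] and [|tau * c| <= 1/2].
    The constant 100 is crude. *)
Lemma one_minus_cos_ge (u : R) : Rabs u <= 9 / 2 -> u ^ 2 / 100 <= 1 - cos u.
Proof.
  assert (P : forall v, 0 <= v <= 9 / 4 -> v / 7 <= sin v).
  { intros v Hv. destruct (pre_sin_bound v 0) as [L _]; [lra|lra|].
    unfold sin_approx, sin_term in L. simpl in L. nra. }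
  intro Hu. rewrite one_minus_cos.
  assert (Q : (u / 2) ^ 2 / 49 <= sin (u / 2) ^ 2).
  { unfold Rabs in Hu. destruct (Rcase_abs u).
    - specialize (P (- (u / 2)) ltac:(lra)). rewrite sin_neg in P. nra.
    - specialize (P (u / 2) ltac:(lra)). nra. }
  nra.
Qed.

Lemma Cmod_one_minus_sqr (s x : R) : Cmod (1 - RtoC s * cis x)%C ^ 2 = 1 - 2 * s * cos x + s ^ 2.
Proof.
  rewrite Cmod_sqr. unfold cis; simpl. pose proof (sin2_cos2 x) as E. unfold Rsqr in E. nra.
Qed.

Section Factor.
Variables tau c e : R.

(** With w = e^{i tau z}, the zero of [1 - pole * w] lies, to first order in tau, at z = c - i e,
    and the zero of the numerator of [factor] at z = c - 2 i e. So [pole] is the reciprocal of the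
    actual pole in the w-plane. *)
Definition pole : C := (RtoC (1 - e * tau) * cis (- (tau * c)))%C.

Definition factor (w : C) : C := ((1 - RtoC (1 - e * tau) * pole * w) / (1 - pole * w))%C.

Hypothesis Htau : 0 < tau.
Hypothesis He : 0 < e.
Hypothesis Hte : e * tau <= 1 / 2.

Lemma Cmod_pole : Cmod pole = 1 - e * tau.
Proof. unfold pole. rewrite Cmod_mult_cis, Cmod_R, Rabs_pos_eq; lra. Qed.

Lemma Cmod_pole_lt_1 : Cmod pole < 1.
Proof. rewrite Cmod_pole. nra. Qed.

Lemma pole_denom (w : C) : Cmod w <= 1 -> (1 - pole * w <> 0)%C.
Proof.
  intro Hw. apply one_minus_neq_0. rewrite Cmod_mult, Cmod_pole. pose proof (Cmod_ge_0 w). nra.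
Qed.

Lemma factor_sqr (q x : R) : 0 <= q <= 1 ->
  Cmod (factor (RtoC q * cis x))%C ^ 2 * (1 - 2 * (q * (1 - e * tau)) * cos (x - tau * c) + (q * (1 - e * tau)) ^ 2)
  = 1 - 2 * (q * (1 - e * tau) ^ 2) * cos (x - tau * c) + (q * (1 - e * tau) ^ 2) ^ 2.
Proof.
  intro Hq. unfold factor.
  assert (D := pole_denom (RtoC q * cis x)%C). rewrite Cmod_mult_cis, Cmod_R, Rabs_pos_eq in D by lra.
  rewrite Cmod_div by (apply D; lra).
  assert (E1 : (1 - pole * (RtoC q * cis x))%C = (1 - RtoC (q * (1 - e * tau)) * cis (x - tau * c))%C).
  { unfold pole. replace (x - tau * c) with (x + - (tau * c)) by ring. rewrite cis_plus, !RtoC_mult. ring. }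
  assert (E2 : (1 - RtoC (1 - e * tau) * pole * (RtoC q * cis x))%C
    = (1 - RtoC (q * (1 - e * tau) ^ 2) * cis (x - tau * c))%C).
  { unfold pole. replace (x - tau * c) with (x + - (tau * c)) by ring. rewrite cis_plus, !RtoC_mult, RtoC_pow. simpl. ring. }
  rewrite E2, <- !Cmod_one_minus_sqr, E1.
  assert (D2 : Cmod (1 - RtoC (q * (1 - e * tau)) * cis (x - tau * c))%C <> 0).
  { rewrite <- E1. apply Rgt_not_eq, Cmod_gt_0, D. lra. }
  field. exact D2.
Qed.

(** As tau tends to 0 the left side becomes |x - c + 2 i e|^2 / |x - c + i e|^2 = 1 + 3 e^2 / (e^2 +
    (x - c)^2). The 100 is the price of bounding the cosine for all tau allowed. *)
Lemma factor_circle_le (x : R) : Rabs (tau * (x - c)) <= 9 / 2 ->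
  Cmod (factor (cis (tau * x))) ^ 2 <= 1 + 3 * e ^ 2 / (e ^ 2 + (x - c) ^ 2 / 100).
Proof.
  intro Hx. pose proof (factor_sqr 1 (tau * x) ltac:(lra)) as E.
  rewrite !Rmult_1_l, Cmult_1_l in E.
  replace (tau * x - tau * c) with (tau * (x - c)) in E by ring.
  pose proof (one_minus_cos_ge _ Hx) as B. pose proof (COS_bound (tau * (x - c))) as CB.
  set (K := cos (tau * (x - c))) in *. set (F := Cmod _) in *.
  set (d := (x - c) ^ 2 / 100).
  assert (Hd : 0 <= d) by (unfold d; pose proof (pow2_ge_0 (x - c)); lra).
  assert (HB : tau ^ 2 * d <= 1 - K) by (unfold d; nra).
  set (u := e * tau) in *. assert (Hu : 0 < u) by (unfold u; nra).
  set (D := 1 - 2 * (1 - u) * K + (1 - u) ^ 2) in *.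
  assert (HD : tau ^ 2 * (e ^ 2 + d) <= D).
  { replace D with (u ^ 2 + 2 * (1 - u) * (1 - K)) by (unfold D; ring).
    replace (u ^ 2) with (tau ^ 2 * e ^ 2) by (unfold u; ring). nra. }
  assert (Hp : 0 < e ^ 2 + d) by nra.
  assert (Hp2 : 0 < tau ^ 2 * (e ^ 2 + d)) by (apply Rmult_lt_0_compat; auto; nra).
  assert (HN : F ^ 2 * D <= D + 3 * u ^ 2).
  { rewrite E. unfold D.
    assert (Hz : 0 <= u * (1 - u) * (1 - K)) by (apply Rmult_le_pos; nra).
    assert (Hz2 : 0 <= u ^ 2) by nra.
    nra. }
  apply (Rmult_le_reg_r (D * (e ^ 2 + d))). { apply Rmult_lt_0_compat; lra. }
  replace ((1 + 3 * e ^ 2 / (e ^ 2 + d)) * (D * (e ^ 2 + d))) with (D * (e ^ 2 + d) + 3 * e ^ 2 * D) by (field; lra).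
  assert (u ^ 2 * (e ^ 2 + d) <= e ^ 2 * D).
  { replace (u ^ 2) with (e ^ 2 * tau ^ 2) by (unfold u; ring). nra. }
  nra.
Qed.

(** Here r plays e^{- y tau}, the image of z = i y. In the limit the left ratio is 1 + (2 e y + 3
    e^2) / ((e + y)^2 + c^2); keeping only a fraction of the term in e y absorbs the effect of
    positive tau. *)
Lemma factor_real_ge (y r : R) : 0 < y -> 1 / 2 <= r <= 1 ->
  y * tau / 2 <= 1 - r <= y * tau -> 2 * tau * c ^ 2 <= y ->
  1 + e * y / (8 * ((e + y) ^ 2 + c ^ 2)) <= Cmod (factor (RtoC r)) ^ 2.
Proof.
  intros Hy Hr Hr2 Hc.
  assert (E := factor_sqr r 0). rewrite cis_0, Cmult_1_r in E. specialize (E ltac:(lra)).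
  replace (0 - tau * c) with (- (tau * c)) in E by ring. rewrite cos_neg in E.
  set (F := Cmod _) in *. set (K := cos (tau * c)) in *.
  assert (HK : 1 - (tau * c) ^ 2 / 2 <= K <= 1).
  { unfold K. pose proof (COS_bound (tau * c)). pose proof (one_minus_cos (tau * c)).
    pose proof (sin_sqr_le (tau * c / 2)). nra. }
  set (u := e * tau) in *. assert (Hu : 0 < u) by (unfold u; nra).
  set (v := r * (1 - u)) in *.
  assert (Hv : 1 / 4 <= v < 1) by (unfold v; nra).
  set (D := 1 - 2 * v * K + v ^ 2) in *.
  assert (Hv1 : 1 - v <= tau * (e + y)) by (unfold v, u in *; nra).
  assert (Hv2 : y * tau / 2 <= 1 - v) by (unfold v; nra).
  assert (Hcc : 0 <= c ^ 2) by apply pow2_ge_0.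
  assert (Htc : (tau * c) ^ 2 <= tau * y / 2) by nra.
  assert (HD : D <= tau ^ 2 * ((e + y) ^ 2 + c ^ 2)).
  { replace D with ((1 - v) ^ 2 + 2 * v * (1 - K)) by (unfold D; ring).
    assert ((1 - v) ^ 2 <= (tau * (e + y)) ^ 2) by (apply pow_incr; lra).
    assert (2 * v * (1 - K) <= 2 * 1 * ((tau * c) ^ 2 / 2)).
    { apply Rmult_le_compat; nra. }
    nra. }
  assert (HD0 : 0 < D).
  { replace D with ((1 - v) ^ 2 + 2 * v * (1 - K)) by (unfold D; ring). nra. }
  assert (HN : D + e * y * tau ^ 2 / 8 <= F ^ 2 * D).
  { rewrite E. replace (r * (1 - u) ^ 2) with (v * (1 - u)) by (unfold v; ring).
    unfold D.
    assert (X : 2 * v * u * (y * tau / 4) <= 2 * v * u * (K - v)).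
    { apply Rmult_le_compat_l; [nra|]. nra. }
    assert (Y : e * y * tau ^ 2 / 8 <= 2 * v * u * (y * tau / 4)).
    { replace (2 * v * u * (y * tau / 4)) with (v * (e * y * tau ^ 2) / 2) by (unfold u; field).
      assert (0 < e * y * tau ^ 2) by (apply Rmult_lt_0_compat; nra). nra. }
    assert (W : 0 <= v ^ 2 * u ^ 2) by nra.
    nra. }
  set (Z := (e + y) ^ 2 + c ^ 2) in *. assert (HZ : 0 < Z) by (unfold Z; nra).
  apply (Rmult_le_reg_r (8 * D * Z)). { apply Rmult_lt_0_compat; lra. }
  replace ((1 + e * y / (8 * Z)) * (8 * D * Z)) with (8 * D * Z + e * y * D) by (field; lra).
  assert (e * y * D <= e * y * (tau ^ 2 * Z)) by (apply Rmult_le_compat_l; nra).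
  nra.
Qed.

End Factor.

(** * Products of factors and the representation of exponentials *)

Fixpoint outer (tau : R) (L : list (R * R)) (w : C) : C :=
  match L with
  | nil => 1%C
  | (c, e) :: L' => (factor tau c e w * outer tau L' w)%C
  end.

(** [circle_bound] and [center_bound] estimate squared moduli of [outer] and do not contain [tau],
    so that [tau] can be chosen last. *)
Fixpoint circle_bound (L : list (R * R)) (x : R) : R :=
  match L with
  | nil => 1
  | (c, e) :: L' => (1 + 3 * e ^ 2 / (e ^ 2 + (x - c) ^ 2 / 100)) * circle_bound L' x
  end.

Fixpoint center_bound (y : R) (L : list (R * R)) : R :=
  match L with
  | nil => 1
  | (c, e) :: L' => (1 + e * y / (8 * ((e + y) ^ 2 + c ^ 2))) * center_bound y L'
  end.

Definition positive_radii (L : list (R * R)) : Prop := forall c e, In (c, e) L -> 0 < e.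

Lemma positive_radii_inv (c e : R) (L : list (R * R)) :
  positive_radii ((c, e) :: L) -> 0 < e /\ positive_radii L.
Proof.
  intro H. split.
  - apply (H c e). left. reflexivity.
  - intros c' e' H'. apply (H c' e'). right. exact H'.
Qed.

Lemma circle_term_bounds (c e x : R) : 0 < e ->
  0 <= 3 * e ^ 2 / (e ^ 2 + (x - c) ^ 2 / 100) <= 3.
Proof.
  intro He. assert (0 < e ^ 2) by nra. pose proof (pow2_ge_0 (x - c)).
  split.
  - apply Rle_mult_inv_pos; lra.
  - apply (Rmult_le_reg_r (e ^ 2 + (x - c) ^ 2 / 100)); [lra|].
    unfold Rdiv at 1. rewrite Rmult_assoc, Rinv_l by lra. lra.
Qed.

Lemma circle_bound_bounds (L : list (R * R)) (x : R) : positive_radii L ->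
  1 <= circle_bound L x <= 4 ^ length L.
Proof.
  induction L as [|[c e] L IH]; intro H; simpl; [lra|].
  apply positive_radii_inv in H. destruct H as [He H]. specialize (IH H).
  pose proof (circle_term_bounds c e x He) as T. simpl in T. nra.
Qed.

Lemma center_term_pos (y c e : R) : 0 < y -> 0 < e -> 0 < e * y / (8 * ((e + y) ^ 2 + c ^ 2)).
Proof.
  intros Hy He. apply Rdiv_lt_0_compat; [nra|]. pose proof (pow2_ge_0 c). nra.
Qed.

Lemma center_bound_ge_1 (y : R) (L : list (R * R)) : 0 < y -> positive_radii L ->
  1 <= center_bound y L.
Proof.
  intro Hy. induction L as [|[c e] L IH]; intro H; simpl; [lra|].
  apply positive_radii_inv in H. destruct H as [He H]. specialize (IH H).
  pose proof (center_term_pos y c e Hy He) as T. simpl in T. nra.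
Qed.

Lemma data_bound (L : list (R * R)) : positive_radii L ->
  exists T, 0 < T /\ forall c e, In (c, e) L -> e <= T /\ Rabs c <= T /\ c ^ 2 <= T.
Proof.
  induction L as [|[c e] L IH]; intro H.
  - exists 1. split; [lra|]. intros ? ? [].
  - apply positive_radii_inv in H. destruct H as [He H]. destruct (IH H) as [T [HT HL]].
    pose proof (Rabs_pos c). pose proof (pow2_ge_0 c).
    exists (T + e + Rabs c + c ^ 2). split; [lra|].
    intros c' e' [E|E].
    + injection E; intros; subst. repeat split; lra.
    + destruct (HL _ _ E) as [? [? ?]]. repeat split; lra.
Qed.

(** Smallness of tau: the second condition keeps the poles well placed, the third keeps
    [tau * (x - c)] in the range of [one_minus_cos_ge], and the fourth makes [1 - cos (tau * c)]
    small against [y * tau] at the center. *)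
Definition admissible_step (tau y : R) (L : list (R * R)) : Prop :=
  forall c e, In (c, e) L ->
    0 < e /\ e * tau <= 1 / 2 /\ tau * Rabs c <= 1 / 2 /\ 2 * tau * c ^ 2 <= y.

Lemma admissible_step_inv (tau y c e : R) (L : list (R * R)) :
  admissible_step tau y ((c, e) :: L) ->
  (0 < e /\ e * tau <= 1 / 2 /\ tau * Rabs c <= 1 / 2 /\ 2 * tau * c ^ 2 <= y) /\ admissible_step tau y L.
Proof.
  intro H. split.
  - apply H. left. reflexivity.
  - intros c' e' H'. apply H. right. exact H'.
Qed.

Lemma outer_circle_le (tau y : R) (L : list (R * R)) (x : R) :
  0 < tau -> admissible_step tau y L -> Rabs (tau * x) <= PI ->
  Cmod (outer tau L (cis (tau * x))) ^ 2 <= circle_bound L x.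
Proof.
  intros Ht H Hx. induction L as [|[c e] L IH]; cbn [outer circle_bound].
  - rewrite Cmod_1. lra.
  - apply admissible_step_inv in H. destruct H as [[He [He2 [Hc _]]] H].
    rewrite Cmod_mult, Rpow_mult_distr.
    apply Rmult_le_compat; auto using pow2_ge_0.
    apply factor_circle_le; auto.
    pose proof PI_4.
    replace (tau * (x - c)) with (tau * x + - (tau * c)) by ring.
    eapply Rle_trans; [apply Rabs_triang|]. rewrite Rabs_Ropp, (Rabs_mult tau c).
    rewrite (Rabs_pos_eq tau) by lra. lra.
Qed.

Lemma outer_center_ge (tau y r : R) (L : list (R * R)) :
  0 < tau -> 0 < y -> 1 / 2 <= r <= 1 -> y * tau / 2 <= 1 - r <= y * tau ->
  admissible_step tau y L ->
  center_bound y L <= Cmod (outer tau L (RtoC r)) ^ 2.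
Proof.
  intros Ht Hy Hr Hr2 H. induction L as [|[c e] L IH]; cbn [outer center_bound].
  - rewrite Cmod_1. lra.
  - pose proof H as H0. apply admissible_step_inv in H. destruct H as [[He [He2 [_ Hc]]] H].
    rewrite Cmod_mult, Rpow_mult_distr.
    apply Rmult_le_compat; auto.
    + pose proof (center_term_pos y c e Hy He). lra.
    + eapply Rle_trans; [apply Rle_0_1|]. apply center_bound_ge_1; auto.
      intros c' e' H'. apply (H c' e' H').
    + apply factor_real_ge; auto.
Qed.

Lemma outer_mean_value (tau y r : R) (L : list (R * R)) :
  0 < tau -> 0 < r < 1 -> admissible_step tau y L -> mean_value r (outer tau L).
Proof.
  intros Ht Hr H. induction L as [|[c e] L IH].
  - apply mean_value_one. exact Hr.
  - apply admissible_step_inv in H. destruct H as [[He [He2 _]] H].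
    apply (mean_value_ratio r Hr (outer tau L) (pole tau c e) (RtoC (1 - e * tau) * pole tau c e)%C);
      auto. apply Cmod_pole_lt_1; auto.
Qed.

Lemma exp_INR_mult (n : nat) (u : R) : exp (INR n * u) = exp u ^ n.
Proof.
  induction n as [|n IH].
  - simpl. rewrite Rmult_0_l. apply exp_0.
  - rewrite S_INR. simpl. rewrite <- IH, <- exp_plus. f_equal. ring.
Qed.

Lemma exp_neg_sub_le (a b : R) : 0 <= a <= b -> Rabs (exp (- a) - exp (- b)) <= b - a.
Proof.
  intro H. replace (exp (- b)) with (exp (- a) * exp (- (b - a))).
  2: { rewrite <- exp_plus. f_equal. ring. }
  assert (exp (- a) <= 1).
  { destruct (Req_dec a 0) as [->|]. - rewrite Ropp_0, exp_0. lra.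
    - rewrite <- exp_0. left. apply exp_increasing. lra. }
  assert (exp (- (b - a)) <= 1).
  { destruct (Req_dec b a) as [->|]. - rewrite Rminus_diag, Ropp_0, exp_0. lra.
    - rewrite <- exp_0. left. apply exp_increasing. lra. }
  pose proof (exp_ineq1_le (- (b - a))). pose proof (exp_pos (- a)).
  rewrite Rabs_pos_eq; nra.
Qed.

Lemma exp_step_bounds (u : R) : 0 < u <= 1 / 2 ->
  1 / 2 <= exp (- u) < 1 /\ u / 2 <= 1 - exp (- u) <= u.
Proof.
  intro Hu. pose proof (exp_ineq1_le (- u)). pose proof (exp_ineq1_le u).
  pose proof (exp_pos (- u)). pose proof (exp_pos u).
  assert (E : exp u * exp (- u) = 1) by (rewrite <- exp_plus, Rplus_opp_r; apply exp_0).
  assert (exp (- u) * (1 + u) <= 1) by nra.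
  repeat split; nra.
Qed.

(** The peak of the kernel is [1 / (1 - r)^2], while its mass [2 PI / (1 - r^2)] is at least
    [PI / (1 - r)]. After rescaling by tau this yields the factor 1 / y in the bound on [phi]. *)
Lemma poisson_mass (r x : R) : 0 < r < 1 -> poisson r x * (PI * (1 - r)) <= poisson_integral r.
Proof.
  intro Hr. pose proof (poisson_integral_eq r Hr) as E. pose proof (poisson_integral_pos r Hr) as T.
  pose proof PI_RGT_0.
  assert (P : poisson r x * (1 - r) ^ 2 <= 1).
  { pose proof (poisson_pos r Hr x) as P. unfold poisson in *.
    set (D := 1 - 2 * r * cos x + r ^ 2) in *.
    assert (D <> 0) by (intro G; rewrite G, Rinv_0 in P; lra).
    assert ((1 - r) ^ 2 <= D) by (unfold D; pose proof (COS_bound x); nra).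
    apply (Rle_trans _ (/ D * D)); [apply Rmult_le_compat_l; lra | rewrite Rinv_l; lra]. }
  pose proof (poisson_pos r Hr x).
  assert (Q : PI <= (1 - r) * poisson_integral r).
  { assert (E2 : (1 - r) * poisson_integral r * (1 + r) = 2 * PI) by (rewrite <- E; ring).
    assert (Z : 0 < (1 - r) * poisson_integral r) by (apply Rmult_lt_0_compat; lra).
    assert ((1 - r) * poisson_integral r * (1 + r) <= (1 - r) * poisson_integral r * 2) by (apply Rmult_le_compat_l; lra). lra. }
  assert (poisson r x * (PI * (1 - r)) <= poisson r x * ((1 - r) * poisson_integral r * (1 - r))).
  { apply Rmult_le_compat_l; [lra|]. apply Rmult_le_compat_r; lra. }
  assert (poisson_integral r * (poisson r x * (1 - r) ^ 2) <= poisson_integral r * 1) by (apply Rmult_le_compat_l; lra).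
  nra.
Qed.

(* On the circle [w = cis (tau * x)] with [r = exp (- y * tau)], the function [phi] is the outer
   function times the Poisson kernel at [r], normalised by its value at [r]; [tau] tends to 0. *)
Lemma exponential_representation (L : list (R * R)) (y A B S eta : R) :
  0 < y -> A < B -> positive_radii L ->
  (forall x, x <= A \/ B <= x -> circle_bound L x <= S) -> 0 < eta ->
  exists phi : R -> C, Ccont phi /\
    (forall x, A <= x <= B -> Cmod (phi x) ^ 2 <= circle_bound L x / (center_bound y L * y ^ 2)) /\
    (forall t, 0 <= t ->
      Cmod (CI (fun x => phi x * cis (x * t))%C A B - RtoC (exp (- (y * t))))
      <= sqrt (S / center_bound y L) + eta).
Proof.
  intros Hy HAB HL HS Heta.
  destruct (data_bound L HL) as [T [HT HT2]].
  set (X := Rabs A + Rabs B).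
  set (M := 2 ^ length L / y).
  assert (HM : 0 < M) by (apply Rdiv_lt_0_compat; auto; apply pow_lt; lra).
  assert (HX : 0 <= X) by (unfold X; pose proof (Rabs_pos A); pose proof (Rabs_pos B); lra).
  (* Each summand serves one smallness condition on [tau = / Big]: two for [admissible_step], then
     [y * tau <= 1/2], then [[tau * A, tau * B]] inside [[- PI, PI]], and the last two for the
     errors of rounding t to a multiple of tau. *)
  set (Big := 2 * T + 2 * T / y + 2 * y + X + 2 * ((B - A) * (X * M)) / eta + 2 * y / eta).
  assert (P1 : 0 < 2 * T / y) by (apply Rdiv_lt_0_compat; lra).
  assert (P2 : 0 <= 2 * ((B - A) * (X * M)) / eta).
  { apply Rle_mult_inv_pos; auto. apply Rmult_le_pos; [lra|]. apply Rmult_le_pos; [lra|]. nra. }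
  assert (P3 : 0 < 2 * y / eta) by (apply Rdiv_lt_0_compat; lra).
  assert (HBig : 0 < Big) by (unfold Big; lra).
  set (tau := / Big).
  assert (Htau : 0 < tau) by (apply Rinv_0_lt_compat; auto).
  assert (Hle : forall z, z <= Big -> tau * z <= 1).
  { intros z Hz. unfold tau. rewrite <- (Rinv_l Big) by lra. apply Rmult_le_compat_l; auto. apply Rlt_le; auto. }
  assert (H1 : tau * (2 * T) <= 1) by (apply Hle; unfold Big; lra).
  assert (H2 : tau * (2 * T / y) <= 1) by (apply Hle; unfold Big; lra).
  assert (H3 : tau * (2 * y) <= 1) by (apply Hle; unfold Big; lra).
  assert (H4 : tau * X <= 1) by (apply Hle; unfold Big; lra).
  assert (H5 : tau * (2 * ((B - A) * (X * M)) / eta) <= 1) by (apply Hle; unfold Big; lra).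
  assert (H6 : tau * (2 * y / eta) <= 1) by (apply Hle; unfold Big; lra).
  clearbody tau.
  assert (H2' : 2 * tau * T <= y).
  { apply (Rmult_le_compat_r y) in H2; [|lra].
    replace (tau * (2 * T / y) * y) with (2 * tau * T) in H2 by (field; lra). lra. }
  assert (H5' : tau * ((B - A) * (X * M)) <= eta / 2).
  { apply (Rmult_le_compat_r (eta / 2)) in H5; [|lra].
    replace (tau * (2 * ((B - A) * (X * M)) / eta) * (eta / 2)) with (tau * ((B - A) * (X * M))) in H5 by (field; lra). lra. }
  assert (H6' : tau * y <= eta / 2).
  { apply (Rmult_le_compat_r (eta / 2)) in H6; [|lra].
    replace (tau * (2 * y / eta) * (eta / 2)) with (tau * y) in H6 by (field; lra). lra. }
  assert (Hadm : admissible_step tau y L).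
  { intros c e Hin. destruct (HT2 c e Hin) as [Q1 [Q2 Q3]]. pose proof (HL c e Hin).
    repeat split; auto; nra. }
  set (r := exp (- (y * tau))).
  destruct (exp_step_bounds (y * tau) ltac:(nra)) as [Hr1 Hr2]. fold r in Hr1, Hr2.
  assert (Hr : 0 < r < 1) by lra.
  pose proof (poisson_integral_pos r Hr) as HT0.
  pose proof (outer_mean_value tau y r L Htau Hr Hadm) as [Gc Gm].
  pose proof (outer_center_ge tau y r L Htau Hy ltac:(lra) Hr2 Hadm) as Gr.
  pose proof (center_bound_ge_1 y L Hy HL) as Hg1.
  set (g0 := center_bound y L) in *.
  set (Gz := outer tau L (RtoC r)) in *.
  assert (HGz : 0 < Cmod Gz) by (pose proof (Cmod_ge_0 Gz); nra).
  assert (Gnz : Gz <> 0%C) by (apply Cmod_gt_0; auto).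
  set (F := fun x => (outer tau L (cis x) * RtoC (poisson r x))%C).
  assert (Fc : Ccont F).
  { apply (Ccont_mult (fun x => outer tau L (cis x))); auto. apply Ccont_RtoC, Rcont_poisson, Hr. }
  set (K := (/ (RtoC (poisson_integral r) * Gz))%C).
  assert (KE : Cmod K = / (poisson_integral r * Cmod Gz)).
  { unfold K. rewrite Cmod_inv, Cmod_mult, Cmod_R, Rabs_pos_eq; auto; try lra.
    apply Cmod_gt_0. rewrite Cmod_mult, Cmod_R, Rabs_pos_eq by lra. apply Rmult_lt_0_compat; auto. }
  (* The factor [tau] is the Jacobian of [x -> tau * x]; [K] divides by the mass and by the value at
     r. *)
  set (phi := fun x => (K * (RtoC tau * F (tau * x)%R))%C).
  assert (Pc : Ccont phi).
  { unfold phi. apply Ccont_mult; auto with cont. apply Ccont_mult; auto with cont.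
    apply (Ccont_comp F); auto with cont. }
  assert (Habs : forall x, A <= x <= B -> Rabs x <= X).
  { intros x Hx. unfold X, Rabs. repeat destruct (Rcase_abs _); lra. }
  assert (Hpi : forall x, A <= x <= B -> Rabs (tau * x) <= PI).
  { intros x Hx. specialize (Habs x Hx). rewrite Rabs_mult, (Rabs_pos_eq tau) by lra.
    pose proof PI2_1. nra. }
  assert (Pb : forall x, A <= x <= B -> Cmod (phi x) ^ 2 <= circle_bound L x / (g0 * y ^ 2)).
  { intros x Hx. unfold phi, F. rewrite !Cmod_mult, KE, !Cmod_R, (Rabs_pos_eq tau) by lra.
    pose proof (poisson_pos r Hr (tau * x)) as Pp. rewrite (Rabs_pos_eq (poisson r _)) by lra.
    pose proof (outer_circle_le tau y L x Htau Hadm (Hpi x Hx)) as Q.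
    pose proof (poisson_mass r (tau * x) Hr) as PM.
    set (p := poisson r (tau * x)) in *. set (O := Cmod (outer tau L (cis (tau * x)))) in *.
    assert (PB : tau * p * y <= poisson_integral r).
    { pose proof PI2_1. eapply Rle_trans; [|exact PM]. 
      assert (y * tau <= PI * (1 - r)) by nra. nra. }
    replace ((/ (poisson_integral r * Cmod Gz) * (tau * (O * p))) ^ 2) with
      ((tau * p * y) ^ 2 * O ^ 2 / ((poisson_integral r) ^ 2 * Cmod Gz ^ 2 * y ^ 2)) by (field; lra).
    assert (Y1 : (tau * p * y) ^ 2 <= poisson_integral r ^ 2).
    { apply pow_incr. split; auto. apply Rmult_le_pos; [|lra]. apply Rmult_le_pos; lra. }
    assert (Y2 : 0 < poisson_integral r ^ 2) by nra.
    assert (Y3 : 0 < y ^ 2) by nra.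
    assert (Y4 : (tau * p * y) ^ 2 * O ^ 2 <= poisson_integral r ^ 2 * circle_bound L x).
    { apply Rmult_le_compat; auto using pow2_ge_0. }
    apply (Rmult_le_reg_r (poisson_integral r ^ 2 * Cmod Gz ^ 2 * y ^ 2)).
    { apply Rmult_lt_0_compat; auto. apply Rmult_lt_0_compat; auto. nra. }
    unfold Rdiv at 1. rewrite Rmult_assoc, Rinv_l, Rmult_1_r.
    2: { apply Rgt_not_eq. apply Rmult_lt_0_compat; auto. apply Rmult_lt_0_compat; auto. nra. }
    replace (circle_bound L x / (g0 * y ^ 2) * (poisson_integral r ^ 2 * Cmod Gz ^ 2 * y ^ 2))
      with (poisson_integral r ^ 2 * circle_bound L x * (Cmod Gz ^ 2 / g0)) by (field; lra).
    assert (1 <= Cmod Gz ^ 2 / g0).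
    { apply (Rmult_le_reg_r g0); [lra|]. unfold Rdiv. rewrite Rmult_assoc, Rinv_l by lra. lra. }
    assert (0 <= poisson_integral r ^ 2 * circle_bound L x).
    { apply Rmult_le_pos; [lra|]. pose proof (circle_bound_bounds L x HL). lra. }
    nra. }
  assert (PM : forall x, A <= x <= B -> Cmod (phi x) <= M).
  { intros x Hx. apply Cmod_le_sqr; [lra|]. eapply Rle_trans; [apply Pb; auto|].
    pose proof (circle_bound_bounds L x HL) as [_ Q].
    unfold M, Rdiv. rewrite Rpow_mult_distr, pow_inv, <- pow_mult, Nat.mul_comm, pow_mult.
    replace (2 ^ 2) with 4 by ring.
    rewrite Rinv_mult. assert (0 < / g0 <= 1).
    { split. apply Rinv_0_lt_compat; lra. rewrite <- Rinv_1. apply Rinv_le_contravar; lra. }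
    assert (0 < / y ^ 2) by (apply Rinv_0_lt_compat; nra).
    pose proof (circle_bound_bounds L x HL) as [Q1 _].
    rewrite <- Rmult_assoc. apply Rmult_le_compat_r; [lra|]. nra. }
  exists phi. split; [exact Pc|]. split; [exact Pb|].
  (* At [t = k * tau] the exponential is the monomial w^k and the mean value identity is exact. The
     only error comes from the two arcs outside [[tau * A, tau * B]], where the outer function is at
     most [sqrt S]. *)
  assert (Disc : forall k, Cmod (CI (fun x => phi x * cis (x * (INR k * tau)))%C A B - RtoC (r ^ k)) <= sqrt (S / g0)).
  { intro k.
    assert (E1 : CI (fun x => phi x * cis (x * (INR k * tau)))%C A B = (K * CI (fun x => cisn k x * F x)%C (tau * A) (tau * B))%C).
    { rewrite <- CI_comp_scal by auto with cont. rewrite <- CI_scal.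
      - apply CI_ext; [lra|]. intros x _. unfold phi, cisn.
        replace (INR k * (tau * x)) with (x * (INR k * tau)) by ring. ring.
      - apply Ccont_mult; auto with cont. apply (Ccont_comp (fun x => cisn k x * F x)%C); auto with cont. }
    assert (E2 : RtoC (r ^ k) = (K * CI (fun x => cisn k x * F x)%C (- PI) PI)%C).
    { specialize (Gm k). change (CI (fun x => cisn k x * F x)%C (- PI) PI = (RtoC (r ^ k) * Gz * RtoC (poisson_integral r))%C) in Gm.
      rewrite Gm. unfold K. fold Gz. field. split; auto.
      intro E. injection E. lra. }
    set (h := fun x => (cisn k x * F x)%C) in *.
    assert (hc : Ccont h) by (unfold h; auto with cont).
    assert (E3 : CI h (- PI) PI = (CI h (- PI) (tau * A) + CI h (tau * A) (tau * B) + CI h (tau * B) PI)%C).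
    { rewrite !CI_Chasles; auto. }
    assert (hb : forall z, - PI <= z <= tau * A \/ tau * B <= z <= PI -> Cmod (h z) <= sqrt S * poisson r z).
    { intros z Hz. unfold h, F, cisn. rewrite !Cmod_mult, Cmod_cis, Cmod_R.
      pose proof (poisson_pos r Hr z) as Pp. rewrite (Rabs_pos_eq (poisson r _)) by lra.
      rewrite Rmult_1_l. apply Rmult_le_compat_r; [lra|].
      assert (Q : Cmod (outer tau L (cis z)) ^ 2 <= S).
      { replace z with (tau * (z / tau)) by (field; lra).
        eapply Rle_trans; [apply (outer_circle_le tau y); auto|].
        - replace (tau * (z / tau)) with z by (field; lra).
          pose proof (Hpi A ltac:(lra)) as QA. pose proof (Hpi B ltac:(lra)) as QB.
          apply Rabs_le. apply Rabs_le_between in QA. apply Rabs_le_between in QB. lra.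
        - apply HS. destruct Hz as [Hz|Hz]; [left|right].
          + apply (Rmult_le_reg_l tau); auto. replace (tau * (z / tau)) with z by (field; lra). lra.
          + apply (Rmult_le_reg_l tau); auto. replace (tau * (z / tau)) with z by (field; lra). lra. }
      rewrite <- (sqrt_pow2 (Cmod (outer tau L (cis z)))) by apply Cmod_ge_0.
      apply sqrt_le_1_alt, Q. }
    pose proof (Rcont_poisson r Hr) as Rp.
    pose proof (Hpi A ltac:(lra)) as QA. pose proof (Hpi B ltac:(lra)) as QB.
    apply Rabs_le_between in QA. apply Rabs_le_between in QB.
    assert (J1 : Cmod (CI h (- PI) (tau * A)) <= sqrt S * RInt (poisson r) (- PI) (tau * A)).
    { rewrite <- RInt_scal_R by auto. apply CI_le; auto with cont; lra. }
    assert (J2 : Cmod (CI h (tau * B) PI) <= sqrt S * RInt (poisson r) (tau * B) PI).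
    { rewrite <- RInt_scal_R by auto. apply CI_le; auto with cont; lra. }
    assert (J3 : RInt (poisson r) (- PI) (tau * A) + RInt (poisson r) (tau * B) PI <= poisson_integral r).
    { unfold poisson_integral. rewrite <- (RInt_Chasles (poisson r) (- PI) (tau * A) PI) by (apply Rcont_ex_RInt; auto).
      rewrite <- (RInt_Chasles (poisson r) (tau * A) (tau * B) PI) by (apply Rcont_ex_RInt; auto).
      unfold plus; simpl.
      assert (0 <= RInt (poisson r) (tau * A) (tau * B)).
      { apply RInt_ge_0. - apply Rmult_le_compat_l; lra. - apply Rcont_ex_RInt; auto.
        - intros; apply Rlt_le, poisson_pos, Hr. }
      lra. }
    rewrite E1, E2, E3.
    replace (K * CI h (tau * A) (tau * B) - K * (CI h (- PI) (tau * A) + CI h (tau * A) (tau * B) + CI h (tau * B) PI))%C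
      with (- (K * (CI h (- PI) (tau * A) + CI h (tau * B) PI)))%C by ring.
    rewrite Cmod_opp, Cmod_mult, KE.
    assert (J4 : Cmod (CI h (- PI) (tau * A) + CI h (tau * B) PI)%C <= sqrt S * poisson_integral r).
    { eapply Rle_trans; [apply Cmod_triangle|]. pose proof (sqrt_pos S). nra. }
    assert (J5 : sqrt g0 <= Cmod Gz).
    { rewrite <- (sqrt_pow2 (Cmod Gz)) by lra. apply sqrt_le_1_alt, Gr. }
    assert (J6 : 0 < sqrt g0) by (apply sqrt_lt_R0; lra).
    rewrite sqrt_div_alt by lra.
    apply (Rmult_le_reg_l (poisson_integral r * Cmod Gz)). { apply Rmult_lt_0_compat; auto. }
    rewrite <- Rmult_assoc, Rinv_r, Rmult_1_l.
    2: { apply Rgt_not_eq, Rmult_lt_0_compat; auto. }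
    eapply Rle_trans; [exact J4|].
    replace (sqrt S * poisson_integral r) with (poisson_integral r * sqrt g0 * (sqrt S / sqrt g0)) by (field; lra).
    apply Rmult_le_compat_r.
    - apply Rle_mult_inv_pos; auto. apply sqrt_pos.
    - apply Rmult_le_compat_l; lra. }
  intros t Ht.
  (* Rounding t down to a multiple of tau moves the exponential by at most [y * tau] and the
     integral by at most [tau * ((B - A) * (X * M))], each at most [eta / 2]. *)
  destruct (nfloor_ex (t / tau)) as [k Hk]. { apply Rle_mult_inv_pos; auto. }
  assert (Hk1 : INR k * tau <= t).
  { apply (Rmult_le_reg_r (/ tau)). apply Rinv_0_lt_compat; auto.
    rewrite Rmult_assoc, Rinv_r, Rmult_1_r by lra. apply Hk. }
  assert (Hk2 : t <= INR k * tau + tau).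
  { apply (Rmult_le_reg_r (/ tau)). apply Rinv_0_lt_compat; auto.
    replace ((INR k * tau + tau) * / tau) with (INR k + 1) by (field; lra). apply Rlt_le, Hk. }
  specialize (Disc k).
  assert (Er : r ^ k = exp (- (y * (INR k * tau)))).
  { unfold r. rewrite <- exp_INR_mult. f_equal. ring. }
  rewrite Er in Disc.
  assert (D1 : Rabs (exp (- (y * (INR k * tau))) - exp (- (y * t))) <= eta / 2).
  { pose proof (pos_INR k). eapply Rle_trans; [apply exp_neg_sub_le|]; nra. }
  assert (Pt : forall s, Ccont (fun x => cis (x * s))).
  { intro s. apply Ccont_cis. auto with cont. }
  assert (D2 : Cmod (CI (fun x => phi x * cis (x * t))%C A B - CI (fun x => phi x * cis (x * (INR k * tau)))%C A B)%C <= eta / 2).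
  { rewrite <- CI_minus by auto with cont.
    eapply Rle_trans; [|exact H5'].
    eapply Rle_trans; [apply (CI_le_const _ (tau * (X * M)))|]; try lra.
    - auto with cont.
    - intros x Hx. replace (phi x * cis (x * t) - phi x * cis (x * (INR k * tau)))%C
        with (phi x * (cis (x * t) - cis (x * (INR k * tau))))%C by ring.
      rewrite Cmod_mult. pose proof (Cmod_cis_sub (x * t) (x * (INR k * tau))) as Q.
      replace (x * t - x * (INR k * tau)) with (x * (t - INR k * tau)) in Q by ring.
      rewrite Rabs_mult, (Rabs_pos_eq (t - _)) in Q by lra.
      specialize (PM x Hx). specialize (Habs x Hx). pose proof (Rabs_pos x).
      pose proof (Cmod_ge_0 (phi x)).
      replace (tau * (X * M)) with (M * (X * tau)) by ring.
      apply Rmult_le_compat; auto using Cmod_ge_0.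
      eapply Rle_trans; [exact Q|]. apply Rmult_le_compat; lra. }
  match goal with |- Cmod (?a - ?b)%C <= _ =>
    match type of Disc with Cmod (?c - ?d)%C <= _ =>
      replace (a - b)%C with ((a - c) + ((c - d) + (d - b)))%C by ring end end.
  eapply Rle_trans; [apply Cmod_triangle|].
  replace (sqrt (S / g0) + eta) with (eta / 2 + (sqrt (S / g0) + eta / 2)) by field.
  apply Rplus_le_compat; [exact D2|].
  eapply Rle_trans; [apply Cmod_triangle|].
  apply Rplus_le_compat; [exact Disc|].
  rewrite <- RtoC_minus, Cmod_R. exact D1.
Qed.

Lemma circle_bound_repeat (c e x : R) (m : nat) :
  circle_bound (repeat (c, e) m) x = (1 + 3 * e ^ 2 / (e ^ 2 + (x - c) ^ 2 / 100)) ^ m.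
Proof. induction m as [|m IH]; cbn [repeat circle_bound]; [reflexivity|]. rewrite IH. reflexivity. Qed.

Lemma center_bound_repeat (y c e : R) (m : nat) :
  center_bound y (repeat (c, e) m) = (1 + e * y / (8 * ((e + y) ^ 2 + c ^ 2))) ^ m.
Proof. induction m as [|m IH]; cbn [repeat center_bound]; [reflexivity|]. rewrite IH. reflexivity. Qed.

(* As [eps -> 0] one outer factor exceeds 1 by [O(eps^2)] off the interval but by a multiple of
   [eps] at the center; a high power of it separates the two. *)
Lemma half_line_approximation (h y eta : R) : 0 < h -> 0 < y -> 0 < eta ->
  exists phi : R -> C, Ccont phi /\ forall t, 0 <= t ->
    Cmod (CI (fun x => phi x * cis (x * t))%C 0 h - RtoC (exp (- (y * t)))) <= eta.
Proof.
  intros Hh Hy Heta.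
  (* Outside [[0, h]] one has [(x - c)^2 / 100 >= h^2 / 400], so a factor is at most [1 + C1 * e^2]
     there. Since [e <= 1], the gain at the center is at least [b * e], and [e <= b / (2 * C1)]
     makes it win. *)
  set (c := h / 2). set (C1 := 1200 / h ^ 2). set (b := y / (8 * ((1 + y) ^ 2 + c ^ 2))).
  assert (HC1 : 0 < C1) by (apply Rdiv_lt_0_compat; nra).
  assert (Hb : 0 < b). { apply Rdiv_lt_0_compat; auto. pose proof (pow2_ge_0 c). nra. }
  set (e := Rmin 1 (b / (2 * C1))).
  assert (Hb2 : 0 < b / (2 * C1)) by (apply Rdiv_lt_0_compat; lra).
  assert (He : 0 < e <= 1).
  { unfold e. split; [apply Rmin_pos; lra | apply Rmin_l]. }
  assert (HCe : C1 * e ^ 2 < b * e).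
  { assert (C1 * e <= b / 2).
    { replace (b / 2) with (C1 * (b / (2 * C1))) by (field; lra). apply Rmult_le_compat_l; [lra|apply Rmin_r]. }
    nra. }
  set (p := e * y / (8 * ((e + y) ^ 2 + c ^ 2))).
  assert (Hp : b * e <= p).
  { unfold b, p. replace (y / (8 * ((1 + y) ^ 2 + c ^ 2)) * e) with (e * y * / (8 * ((1 + y) ^ 2 + c ^ 2))).
    2: { field. pose proof (pow2_ge_0 c). nra. }
    apply Rmult_le_compat_l; [nra|]. pose proof (pow2_ge_0 c). apply Rinv_le_contravar; nra. }
  assert (Hce0 : 0 < C1 * e ^ 2) by (apply Rmult_lt_0_compat; nra).
  set (q := (1 + C1 * e ^ 2) / (1 + p)).
  assert (Hq : 0 < q < 1).
  { split. - apply Rdiv_lt_0_compat; lra.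
    - apply (Rmult_lt_reg_r (1 + p)); [lra|]. unfold q, Rdiv. rewrite Rmult_assoc, Rinv_l by lra. lra. }
  destruct (pow_lt_1_zero q ltac:(rewrite Rabs_pos_eq; lra) ((eta / 2) ^ 2) ltac:(nra)) as [m Hm].
  specialize (Hm m (Nat.le_refl m)). rewrite Rabs_pos_eq in Hm by (apply pow_le; lra).
  assert (HL : positive_radii (repeat (c, e) m)).
  { intros c' e' Hin. apply repeat_spec in Hin. injection Hin; intros; subst. lra. }
  destruct (exponential_representation (repeat (c, e) m) y 0 h ((1 + C1 * e ^ 2) ^ m) (eta / 2))
    as [phi [P1 [_ P2]]]; auto; try lra.
  - intros x Hx. rewrite circle_bound_repeat. apply pow_incr.
    pose proof (circle_term_bounds c e x ltac:(lra)) as T. split; [lra|].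
    apply Rplus_le_compat_l.
    replace (C1 * e ^ 2) with (3 * e ^ 2 * / (h ^ 2 / 400)) by (unfold C1; field; lra).
    unfold Rdiv at 1. apply Rmult_le_compat_l; [nra|]. apply Rinv_le_contravar; [nra|].
    assert (h ^ 2 / 4 <= (x - c) ^ 2) by (unfold c; destruct Hx; nra). nra.
  - exists phi. split; auto. intros t Ht. eapply Rle_trans; [apply P2; auto|].
    rewrite center_bound_repeat. fold p.
    replace ((1 + C1 * e ^ 2) ^ m / (1 + p) ^ m) with (q ^ m).
    2: { unfold q, Rdiv. rewrite Rpow_mult_distr, pow_inv. reflexivity. }
    apply Rlt_le, sqrt_le_1_alt in Hm. rewrite sqrt_pow2 in Hm by lra. lra.
Qed.

(** * Condensation of the logarithmic series *)

Fixpoint Rsum (f : nat -> R) (n : nat) : R :=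
  match n with O => 0 | S m => Rsum f m + f m end.

Lemma Rsum_S (f : nat -> R) (n : nat) : Rsum f (S n) = Rsum f n + f n.
Proof. reflexivity. Qed.

Lemma Rsum_le (f g : nat -> R) (n : nat) : (forall i, (i < n)%nat -> f i <= g i) -> Rsum f n <= Rsum g n.
Proof.
  induction n as [|n IH]; intro H; simpl; [lra|].
  pose proof (IH ltac:(intros; apply H; lia)). pose proof (H n ltac:(lia)). lra.
Qed.

Lemma Rsum_ext (f g : nat -> R) (n : nat) : (forall i, (i < n)%nat -> f i = g i) -> Rsum f n = Rsum g n.
Proof. intro H. apply Rle_antisym; apply Rsum_le; intros; rewrite H by auto; lra. Qed.

Lemma Rsum_scal (c : R) (f : nat -> R) (n : nat) : Rsum (fun i => c * f i) n = c * Rsum f n.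
Proof. induction n as [|n IH]; simpl; [ring | rewrite IH; ring]. Qed.

Lemma Rsum_plus (f g : nat -> R) (n : nat) : Rsum (fun i => f i + g i) n = Rsum f n + Rsum g n.
Proof. induction n as [|n IH]; simpl; [ring | rewrite IH; ring]. Qed.

Lemma Rsum_mono (f : nat -> R) (m n : nat) : (forall i, 0 <= f i) -> (m <= n)%nat -> Rsum f m <= Rsum f n.
Proof.
  intros Hf H. induction H as [|n _ IH]; simpl; [lra|]. pose proof (Hf n). lra.
Qed.

Lemma Rsum_nonneg (f : nat -> R) (n : nat) : (forall i, (i < n)%nat -> 0 <= f i) -> 0 <= Rsum f n.
Proof.
  induction n as [|n IH]; intro H; simpl; [lra|].
  pose proof (IH ltac:(intros; apply H; lia)). pose proof (H n ltac:(lia)). lra.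
Qed.

Lemma sum_n_Rsum (f : nat -> R) (n : nat) : sum_n f n = Rsum f (S n).
Proof.
  induction n as [|n IH].
  - rewrite sum_O. simpl. ring.
  - rewrite sum_Sn, IH. reflexivity.
Qed.

Lemma Rsum_shift (f : nat -> R) (k n : nat) : Rsum (fun i => f (i + k)%nat) n = Rsum f (n + k) - Rsum f k.
Proof. induction n as [|n IH]; simpl; [ring | rewrite IH; ring]. Qed.

Lemma ex_series_of_bound (f : nat -> R) (M : R) : (forall i, 0 <= f i) -> (forall n, Rsum f n <= M) -> ex_series f.
Proof.
  intros Hf HM.
  destruct (ex_finite_lim_seq_incr (sum_n f) M) as [l Hl].
  - intro n. rewrite !sum_n_Rsum. simpl. pose proof (Hf (S n)). lra.
  - intro n. rewrite sum_n_Rsum. apply HM.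
  - exists l. exact Hl.
Qed.

Lemma Rsum_le_Series (f : nat -> R) (n : nat) : (forall i, 0 <= f i) -> ex_series f -> Rsum f n <= Series f.
Proof.
  intros Hf Hs. apply Series_correct in Hs.
  assert (L : is_lim_seq (sum_n f) (Series f)) by exact Hs.
  pose proof (is_lim_seq_incr_compare (sum_n f) _ L) as C.
  apply (Rle_trans _ (sum_n f n)).
  - rewrite sum_n_Rsum. simpl. pose proof (Hf n). lra.
  - apply C. intro m. rewrite !sum_n_Rsum. simpl. pose proof (Hf (S m)). lra.
Qed.

Lemma series_tail (f : nat -> R) (e : R) : (forall i, 0 <= f i) -> ex_series f -> 0 < e ->
  exists k0, forall k1 k, (k0 <= k1)%nat -> Rsum (fun i => f (i + k1)%nat) k <= e.
Proof.
  intros Hf Hs He.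
  assert (L : is_lim_seq (sum_n f) (Series f)) by (apply Series_correct in Hs; exact Hs).
  apply is_lim_seq_spec in L. destruct (L (mkposreal e He)) as [N HN]. simpl in HN.
  exists (S N). intros k1 k Hk. rewrite Rsum_shift.
  pose proof (Rsum_le_Series f (k + k1) Hf Hs).
  specialize (HN N (Nat.le_refl N)). rewrite sum_n_Rsum in HN.
  pose proof (Rsum_mono f _ _ Hf Hk). apply Rabs_lt_between in HN. lra.
Qed.

Lemma ex_series_shift_iff (f : nat -> R) (k : nat) : ex_series (fun i => f (i + k)%nat) <-> ex_series f.
Proof.
  rewrite (ex_series_incr_n f k). split; intro H; eapply ex_series_ext; eauto;
    intro n; simpl; f_equal; lia.
Qed.

(* [logweight 0 = logweight 1 = 0], because [/ 0 = 0]. *)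
Definition logweight (n : nat) : R := / (INR n * ln (INR n) ^ 2).

Lemma ln_INR_pos (n : nat) : (2 <= n)%nat -> 0 < ln (INR n).
Proof.
  intro H. rewrite <- ln_1. apply ln_increasing; [lra|]. apply le_INR in H. simpl in H. lra.
Qed.

Lemma logweight_nonneg (n : nat) : 0 <= logweight n.
Proof.
  unfold logweight. destruct (Nat.eq_dec n 0) as [->|].
  - simpl. rewrite Rmult_0_l, Rinv_0. lra.
  - pose proof (pos_INR n).
    destruct (Req_dec (ln (INR n)) 0) as [E|E].
    + rewrite E. replace (INR n * 0 ^ 2) with 0 by ring. rewrite Rinv_0. lra.
    + apply Rlt_le, Rinv_0_lt_compat. apply Rmult_lt_0_compat.
      * apply lt_0_INR. lia.
      * nra.
Qed.

Lemma ln_step (n : nat) : (1 <= n)%nat ->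
  / INR (S n) <= ln (INR (S n)) - ln (INR n) <= / INR n.
Proof.
  intro H. apply le_INR in H. simpl in H. rewrite S_INR. set (x := INR n) in *.
  assert (P : forall u, 0 < u -> ln u <= u - 1).
  { intros u Hu. pose proof (exp_ineq1_le (ln u)) as E. rewrite exp_ln in E by auto. lra. }
  split.
  - pose proof (P (x / (x + 1)) ltac:(apply Rdiv_lt_0_compat; lra)) as Q.
    rewrite ln_div in Q by lra. replace (x / (x + 1) - 1) with (- / (x + 1)) in Q by (field; lra). lra.
  - pose proof (P ((x + 1) / x) ltac:(apply Rdiv_lt_0_compat; lra)) as Q.
    rewrite ln_div in Q by lra. replace ((x + 1) / x - 1) with (/ x) in Q by (field; lra). lra.
Qed.

(** Discrete form of the fact that 1 / (x ln^2 x) is minus the derivative of 1 / ln x. *)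
Lemma inv_ln_step (n : nat) : (2 <= n)%nat ->
  logweight (S n) <= / ln (INR n) - / ln (INR (S n)) <= logweight n.
Proof.
  intro H. destruct (ln_step n ltac:(lia)) as [L U].
  pose proof (ln_INR_pos n H) as P. 
  assert (HI : 0 < INR n) by (apply lt_0_INR; lia).
  assert (HS : 0 < INR (S n)) by (apply lt_0_INR; lia).
  assert (M : ln (INR n) <= ln (INR (S n))).
  { pose proof (Rinv_0_lt_compat _ HS). lra. }
  unfold logweight. set (a := ln (INR n)) in *. set (b := ln (INR (S n))) in *.
  replace (/ a - / b) with ((b - a) * / (a * b)) by (field; lra).
  rewrite !Rinv_mult.
  assert (I1 : / (b ^ 2) <= / (a * b) <= / (a ^ 2)).
  { split; apply Rinv_le_contravar; nra. }
  assert (0 < / (b ^ 2)) by (apply Rinv_0_lt_compat; nra).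
  rewrite Rinv_mult in I1.
  pose proof (Rinv_0_lt_compat _ HS). pose proof (Rinv_0_lt_compat _ HI).
  split; apply Rmult_le_compat; lra.
Qed.

Lemma logweight_sum_lower (g : nat -> R) (c : R) (a b : nat) : (2 <= a <= b)%nat -> 0 <= c ->
  (forall i, (a <= i)%nat -> c <= g i) ->
  c * (/ ln (INR a) - / ln (INR b)) <= Rsum (fun i => g i * logweight i) b - Rsum (fun i => g i * logweight i) a.
Proof.
  intros [Ha Hab] Hc Hg. induction Hab as [|b Hab IH]; [lra|].
  cbn [Rsum]. pose proof (inv_ln_step b ltac:(lia)) as [_ U]. pose proof (Hg b ltac:(lia)).
  pose proof (logweight_nonneg b).
  assert (c * (/ ln (INR b) - / ln (INR (S b))) <= g b * logweight b).
  { apply (Rle_trans _ (c * logweight b)).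
    - apply Rmult_le_compat_l; lra.
    - apply Rmult_le_compat_r; lra. }
  lra.
Qed.

(** Here the indices are a < i <= b, whereas [logweight_sum_lower] takes a <= i < b; this matches
    the two sides of [inv_ln_step]. *)
Lemma logweight_sum_upper (g : nat -> R) (c : R) (a b : nat) : (2 <= a <= b)%nat -> 0 <= c ->
  (forall i, (2 <= i <= b)%nat -> g i <= c) ->
  Rsum (fun i => g i * logweight i) (S b) - Rsum (fun i => g i * logweight i) (S a)
    <= c * (/ ln (INR a) - / ln (INR b)).
Proof.
  intros [Ha Hab] Hc Hg. induction Hab as [|b Hab IH]; [lra|].
  specialize (IH ltac:(intros; apply Hg; lia)). rewrite (Rsum_S _ (S b)).
  pose proof (inv_ln_step b ltac:(lia)) as [U _]. pose proof (Hg (S b) ltac:(lia)).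
  pose proof (logweight_nonneg (S b)).
  assert (g (S b) * logweight (S b) <= c * (/ ln (INR b) - / ln (INR (S b)))).
  { apply (Rle_trans _ (c * logweight (S b))).
    - apply Rmult_le_compat_r; lra.
    - apply Rmult_le_compat_l; lra. }
  lra.
Qed.

Lemma ex_series_logweight : ex_series logweight.
Proof.
  apply (ex_series_of_bound _ (Rsum logweight 3 + / ln 2)). { apply logweight_nonneg. }
  intro n. apply (Rle_trans _ (Rsum logweight (S (n + 2)))).
  { apply Rsum_mono; [apply logweight_nonneg | lia]. }
  pose proof (logweight_sum_upper (fun _ => 1) 1 2 (n + 2) ltac:(lia) ltac:(lra) ltac:(intros; lra)) as U.
  rewrite !(Rsum_ext (fun i => 1 * logweight i) logweight) in U by (intros; ring).
  change (INR 2) with 2 in U.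
  pose proof (Rinv_0_lt_compat _ (ln_INR_pos (n + 2) ltac:(lia))). lra.
Qed.

(** [ln (tower k)] is [2^k * ln 2], so consecutive towers cut out dyadic blocks of ln n, the scale
    of the frequencies. *)
Definition tower (k : nat) : nat := Nat.pow 2 (Nat.pow 2 k).

Lemma tower_gt (k : nat) : (k < tower k)%nat.
Proof.
  unfold tower. pose proof (Nat.pow_gt_lin_r 2 k ltac:(lia)).
  pose proof (Nat.pow_gt_lin_r 2 (2 ^ k) ltac:(lia)). lia.
Qed.

Lemma tower_ge_2 (k : nat) : (2 <= tower k)%nat.
Proof.
  destruct k as [|k]; [reflexivity|]. pose proof (tower_gt (S k)). lia.
Qed.

Lemma tower_mono (j k : nat) : (j <= k)%nat -> (tower j <= tower k)%nat.
Proof. intro H. unfold tower. apply Nat.pow_le_mono_r; [lia|]. apply Nat.pow_le_mono_r; lia. Qed.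

Lemma ln_tower (k : nat) : ln (INR (tower k)) = 2 ^ k * ln 2.
Proof.
  unfold tower. rewrite pow_INR, ln_pow by (simpl; lra). rewrite pow_INR. reflexivity.
Qed.

Lemma ln_2_bounds : 0 < ln 2 <= 1.
Proof.
  split. { exact (ln_INR_pos 2 ltac:(lia)). }
  pose proof (exp_ineq1_le (ln 2)) as E. rewrite exp_ln in E by lra. lra.
Qed.

Lemma inv_ln_tower_step (k : nat) :
  / ln (INR (tower k)) - / ln (INR (tower (S k))) = / (2 * ln 2) * / 2 ^ k.
Proof.
  rewrite !ln_tower. pose proof ln_2_bounds. pose proof (pow_lt 2 k ltac:(lra)).
  simpl. field. lra.
Qed.

(** By telescoping 1 / ln, the weight between consecutive towers is about [1 / (2 ln 2 * 2^k)], and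
    monotonicity bounds g on the block by its values at the two ends. The upper end belongs to index
    k + 1, which costs a shift of the series and a factor 2. *)
Lemma tower_condensation (g : nat -> R) :
  (forall i, 0 <= g i) -> (forall i j, (2 <= i <= j)%nat -> g i <= g j) ->
  (ex_series (fun i => g i * logweight i) <-> ex_series (fun k => g (tower k) * / 2 ^ k)).
Proof.
  intros Hg Hm.
  set (f := fun i => g i * logweight i).
  assert (Hf : forall i, 0 <= f i) by (intro; apply Rmult_le_pos; [auto | apply logweight_nonneg]).
  assert (Hp : forall k, 0 < / 2 ^ k) by (intro; apply Rinv_0_lt_compat, pow_lt; lra).
  assert (Hh : forall k, 0 <= g (tower k) * / 2 ^ k).
  { intro k. apply Rmult_le_pos; auto. apply Rlt_le, Hp. }
  pose proof ln_2_bounds as L2.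
  assert (L2' : 0 < / (2 * ln 2)) by (apply Rinv_0_lt_compat; lra).
  split; intro Hs.
  - apply (ex_series_of_bound _ (2 * ln 2 * Series f)); auto.
    intro K.
    assert (P : / (2 * ln 2) * Rsum (fun k => g (tower k) * / 2 ^ k) K <= Rsum f (tower K)).
    { induction K as [|K IH].
      - cbn [Rsum]. rewrite Rmult_0_r. apply Rsum_nonneg; auto.
      - cbn [Rsum].
        pose proof (logweight_sum_lower g (g (tower K)) (tower K) (tower (S K))
          (conj (tower_ge_2 K) (tower_mono K (S K) ltac:(lia))) (Hg _)
          (fun i Hi => Hm _ _ (conj (tower_ge_2 K) Hi))) as Q.
        rewrite inv_ln_tower_step in Q. fold f in Q. lra. }
    pose proof (Rsum_le_Series f (tower K) Hf Hs).
    apply (Rmult_le_reg_l (/ (2 * ln 2))); auto.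
    replace (/ (2 * ln 2) * (2 * ln 2 * Series f)) with (Series f) by (field; lra). lra.
  - apply (ex_series_shift_iff _ 1) in Hs.
    set (h := fun k => g (tower (S k)) * / 2 ^ (S k)).
    assert (Hs' : ex_series h).
    { eapply ex_series_ext; [|exact Hs]. intro k. unfold h. rewrite Nat.add_1_r. reflexivity. }
    assert (Hh' : forall k, 0 <= h k) by (intro; apply Hh).
    apply (ex_series_of_bound _ (Rsum f (S (tower 0)) + / ln 2 * Series h)); auto.
    intro n. apply (Rle_trans _ (Rsum f (S (tower n)))).
    { apply Rsum_mono; auto. pose proof (tower_gt n). lia. }
    apply (Rle_trans _ (Rsum f (S (tower 0)) + / ln 2 * Rsum h n)).
    + induction n as [|n IH]; [cbn [Rsum]; lra|].
      pose proof (logweight_sum_upper g (g (tower (S n))) (tower n) (tower (S n))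
          (conj (tower_ge_2 n) (tower_mono n (S n) ltac:(lia))) (Hg _)
          (fun i Hi => Hm i _ Hi)) as Q.
      fold f in Q. rewrite inv_ln_tower_step in Q.
      change (Rsum h (S n)) with (Rsum h n + h n).
      unfold h at 2. simpl pow. rewrite !Rinv_mult in *. lra.
    + apply Rplus_le_compat_l, Rmult_le_compat_l.
      * apply Rlt_le, Rinv_0_lt_compat; lra.
      * apply Rsum_le_Series; auto.
Qed.

(** * Exponential sums *)

Fixpoint Csum (f : nat -> C) (n : nat) : C :=
  match n with O => 0%C | S m => (Csum f m + f m)%C end.

Lemma Csum_shift (f : nat -> C) (n : nat) : Csum f (S n) = (f 0%nat + Csum (fun i => f (S i)) n)%C.
Proof.
  induction n as [|n IH]; [simpl; ring|].
  change (Csum f (S (S n))) with (Csum f (S n) + f (S n))%C. rewrite IH. simpl. ring.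
Qed.

Lemma sum_n_m_Csum (f : nat -> C) (n : nat) : sum_n_m f 1 n = Csum (fun i => f (S i)) n.
Proof.
  induction n as [|n IH].
  - rewrite sum_n_m_zero by lia. reflexivity.
  - rewrite sum_n_Sm by lia. rewrite IH. reflexivity.
Qed.

Lemma Csum_ext (f g : nat -> C) (n : nat) : (forall i, (i < n)%nat -> f i = g i) -> Csum f n = Csum g n.
Proof.
  induction n as [|n IH]; intro H; simpl; [reflexivity|].
  rewrite IH, H by auto. reflexivity.
Qed.

Lemma Csum_scal (c : C) (f : nat -> C) (n : nat) : Csum (fun i => c * f i)%C n = (c * Csum f n)%C.
Proof. induction n as [|n IH]; simpl; [ring | rewrite IH; ring]. Qed.

Lemma Csum_minus (f g : nat -> C) (n : nat) : Csum (fun i => f i - g i)%C n = (Csum f n - Csum g n)%C.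
Proof. induction n as [|n IH]; simpl; [ring | rewrite IH; ring]. Qed.

Lemma Cmod_Csum (f : nat -> C) (n : nat) : Cmod (Csum f n) <= Rsum (fun i => Cmod (f i)) n.
Proof.
  induction n as [|n IH]; simpl.
  - rewrite Cmod_0. lra.
  - eapply Rle_trans; [apply Cmod_triangle|]. lra.
Qed.

Lemma Ccont_Csum (f : nat -> R -> C) (n : nat) : (forall i, Ccont (f i)) -> Ccont (fun t => Csum (fun i => f i t) n).
Proof.
  intro H. induction n as [|n IH]; simpl; [apply Ccont_const|]. apply Ccont_plus; auto.
Qed.

Lemma CI_Csum (f : nat -> R -> C) (a b : R) (n : nat) : (forall i, Ccont (f i)) ->
  CI (fun t => Csum (fun i => f i t) n) a b = Csum (fun i => CI (f i) a b) n.
Proof.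
  intro H. induction n as [|n IH]; simpl.
  - rewrite CI_const. ring.
  - rewrite CI_plus; auto using Ccont_Csum. rewrite IH. reflexivity.
Qed.

Definition expsum (nu : nat -> R) (c : nat -> C) (n : nat) (t : R) : C :=
  Csum (fun i => c i * cis (nu i * t))%C n.

Lemma Ccont_expsum (nu : nat -> R) (c : nat -> C) (n : nat) : Ccont (expsum nu c n).
Proof. apply (Ccont_Csum (fun i t => c i * cis (nu i * t))%C). auto with cont. Qed.
#[local] Hint Resolve Ccont_expsum : cont.

Definition freq (alpha : R) (n : nat) : R := ln ((INR n + alpha) / alpha).

(** Index 0 carries the fixed term, at frequency 0, and ignores [a 0]. *)
Definition coef (alpha : R) (a : nat -> C) (n : nat) : C :=
  match n with O => RtoC (/ alpha) | S _ => (a n / RtoC (INR n + alpha))%C end.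

Lemma Rcpow_eq (x t : R) : 0 < x -> Rcpow x (Ci * RtoC t - 1)%C = (RtoC (/ x) * cis (t * ln x))%C.
Proof.
  intro Hx. unfold Rcpow, Cexp, cis.
  replace (Re ((Ci * RtoC t - 1) * RtoC (ln x))%C) with (- ln x) by (simpl; ring).
  replace (Im ((Ci * RtoC t - 1) * RtoC (ln x))%C) with (t * ln x) by (simpl; ring).
  rewrite exp_Ropp, exp_ln by auto. unfold Cmult, RtoC; simpl. f_equal; ring.
Qed.

Lemma hurwitz_poly_expsum (alpha : R) (a : nat -> C) (N : nat) (t : R) : 0 < alpha ->
  hurwitz_poly alpha a N t = (cis (t * ln alpha) * expsum (freq alpha) (coef alpha a) (S N) t)%C.
Proof.
  intro Ha. unfold hurwitz_poly, expsum. rewrite Csum_shift, sum_n_m_Csum, Rcpow_eq by auto.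
  rewrite Cmult_plus_distr_l, <- Csum_scal. f_equal.
  - unfold freq. simpl coef. replace ((INR 0 + alpha) / alpha) with 1 by (simpl; field; lra).
    rewrite ln_1, Rmult_0_l, cis_0. ring.
  - apply Csum_ext. intros i _. pose proof (pos_INR (S i)).
    rewrite Rcpow_eq by lra. unfold freq. rewrite ln_div by lra.
    replace (t * ln (INR (S i) + alpha)) with (t * ln alpha + (ln (INR (S i) + alpha) - ln alpha) * t) by ring.
    rewrite cis_plus. unfold coef, Cdiv. rewrite RtoC_inv by lra. ring.
Qed.

Lemma mean_square_expsum (alpha H : R) (N : nat) (a : nat -> C) : 0 < alpha ->
  mean_square alpha H N a = RInt (fun t => Cmod (expsum (freq alpha) (coef alpha a) (S N) t) ^ 2) 0 H.
Proof.
  intro Ha. unfold mean_square. apply RInt_ext. intros t _.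
  rewrite hurwitz_poly_expsum, Cmod_mult, Cmod_cis by auto. rewrite Rmult_1_l. reflexivity.
Qed.

(** * Existence of the minimum *)

(** A form of compactness tailored to Lipschitz functions: it passes to products and to Lipschitz
    images, which leads from intervals to polydiscs without any topology on sequences. No metric
    axioms are assumed of [d]. *)
Definition min_attained {X : Type} (P : X -> Prop) (d : X -> X -> R) : Prop :=
  forall (F : X -> R) (K : R), 0 <= K ->
    (forall x y, P x -> P y -> Rabs (F x - F y) <= K * d x y) ->
    exists x, P x /\ forall y, P y -> F x <= F y.

Lemma Lipschitz_continuity_pt (f : R -> R) (K c : R) : 0 <= K ->
  (forall x y, Rabs (f x - f y) <= K * Rabs (x - y)) -> continuity_pt f c.
Proof.
  intros HK Hf e He. exists (e / (K + 1)). split. { apply Rdiv_lt_0_compat; lra. }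
  intros x [_ Hx]. unfold dist in *; simpl in *. unfold R_dist in *.
  eapply Rle_lt_trans; [apply Hf|].
  apply (Rmult_lt_compat_l (K + 1)) in Hx; [|lra].
  replace ((K + 1) * (e / (K + 1))) with e in Hx by (field; lra).
  pose proof (Rabs_pos (x - c)). nra.
Qed.

(** [F] is controlled only on the interval, so it is composed with the 1-Lipschitz clamp [cl] to
    have two-sided continuity at the end points. *)
Lemma min_attained_interval (a b : R) : a <= b ->
  min_attained (fun x => a <= x <= b) (fun x y => Rabs (x - y)).
Proof.
  intros Hab F K HK HF.
  set (cl := fun x => Rmax a (Rmin b x)).
  assert (Hcl : forall x, a <= cl x <= b).
  { intro x. unfold cl, Rmax, Rmin. repeat destruct (Rle_dec _ _); lra. }
  assert (Hcl1 : forall x, a <= x <= b -> cl x = x).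
  { intros x Hx. unfold cl, Rmax, Rmin. repeat destruct (Rle_dec _ _); lra. }
  assert (Hcl2 : forall x y, Rabs (cl x - cl y) <= Rabs (x - y)).
  { intros x y. unfold cl, Rmax, Rmin, Rabs.
    repeat destruct (Rle_dec _ _); repeat destruct (Rcase_abs _); lra. }
  destruct (continuity_ab_min (fun x => F (cl x)) a b Hab) as [m [Hm1 Hm2]].
  - intros c _. apply (Lipschitz_continuity_pt _ K); auto. intros x y.
    eapply Rle_trans; [apply HF; apply Hcl|]. apply Rmult_le_compat_l; auto.
  - exists m. split; auto. intros y Hy. specialize (Hm1 y Hy). simpl in Hm1. rewrite !Hcl1 in Hm1 by auto. exact Hm1.
Qed.

(** Minimise in the second variable first, with a minimiser [s x] picked by choice; the partial
    minimum is again Lipschitz in x with the same constant. *)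
Lemma min_attained_prod {X Y : Type} (P : X -> Prop) (d : X -> X -> R) (Q : Y -> Prop) (d' : Y -> Y -> R) :
  (forall x, P x -> d x x = 0) -> (forall y, Q y -> d' y y = 0) ->
  min_attained P d -> min_attained Q d' ->
  min_attained (fun p : X * Y => P (fst p) /\ Q (snd p)) (fun p q => d (fst p) (fst q) + d' (snd p) (snd q)).
Proof.
  intros Hd Hd' MP MQ F K HK HF.
  assert (Hy : forall x, exists y, P x -> Q y /\ forall z, Q z -> F (x, y) <= F (x, z)).
  { intro x. destruct (excluded_middle_informative (P x)) as [Hx|Hx].
    - destruct (MQ (fun y => F (x, y)) K HK) as [y Hy].
      + intros y z Qy Qz. specialize (HF (x, y) (x, z)). simpl in HF. rewrite (Hd x Hx), Rplus_0_l in HF.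
        apply HF; auto.
      + exists y. auto.
    (* Off [P] any element of [Y] will do, and a minimiser of a constant function supplies one. *)
    - destruct (MQ (fun _ => 0) 0 ltac:(lra)) as [y _].
      + intros. rewrite Rminus_diag, Rabs_R0. lra.
      + exists y. intro; contradiction. }
  set (s := fun x => proj1_sig (constructive_indefinite_description _ (Hy x))).
  assert (Hs : forall x, P x -> Q (s x) /\ forall z, Q z -> F (x, s x) <= F (x, z)).
  { intro x. unfold s. apply (proj2_sig (constructive_indefinite_description _ (Hy x))). }
  destruct (MP (fun x => F (x, s x)) K HK) as [x [Px Hx]].
  - assert (O : forall x y, P x -> P y -> F (x, s x) - F (y, s y) <= K * d x y).
    { intros x y Px Py. destruct (Hs x Px) as [Qx Lx]. destruct (Hs y Py) as [Qy _].
      pose proof (Lx _ Qy) as L. specialize (HF (x, s y) (y, s y) (conj Px Qy) (conj Py Qy)).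
      simpl in HF. rewrite (Hd' _ Qy), Rplus_0_r in HF. apply Rabs_le_between in HF. lra. }
    assert (O' : forall x y, P x -> P y -> F (y, s y) - F (x, s x) <= K * d x y).
    { intros x y Px Py. destruct (Hs x Px) as [Qx _]. destruct (Hs y Py) as [Qy Ly].
      pose proof (Ly _ Qx) as L. specialize (HF (x, s x) (y, s x) (conj Px Qx) (conj Py Qx)).
      simpl in HF. rewrite (Hd' _ Qx), Rplus_0_r in HF. apply Rabs_le_between in HF. lra. }
    intros x y Px Py. apply Rabs_le. split; [pose proof (O' x y Px Py) | pose proof (O x y Px Py)]; lra.
  - exists (x, s x). destruct (Hs x Px) as [Qx _]. split; [simpl; auto|].
    intros [y z] [Py Qz]. simpl in *. destruct (Hs y Py) as [_ Ly]. specialize (Hx y Py). specialize (Ly z Qz). lra.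
Qed.

Lemma min_attained_image {X Y : Type} (P : X -> Prop) (d : X -> X -> R) (Q : Y -> Prop) (d' : Y -> Y -> R)
  (f : X -> Y) (L : R) : 0 <= L -> (forall x, P x -> Q (f x)) -> (forall y, Q y -> exists x, P x /\ f x = y) ->
  (forall x x', P x -> P x' -> d' (f x) (f x') <= L * d x x') -> min_attained P d -> min_attained Q d'.
Proof.
  intros HL Hf Hsurj Hd M F K HK HF.
  destruct (M (fun x => F (f x)) (K * L)) as [x [Px Hx]].
  - apply Rmult_le_pos; auto.
  - intros x y Px Py. eapply Rle_trans; [apply HF; auto|]. rewrite Rmult_assoc. apply Rmult_le_compat_l; auto.
  - exists (f x). split; auto. intros y Qy. destruct (Hsurj y Qy) as [x' [Px' <-]]. auto.
Qed.

Lemma polar_form (z : C) : exists theta, - PI <= theta <= PI /\ z = (RtoC (Cmod z) * cis theta)%C.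
Proof.
  destruct (Req_dec (Cmod z) 0) as [E|E].
  - exists 0. pose proof PI_RGT_0. split; [lra|]. apply Cmod_eq_0 in E. subst. rewrite Cmod_0. ring.
  - pose proof (Cmod_ge_0 z). pose proof (Cmod_sqr z) as Q. destruct z as [x y]. set (m := Cmod (x, y)) in *.
    simpl in Q. set (u := x / m). set (v := y / m).
    assert (Huv : u ^ 2 + v ^ 2 = 1).
    { unfold u, v. replace ((x / m) ^ 2 + (y / m) ^ 2) with ((x ^ 2 + y ^ 2) / m ^ 2) by (field; lra).
      simpl. rewrite <- Q. field. lra. }
    assert (Hu : -1 <= u <= 1) by nra.
    pose proof (acos_bound u) as [B1 B2]. pose proof (cos_acos u Hu) as E1. pose proof (sin_acos u Hu) as E2.
    assert (Ex : x = m * u) by (unfold u; field; lra).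
    assert (Ey : y = m * v) by (unfold v; field; lra).
    replace (1 - u²) with (v ^ 2) in E2 by (unfold Rsqr; lra).
    destruct (Rle_lt_dec 0 v).
    + exists (acos u). split; [lra|]. unfold cis, Cmult, RtoC; simpl. rewrite sqrt_pow2 in E2 by auto.
      rewrite E1, E2. f_equal; lra.
    + exists (- acos u). split; [lra|]. unfold cis, Cmult, RtoC; simpl.
      replace (v ^ 2) with ((- v) ^ 2) in E2 by ring. rewrite sqrt_pow2 in E2 by lra.
      rewrite cos_neg, sin_neg, E1, E2. f_equal; lra.
Qed.

(** The disc is the image of the rectangle of polar coordinates, with Lipschitz constant
    [1 + rho]. *)
Lemma min_attained_disc (rho : R) : 0 <= rho ->
  min_attained (fun z => Cmod z <= rho) (fun z w => Cmod (z - w)%C).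
Proof.
  intro Hr. pose proof PI_RGT_0.
  apply (min_attained_image (fun p : R * R => (0 <= fst p <= rho) /\ (- PI <= snd p <= PI))
    (fun p q => Rabs (fst p - fst q) + Rabs (snd p - snd q)) _ _
    (fun p => RtoC (fst p) * cis (snd p))%C (1 + rho)); [lra| | | |].
  - intros [s th] [Hs _]. simpl in *. rewrite Cmod_mult_cis, Cmod_R, Rabs_pos_eq; lra.
  - intros z Hz. destruct (polar_form z) as [th [Hth E]]. exists (Cmod z, th). simpl.
    split; [split; [split; [apply Cmod_ge_0 | auto] | auto] | auto].
  - intros [s th] [s' th'] [Hs _] [Hs' _]. cbn [fst snd] in *.
    replace (RtoC s * cis th - RtoC s' * cis th')%C
      with (RtoC (s - s') * cis th + RtoC s' * (cis th - cis th'))%C by (rewrite RtoC_minus; ring).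
    eapply Rle_trans; [apply Cmod_triangle|].
    rewrite Cmod_mult_cis, Cmod_mult, !Cmod_R, (Rabs_pos_eq s') by lra.
    pose proof (Cmod_cis_sub th th'). pose proof (Rabs_pos (s - s')). pose proof (Rabs_pos (th - th')).
    pose proof (Cmod_ge_0 (cis th - cis th')%C). nra.
  - apply (min_attained_prod (fun s => 0 <= s <= rho) (fun x y => Rabs (x - y)) (fun t => - PI <= t <= PI) (fun x y => Rabs (x - y))).
    + intros. rewrite Rminus_diag, Rabs_R0. reflexivity.
    + intros. rewrite Rminus_diag, Rabs_R0. reflexivity.
    + apply min_attained_interval; lra.
    + apply min_attained_interval; lra.
Qed.

(** The points are infinite sequences, unconstrained from index n on; a function that is Lipschitz
    for this distance cannot depend on those coordinates. In particular it is constant for n = 0. *)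
Lemma min_attained_polydisc (rho : nat -> R) (n : nat) : (forall i, (i < n)%nat -> 0 <= rho i) ->
  min_attained (fun a : nat -> C => forall i, (i < n)%nat -> Cmod (a i) <= rho i)
    (fun a b => Rsum (fun i => Cmod (a i - b i)%C) n).
Proof.
  assert (Z : forall a : nat -> C, forall m, Rsum (fun i => Cmod (a i - a i)%C) m = 0).
  { intros a m. induction m as [|m IH]; simpl; auto. rewrite IH.
    unfold Cminus. rewrite Cplus_opp_r, Cmod_0. ring. }
  induction n as [|n IH]; intro Hr.
  - intros F K HK HF. exists (fun _ => 0%C). split; [intros; lia|]. intros y _.
    specialize (HF (fun _ => 0%C) y ltac:(intros; lia) ltac:(intros; lia)). simpl in HF.
    apply Rabs_le_between in HF. lra.
  - set (upd := fun (p : (nat -> C) * C) i => if Nat.eq_dec i n then snd p else fst p i).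
    assert (U1 : forall p, upd p n = snd p).
    { intro p. unfold upd. destruct (Nat.eq_dec n n); [auto | lia]. }
    assert (U2 : forall p i, (i < n)%nat -> upd p i = fst p i).
    { intros p i Hi. unfold upd. destruct (Nat.eq_dec i n); [lia | auto]. }
    apply (min_attained_image
      (fun p : (nat -> C) * C => (forall i, (i < n)%nat -> Cmod (fst p i) <= rho i) /\ Cmod (snd p) <= rho n)
      (fun p q => Rsum (fun i => Cmod (fst p i - fst q i)%C) n + Cmod (snd p - snd q)%C) _ _ upd 1); [lra| | | |].
    + intros p [H1 H2] i Hi. unfold upd. destruct (Nat.eq_dec i n) as [->|]; auto. apply H1. lia.
    + intros a Ha. exists (a, a n). split.
      * simpl. split; [intros; apply Ha; lia | apply Ha; lia].
      * apply functional_extensionality. intro i. unfold upd. destruct (Nat.eq_dec i n); subst; auto.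
    + intros p q _ _. rewrite Rmult_1_l. cbn [Rsum]. rewrite !U1. apply Rplus_le_compat_r, Req_le, Rsum_ext.
      intros i Hi. rewrite !U2 by auto. reflexivity.
    + apply (min_attained_prod (fun a : nat -> C => forall i, (i < n)%nat -> Cmod (a i) <= rho i)
        (fun a b => Rsum (fun i => Cmod (a i - b i)%C) n) (fun z => Cmod z <= rho n) (fun z w => Cmod (z - w)%C)).
      * intros; apply Z.
      * intros y _. unfold Cminus. rewrite Cplus_opp_r. apply Cmod_0.
      * apply IH. auto.
      * apply min_attained_disc, Hr. lia.
Qed.

(** The mean square is Lipschitz in the coefficients: |u|^2 - |v|^2 is (|u| - |v|)(|u| + |v|), with
    both sums at most [B] in modulus and differing by at most [/ alpha] times the distance. *)
Lemma mean_square_min (alpha H : R) (Phi : nat -> R) (N : nat) : 0 < alpha -> 0 < H ->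
  (forall n, (1 <= n)%nat -> 0 < Phi n) ->
  exists m, is_min_over (admissible Phi N) (mean_square alpha H N) m.
Proof.
  intros Ha HH HPhi.
  (* Polydisc coordinates are counted from 0, coefficients from 1. *)
  set (sh := fun (b : nat -> C) n => b (pred n)).
  set (B := / alpha + / alpha * Rsum (fun i => Phi (S i)) N).
  assert (HPS : 0 <= Rsum (fun i => Phi (S i)) N).
  { apply Rsum_nonneg. intros. apply Rlt_le, HPhi. lia. }
  assert (Hia : 0 < / alpha) by (apply Rinv_0_lt_compat; auto).
  assert (HB : 0 <= B) by (unfold B; nra).
  assert (Hco : forall z i, Cmod (z / RtoC (INR (S i) + alpha))%C <= / alpha * Cmod z).
  { intros z i. pose proof (pos_INR (S i)).
    rewrite Cmod_div. 2: { intro E. apply RtoC_inj in E. lra. }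
    rewrite Cmod_R, Rabs_pos_eq by lra. unfold Rdiv. rewrite Rmult_comm.
    apply Rmult_le_compat_r; [apply Cmod_ge_0|]. apply Rinv_le_contravar; lra. }
  destruct (min_attained_polydisc (fun i => Phi (S i)) N
    ltac:(intros; apply Rlt_le, HPhi; lia)
    (fun b => mean_square alpha H N (sh b)) (H * (2 * B * / alpha))) as [b [Hb1 Hb2]].
  - apply Rmult_le_pos; [lra|]. apply Rmult_le_pos; lra.
  - intros b c Hb Hc. rewrite !mean_square_expsum by auto.
    set (Eb := expsum (freq alpha) (coef alpha (sh b)) (S N)).
    set (Ec := expsum (freq alpha) (coef alpha (sh c)) (S N)).
    set (D := Rsum (fun i => Cmod (b i - c i)%C) N).
    assert (Rb : Rcont (fun t => Cmod (Eb t) ^ 2)) by (apply Rcont_Cmod_sqr, Ccont_expsum).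
    assert (Rc : Rcont (fun t => Cmod (Ec t) ^ 2)) by (apply Rcont_Cmod_sqr, Ccont_expsum).
    assert (Bd : forall e : nat -> C, (forall i, (i < N)%nat -> Cmod (e i) <= Phi (S i)) ->
      forall t, Cmod (expsum (freq alpha) (coef alpha (sh e)) (S N) t) <= B).
    { intros e He t. unfold expsum. rewrite Csum_shift. eapply Rle_trans; [apply Cmod_triangle|].
      unfold B. apply Rplus_le_compat.
      - rewrite Cmod_mult_cis. simpl coef. rewrite Cmod_R, Rabs_pos_eq; lra.
      - eapply Rle_trans; [apply Cmod_Csum|]. rewrite <- Rsum_scal. apply Rsum_le. intros i Hi.
        rewrite Cmod_mult_cis. eapply Rle_trans; [apply Hco|].
        apply Rmult_le_compat_l; [lra|]. apply He, Hi. }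
    assert (Df : forall t, Cmod (Eb t - Ec t)%C <= / alpha * D).
    { intro t. unfold Eb, Ec, expsum. rewrite !Csum_shift.
      match goal with |- Cmod (?p + ?u - (?q + ?v))%C <= _ => replace (p + u - (q + v))%C with (u - v)%C by (simpl coef; ring) end.
      rewrite <- Csum_minus. eapply Rle_trans; [apply Cmod_Csum|].
      unfold D. rewrite <- Rsum_scal. apply Rsum_le. intros i Hi.
      unfold coef, sh. simpl pred.
      replace (b i / RtoC (INR (S i) + alpha) * cis (freq alpha (S i) * t) - c i / RtoC (INR (S i) + alpha) * cis (freq alpha (S i) * t))%C
        with ((b i - c i) / RtoC (INR (S i) + alpha) * cis (freq alpha (S i) * t))%C by (unfold Cdiv; ring).
      rewrite Cmod_mult_cis. apply Hco. }
    assert (E : RInt (fun t => Cmod (Eb t) ^ 2) 0 H - RInt (fun t => Cmod (Ec t) ^ 2) 0 H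
      = RInt (fun t => Cmod (Eb t) ^ 2 - Cmod (Ec t) ^ 2) 0 H).
    { symmetry. apply (RInt_minus (fun t => Cmod (Eb t) ^ 2) (fun t => Cmod (Ec t) ^ 2)); apply Rcont_ex_RInt; auto. }
    rewrite E. eapply Rle_trans; [apply abs_RInt_le; [lra|apply Rcont_ex_RInt; auto with cont]|].
    replace (H * (2 * B * / alpha) * D) with (RInt (fun _ => 2 * B * / alpha * D) 0 H).
    2: { rewrite RInt_const. unfold scal; simpl; unfold mult; simpl. ring. }
    apply RInt_le; [lra| | |].
    + apply Rcont_ex_RInt. intro t. apply (continuous_Rabs_comp (fun t => Cmod (Eb t) ^ 2 - Cmod (Ec t) ^ 2)).
      apply (Rcont_minus _ _ Rb Rc).
    + apply Rcont_ex_RInt, Rcont_const.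
    + intros t _. replace (Cmod (Eb t) ^ 2 - Cmod (Ec t) ^ 2) with ((Cmod (Eb t) - Cmod (Ec t)) * (Cmod (Eb t) + Cmod (Ec t))) by ring.
      rewrite Rabs_mult. specialize (Df t).
      pose proof (Bd b Hb t) as B1. pose proof (Bd c Hc t) as B2. fold Eb in B1. fold Ec in B2.
      pose proof (Cmod_ge_0 (Eb t)). pose proof (Cmod_ge_0 (Ec t)).
      assert (Tr : Rabs (Cmod (Eb t) - Cmod (Ec t)) <= / alpha * D).
      { pose proof (Cmod_triangle (Eb t - Ec t) (Ec t)) as T1. replace (Eb t - Ec t + Ec t)%C with (Eb t) in T1 by ring.
        pose proof (Cmod_triangle (- (Eb t - Ec t)) (Eb t)) as T2. replace (- (Eb t - Ec t) + Eb t)%C with (Ec t) in T2 by ring.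
        rewrite Cmod_opp in T2. apply Rabs_le. lra. }
      rewrite (Rabs_pos_eq (_ + _)) by lra.
      replace (2 * B * / alpha * D) with (/ alpha * D * (2 * B)) by ring.
      apply Rmult_le_compat; try lra. apply Rabs_pos.
  - exists (mean_square alpha H N (sh b)). split.
    + exists (sh b). split; auto. intros n Hn. destruct n as [|n]; [lia|]. apply Hb1. lia.
    + intros a Had. specialize (Hb2 (fun i => a (S i))).
      replace (mean_square alpha H N a) with (mean_square alpha H N (sh (fun i => a (S i)))).
      * apply Hb2. intros i Hi. apply Had. lia.
      * rewrite !mean_square_expsum by auto. apply RInt_ext. intros t _. do 2 f_equal.
        unfold expsum. apply Csum_ext. intros [|i] _; reflexivity.
Qed.

(** * Lower bound *)

(** The multiplier by which averaging a function over [t, t + h] acts on its component of frequency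
    x. *)
Definition average (h x : R) : C := (RtoC (/ h) * CI (fun u => cis (x * u)) 0 h)%C.

Lemma average_le_1 (h x : R) : 0 < h -> Cmod (average h x) <= 1.
Proof.
  intro Hh. unfold average. pose proof (Rinv_0_lt_compat _ Hh).
  rewrite Cmod_mult, Cmod_R, Rabs_pos_eq by lra.
  assert (Cmod (CI (fun u => cis (x * u)) 0 h) <= (h - 0) * 1).
  { apply CI_le_const; auto with cont; try lra. intros t _. rewrite Cmod_cis. lra. }
  apply (Rmult_le_reg_l h); auto. rewrite <- Rmult_assoc, Rinv_r by lra. lra.
Qed.

Lemma average_0 (h : R) : 0 < h -> average h 0 = 1%C.
Proof.
  intro Hh. unfold average.
  rewrite (CI_ext _ (fun _ => 1%C)); [|lra|].
  - rewrite CI_const. rewrite Rminus_0_r, Cmult_1_r, <- RtoC_mult, Rinv_l by lra. reflexivity.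
  - intros t _. rewrite Rmult_0_l. apply cis_0.
Qed.

Lemma average_decay (h x : R) : 0 < h -> 0 < x -> Cmod (average h x) <= 2 / (h * x).
Proof.
  intros Hh Hx. unfold average. pose proof (Rinv_0_lt_compat _ Hh).
  rewrite Cmod_mult, Cmod_R, Rabs_pos_eq by lra.
  pose proof (f_equal Cmod (CI_cis x 0 h)) as E.
  rewrite !Cmod_mult, Cmod_Ci, Cmod_R, Rabs_pos_eq in E by lra.
  assert (B : Cmod (cis (x * h) - cis (x * 0))%C <= 2).
  { eapply Rle_trans; [apply Cmod_triangle|]. rewrite Cmod_opp, !Cmod_cis. lra. }
  rewrite <- E in B. apply (Rmult_le_reg_l (h * x)); [nra|].
  replace (h * x * (2 / (h * x))) with 2 by (field; lra).
  rewrite Rmult_1_l in B. replace (h * x * (/ h * Cmod (CI (fun u => cis (x * u)) 0 h)))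
    with (x * Cmod (CI (fun u => cis (x * u)) 0 h)) by (field; lra). exact B.
Qed.

Lemma expsum_average (nu : nat -> R) (c : nat -> C) (n : nat) (h t : R) :
  (RtoC (/ h) * CI (fun u => expsum nu c n (t + u)%R) 0 h)%C
  = expsum nu (fun i => c i * average h (nu i))%C n t.
Proof.
  unfold expsum.
  rewrite (CI_Csum (fun i u => c i * cis (nu i * (t + u)))%C).
  2: { intro i. apply Ccont_mult; auto with cont. }
  rewrite <- Csum_scal. apply Csum_ext. intros i _.
  transitivity (RtoC (/ h) * (c i * cis (nu i * t) * CI (fun u => cis (nu i * u)) 0 h))%C.
  - f_equal. rewrite <- CI_scal by auto with cont.
    assert (E : forall u, (c i * cis (nu i * (t + u)))%C = (c i * cis (nu i * t) * cis (nu i * u))%C).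
    { intro u. rewrite Rmult_plus_distr_l, cis_plus. ring. }
    unfold CI. f_equal; apply RInt_ext; intros u _; rewrite E; reflexivity.
  - unfold average. ring.
Qed.

Lemma expsum_average_sup (nu : nat -> R) (c : nat -> C) (n : nat) (h b M : R) : 0 < h ->
  (forall t, 0 <= t <= b -> Cmod (expsum nu c n t) <= M) ->
  forall t, 0 <= t <= b - h -> Cmod (expsum nu (fun i => c i * average h (nu i))%C n t) <= M.
Proof.
  intros Hh HM t Ht. rewrite <- expsum_average. pose proof (Rinv_0_lt_compat _ Hh).
  rewrite Cmod_mult, Cmod_R, Rabs_pos_eq by lra.
  apply (Rmult_le_reg_l h); auto. rewrite <- Rmult_assoc, Rinv_r, Rmult_1_l by lra.
  replace (h * M) with ((h - 0) * M) by ring.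
  apply CI_le_const; [lra| |].
  - apply (Ccont_comp (expsum nu c n)); auto with cont.
  - intros u Hu. apply HM. lra.
Qed.

(* The only place where the mean square enters: [|F| <= (d + |F|^2 / d) / 2]. *)
Lemma expsum_average_L2 (nu : nat -> R) (c : nat -> C) (n : nat) (h b d : R) : 0 < h -> 0 < d ->
  forall t, 0 <= t <= b - h -> Cmod (expsum nu (fun i => c i * average h (nu i))%C n t)
    <= d / 2 + RInt (fun u => Cmod (expsum nu c n u) ^ 2) 0 b / (2 * d * h).
Proof.
  intros Hh Hd t Ht. rewrite <- expsum_average. pose proof (Rinv_0_lt_compat _ Hh).
  rewrite Cmod_mult, Cmod_R, Rabs_pos_eq by lra.
  assert (Rc : Rcont (fun u => Cmod (expsum nu c n u) ^ 2)) by (apply Rcont_Cmod_sqr, Ccont_expsum).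
  set (E := RInt (fun u => Cmod (expsum nu c n u) ^ 2) 0 b).
  assert (B : Cmod (CI (fun u => expsum nu c n (t + u)%R) 0 h) <= h * (d / 2) + / (2 * d) * E).
  { apply (Rle_trans _ (RInt (fun u => d / 2 + / (2 * d) * Cmod (expsum nu c n (t + u)) ^ 2) 0 h)).
    - apply CI_le; [lra| | |].
      + apply (Ccont_comp (expsum nu c n)); auto with cont.
      + apply Rcont_plus; auto with cont. apply Rcont_mult; auto with cont.
        apply (Rcont_comp (fun u => Cmod (expsum nu c n u) ^ 2)); auto with cont.
      + intros u _. set (z := Cmod _).
        apply (Rmult_le_reg_l (2 * d)); [lra|].
        replace (2 * d * (d / 2 + / (2 * d) * z ^ 2)) with (d ^ 2 + z ^ 2) by (field; lra).
        pose proof (pow2_ge_0 (d - z)). nra.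
    - assert (Rs : Rcont (fun u => Cmod (expsum nu c n (t + u)) ^ 2)).
      { apply (Rcont_comp (fun u => Cmod (expsum nu c n u) ^ 2)); auto with cont. }
      rewrite (RInt_plus (fun _ => d / 2) (fun u => / (2 * d) * Cmod (expsum nu c n (t + u)) ^ 2))
        by (apply Rcont_ex_RInt; auto with cont).
      rewrite RInt_const, RInt_scal_R by auto.
      unfold scal, plus; simpl. unfold mult; simpl. rewrite Rminus_0_r. apply Rplus_le_compat_l.
      apply Rmult_le_compat_l. { apply Rlt_le, Rinv_0_lt_compat. lra. }
      change (RInt (fun u => Cmod (expsum nu c n (t + u)) ^ 2) 0 h <= E).
      replace (RInt (fun u => Cmod (expsum nu c n (t + u)) ^ 2) 0 h)
        with (RInt (fun u => Cmod (expsum nu c n u) ^ 2) t (t + h)).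
      2: { rewrite <- (Rplus_0_r t) at 1. 
           replace (t + 0) with (1 * 0 + t) by ring. replace (t + h) with (1 * h + t) by ring.
           rewrite <- (RInt_comp_lin (fun u => Cmod (expsum nu c n u) ^ 2)) by (apply Rcont_ex_RInt; auto).
           apply RInt_ext. intros u _. unfold scal; simpl; unfold mult; simpl.
           rewrite !Rmult_1_l, (Rplus_comm u t). reflexivity. }
      unfold E. rewrite <- (RInt_Chasles _ 0 t b), <- (RInt_Chasles _ t (t + h) b) by (apply Rcont_ex_RInt; auto).
      unfold plus; simpl.
      assert (P : forall p q, p <= q -> 0 <= RInt (fun u => Cmod (expsum nu c n u) ^ 2) p q).
      { intros p q Hpq. apply RInt_ge_0; auto. - apply Rcont_ex_RInt; auto. - intros; apply pow2_ge_0. }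
      pose proof (P 0 t ltac:(lra)) as P1. pose proof (P (t + h) b ltac:(lra)) as P2. simpl in P1, P2. lra. }
  apply (Rmult_le_reg_l h); auto. rewrite <- Rmult_assoc, Rinv_r, Rmult_1_l by lra.
  eapply Rle_trans; [exact B|]. apply Req_le. field. lra.
Qed.

Fixpoint averages (hs : list R) (x : R) : C :=
  match hs with nil => 1%C | h :: hs' => (average h x * averages hs' x)%C end.

Definition list_sum_R (hs : list R) : R := fold_right Rplus 0 hs.

Definition all_pos (hs : list R) : Prop := forall h, In h hs -> 0 < h.

Lemma expsum_ext (nu : nat -> R) (c d : nat -> C) (n : nat) (t : R) :
  (forall i, c i = d i) -> expsum nu c n t = expsum nu d n t.
Proof. intro H. apply Csum_ext. intros i _. rewrite H. reflexivity. Qed.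

Lemma expsum_averages_sup (nu : nat -> R) (n : nat) (M : R) (hs : list R) :
  all_pos hs -> forall (c : nat -> C) (b : R),
  (forall t, 0 <= t <= b -> Cmod (expsum nu c n t) <= M) ->
  forall t, 0 <= t <= b - list_sum_R hs -> Cmod (expsum nu (fun i => c i * averages hs (nu i))%C n t) <= M.
Proof.
  induction hs as [|h hs IH]; intros Hp c b HM t Ht.
  - rewrite (expsum_ext _ _ c). + apply HM. unfold list_sum_R in Ht. simpl in Ht. lra.
    + intro i. simpl. ring.
  - rewrite (expsum_ext _ _ (fun i => (c i * average h (nu i)) * averages hs (nu i))%C).
    2: { intro i. simpl. ring. }
    apply (IH ltac:(intros x Hx; apply Hp; right; auto) _ (b - h)).
    + apply expsum_average_sup; auto. apply Hp. left. reflexivity.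
    + unfold list_sum_R in *. simpl in Ht. lra.
Qed.

Lemma averages_app (l l' : list R) (x : R) : averages (l ++ l') x = (averages l x * averages l' x)%C.
Proof. induction l as [|h l IH]; simpl; [ring | rewrite IH; ring]. Qed.

Lemma averages_repeat (h x : R) (m : nat) : averages (repeat h m) x = (average h x ^ m)%C.
Proof. induction m as [|m IH]; simpl; [reflexivity | rewrite IH; reflexivity]. Qed.

Lemma averages_0 (hs : list R) : all_pos hs -> averages hs 0 = 1%C.
Proof.
  induction hs as [|h hs IH]; intro Hp; simpl; auto.
  rewrite average_0, IH; [ring | |].
  - intros x Hx. apply Hp. right. auto.
  - apply Hp. left. reflexivity.
Qed.

Lemma averages_le_1 (hs : list R) (x : R) : all_pos hs -> Cmod (averages hs x) <= 1.
Proof.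
  induction hs as [|h hs IH]; intro Hp; simpl.
  - rewrite Cmod_1. lra.
  - rewrite Cmod_mult. pose proof (average_le_1 h x (Hp h ltac:(left; auto))).
    pose proof (IH ltac:(intros y Hy; apply Hp; right; auto)).
    pose proof (Cmod_ge_0 (average h x)). pose proof (Cmod_ge_0 (averages hs x)). nra.
Qed.

Lemma averages_flat_map_le (f : nat -> list R) (l : list nat) (k : nat) (x : R) :
  (forall j, all_pos (f j)) -> In k l -> Cmod (averages (flat_map f l) x) <= Cmod (averages (f k) x).
Proof.
  intros Hf. induction l as [|j l IH]; intros [].
  - subst j. cbn [flat_map]. rewrite averages_app, Cmod_mult.
    assert (Cmod (averages (flat_map f l) x) <= 1).
    { apply averages_le_1. intros h Hh. apply in_flat_map in Hh. destruct Hh as [i [_ Hi]]. apply (Hf i h Hi). }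
    pose proof (Cmod_ge_0 (averages (f k) x)). nra.
  - cbn [flat_map]. rewrite averages_app, Cmod_mult. specialize (IH H).
    pose proof (averages_le_1 (f j) x (Hf j)). pose proof (Cmod_ge_0 (averages (f j) x)).
    pose proof (Cmod_ge_0 (averages (flat_map f l) x)). nra.
Qed.

Lemma list_sum_R_app (l l' : list R) : list_sum_R (l ++ l') = list_sum_R l + list_sum_R l'.
Proof. unfold list_sum_R. induction l as [|h l IH]; simpl; [ring | rewrite IH; ring]. Qed.

Lemma list_sum_R_repeat (h : R) (m : nat) : list_sum_R (repeat h m) = INR m * h.
Proof.
  induction m as [|m IH]; [simpl; ring|].
  rewrite S_INR. unfold list_sum_R in *. simpl repeat. simpl. rewrite IH. ring.
Qed.

Lemma list_sum_R_flat_map (h : nat -> R) (m : nat -> nat) (k0 len : nat) :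
  list_sum_R (flat_map (fun k => repeat (h k) (m k)) (seq k0 len))
  = Rsum (fun i => INR (m (i + k0)%nat) * h (i + k0)%nat) len.
Proof.
  induction len as [|len IH]; [reflexivity|].
  rewrite seq_S, flat_map_app, list_sum_R_app, IH. cbn [flat_map Rsum].
  rewrite app_nil_r, list_sum_R_repeat, (Nat.add_comm k0 len). reflexivity.
Qed.

(** * Growth of [Phi] and the averaging schedule *)

Definition nceil (x : R) : nat := Z.to_nat (up x).

Lemma nceil_bounds (x : R) : 0 <= x -> x <= INR (nceil x) <= x + 1.
Proof.
  intro Hx. destruct (archimed x) as [A1 A2]. unfold nceil.
  rewrite INR_IZR_INZ, Z2Nat.id. - lra.
  - apply le_IZR. lra.
Qed.

(* [Phi 0] is unconstrained, whence [Nat.max 1 n]. *)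
Definition growth (Phi : nat -> R) (n : nat) : R := ln (Phi (Nat.max 1 n)) - ln (Phi 1%nat).

Section Growth.
Variable Phi : nat -> R.
Hypothesis Phi_pos : forall n : nat, (1 <= n)%nat -> 0 < Phi n.
Hypothesis Phi_incr : forall m n : nat, (1 <= m <= n)%nat -> Phi m <= Phi n.

Lemma growth_mono (m n : nat) : (m <= n)%nat -> growth Phi m <= growth Phi n.
Proof.
  intro H. unfold growth. apply Rplus_le_compat_r.
  destruct (Phi_incr (Nat.max 1 m) (Nat.max 1 n) ltac:(lia)) as [L|L].
  - left. apply ln_increasing; auto. apply Phi_pos. lia.
  - rewrite L. lra.
Qed.

Lemma growth_nonneg (n : nat) : 0 <= growth Phi n.
Proof.
  pose proof (growth_mono 0 n ltac:(lia)) as H. unfold growth at 1 in H. simpl in H. lra.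
Qed.

Lemma Phi_growth (n : nat) : (1 <= n)%nat -> Phi n = Phi 1%nat * exp (growth Phi n).
Proof.
  intro H. unfold growth, Rminus. rewrite Nat.max_r by auto.
  rewrite exp_plus, exp_Ropp, !exp_ln by (apply Phi_pos; lia). 
  field. pose proof (Phi_pos 1%nat ltac:(lia)). lra.
Qed.

End Growth.

Lemma tower_bracket (n : nat) : (2 <= n)%nat -> exists k, (tower k <= n < tower (S k))%nat.
Proof.
  intro H. exists (Nat.log2 (Nat.log2 n)). unfold tower.
  pose proof (Nat.log2_spec n ltac:(lia)) as [A1 A2].
  assert (1 <= Nat.log2 n)%nat by (apply (Nat.log2_le_mono 2 n); lia).
  pose proof (Nat.log2_spec (Nat.log2 n) ltac:(lia)) as [B1 B2].
  split.
  - apply (Nat.le_trans _ (2 ^ Nat.log2 n)); auto. apply Nat.pow_le_mono_r; lia.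
  - apply (Nat.lt_le_trans _ (2 ^ S (Nat.log2 n))); auto. apply Nat.pow_le_mono_r; lia.
Qed.

Lemma exp_opp_1_ge : / 3 <= exp (- 1).
Proof.
  change (- 1) with (Ropp 1). rewrite exp_Ropp. apply Rinv_le_contravar; [apply exp_pos | apply exp_le_3].
Qed.

(* Step [24 / 2^k] is used [growth(tower (k+1)) + 2 k] times; each use gains a factor [1/3 < 1/e]
   on the frequencies [ln n], [tower k <= n < tower (k+1)]. *)
Definition multiplicity (Phi : nat -> R) (k : nat) : nat := (nceil (growth Phi (tower (S k))) + 2 * k)%nat.

Definition smoothing (Phi : nat -> R) (k : nat) : list R := repeat (24 / 2 ^ k) (multiplicity Phi k).

Lemma two_pow_pos (k : nat) : 0 < 2 ^ k.
Proof. apply pow_lt. lra. Qed.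

(** * Convergent series: the mean square stays away from 0 *)

Section Lower.
Variables alpha H : R.
Variable Phi : nat -> R.
Hypothesis alpha_pos : 0 < alpha.
Hypothesis Phi_pos : forall n : nat, (1 <= n)%nat -> 0 < Phi n.
Hypothesis Phi_incr : forall m n : nat, (1 <= m <= n)%nat -> Phi m <= Phi n.
Hypothesis H_pos : 0 < H.

Lemma smoothing_pos (k : nat) : all_pos (smoothing Phi k).
Proof.
  intros h Hh. apply repeat_spec in Hh. subst. apply Rdiv_lt_0_compat; [lra | apply two_pow_pos].
Qed.

Lemma freq_lower (n : nat) : (1 <= n)%nat -> ln (INR n) - ln alpha <= freq alpha n.
Proof.
  intro Hn. unfold freq. assert (0 < INR n) by (apply lt_0_INR; lia).
  rewrite ln_div by lra. apply Rplus_le_compat_r. left. apply ln_increasing; lra.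
Qed.

(** The hypothesis on alpha gives [freq >= 2^k / 4], so step times frequency is at least 6 and one
    average gains 2/6 <= 1/e: hence the 24. The growth part of the multiplicity cancels [Phi n]; the
    part 2 k leaves e^{-2k} <= 4^{-k} <= 4 / ln^2 n, which turns 1/n into the summable
    [logweight]. *)
Lemma smoothing_decay (k n : nat) : ln alpha <= 2 ^ k / 4 -> (tower k <= n < tower (S k))%nat ->
  Phi n / (INR n + alpha) * Cmod (averages (smoothing Phi k) (freq alpha n)) <= 4 * Phi 1%nat * logweight n.
Proof.
  intros Hk Hn. pose proof (tower_ge_2 k) as T2. pose proof (two_pow_pos k) as Pk.
  assert (HI : 0 < INR n) by (apply lt_0_INR; lia).
  assert (Ln : 2 ^ k / 2 <= ln (INR n)).
  { apply (Rle_trans _ (ln (INR (tower k)))).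
    - rewrite ln_tower. pose proof ln_lt_2. nra.
    - destruct (le_INR (tower k) n ltac:(lia)) as [L|L].
      + left. apply ln_increasing; auto. apply lt_0_INR. lia.
      + rewrite L. lra. }
  assert (Un : ln (INR n) <= 2 * 2 ^ k).
  { apply (Rle_trans _ (ln (INR (tower (S k))))).
    - left. apply ln_increasing; auto. apply lt_INR. lia.
    - rewrite ln_tower. pose proof ln_2_bounds. simpl. nra. }
  pose proof (freq_lower n ltac:(lia)) as Fl.
  assert (Fq : 2 ^ k / 4 <= freq alpha n) by lra.
  unfold smoothing. rewrite averages_repeat, Cmod_pow.
  assert (Hh : 0 < 24 / 2 ^ k) by (apply Rdiv_lt_0_compat; lra).
  assert (A : Cmod (average (24 / 2 ^ k) (freq alpha n)) <= exp (- 1)).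
  { eapply Rle_trans; [apply average_decay; lra|]. eapply Rle_trans; [|apply exp_opp_1_ge].
    assert (6 <= 24 / 2 ^ k * freq alpha n).
    { replace 6 with (24 / 2 ^ k * (2 ^ k / 4)) by (field; lra). apply Rmult_le_compat_l; lra. }
    unfold Rdiv at 1. apply (Rmult_le_reg_r (24 / 2 ^ k * freq alpha n)); [lra|].
    rewrite Rmult_assoc, Rinv_l by lra. lra. }
  set (g := growth Phi (tower (S k))).
  assert (Ap : Cmod (average (24 / 2 ^ k) (freq alpha n)) ^ multiplicity Phi k <= exp (- g) * exp (- (2 * INR k))).
  { eapply Rle_trans; [apply pow_incr; split; [apply Cmod_ge_0 | exact A]|].
    rewrite <- exp_INR_mult, <- exp_plus.
    assert (Q : INR (multiplicity Phi k) >= g + 2 * INR k).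
    { unfold multiplicity. rewrite plus_INR, mult_INR. simpl (INR 2).
      pose proof (nceil_bounds g (growth_nonneg Phi Phi_pos Phi_incr _)). unfold g in *. lra. }
    destruct (Rle_lt_or_eq_dec (INR (multiplicity Phi k) * - 1) (- g + - (2 * INR k))) as [L|L]; [lra| |].
    - left. apply exp_increasing. exact L.
    - rewrite L. lra. }
  assert (Pn : Phi n <= Phi 1%nat * exp g).
  { rewrite (Phi_growth Phi Phi_pos n) by lia. apply Rmult_le_compat_l. { apply Rlt_le, Phi_pos; lia. }
    destruct (growth_mono Phi Phi_pos Phi_incr n (tower (S k)) ltac:(lia)) as [L|L].
    - left. apply exp_increasing, L.
    - unfold g. rewrite L. lra. }
  assert (Ek : exp (- (2 * INR k)) <= / (2 ^ k * 2 ^ k)).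
  { replace (- (2 * INR k)) with (INR k * - 2) by ring. rewrite exp_INR_mult.
    rewrite <- Rpow_mult_distr, <- pow_inv. apply pow_incr. split; [apply Rlt_le, exp_pos|].
    change (- 2) with (Ropp 2). rewrite exp_Ropp. apply Rinv_le_contravar; [lra|].
    replace 2 with (1 + 1) at 3 by ring. rewrite exp_plus. pose proof (exp_ineq1_le 1). nra. }
  pose proof (Phi_pos n ltac:(lia)) as Pn0. pose proof (Phi_pos 1%nat ltac:(lia)) as P10.
  pose proof (exp_pos g) as Eg.
  assert (Step : Phi n * Cmod (average (24 / 2 ^ k) (freq alpha n)) ^ multiplicity Phi k
    <= Phi 1%nat * / (2 ^ k * 2 ^ k)).
  { apply (Rle_trans _ (Phi 1%nat * exp g * (exp (- g) * exp (- (2 * INR k))))).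
    - apply Rmult_le_compat; auto; try lra. apply pow_le, Cmod_ge_0.
    - replace (Phi 1%nat * exp g * (exp (- g) * exp (- (2 * INR k))))
        with (Phi 1%nat * exp (- (2 * INR k)) * (exp g * exp (- g))) by ring.
      rewrite <- exp_plus, Rplus_opp_r, exp_0, Rmult_1_r. apply Rmult_le_compat_l; lra. }
  unfold logweight. rewrite Rinv_mult.
  assert (Lw : / (2 ^ k * 2 ^ k) <= 4 * / ln (INR n) ^ 2).
  { replace (/ (2 ^ k * 2 ^ k)) with (4 * / (2 * 2 ^ k) ^ 2) by (field; lra).
    apply Rmult_le_compat_l; [lra|]. apply Rinv_le_contravar; [nra|]. apply pow_incr. lra. }
  assert (I1 : / (INR n + alpha) <= / INR n) by (apply Rinv_le_contravar; lra).
  assert (I2 : 0 < / (INR n + alpha)) by (apply Rinv_0_lt_compat; lra).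
  assert (I3 : 0 < / ln (INR n) ^ 2) by (apply Rinv_0_lt_compat; nra).
  assert (I4 : 0 < / (2 ^ k * 2 ^ k)) by (apply Rinv_0_lt_compat; nra).
  replace (Phi n / (INR n + alpha) * Cmod (average (24 / 2 ^ k) (freq alpha n)) ^ multiplicity Phi k)
    with (/ (INR n + alpha) * (Phi n * Cmod (average (24 / 2 ^ k) (freq alpha n)) ^ multiplicity Phi k))
    by (unfold Rdiv; ring).
  replace (4 * Phi 1%nat * (/ INR n * / ln (INR n) ^ 2)) with (/ INR n * (Phi 1%nat * (4 * / ln (INR n) ^ 2))) by ring.
  apply Rmult_le_compat; [lra| |exact I1|].
  - apply Rmult_le_pos; [lra|]. apply pow_le, Cmod_ge_0.
  - eapply Rle_trans; [exact Step|]. apply Rmult_le_compat_l; lra.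
Qed.

(** Passing from [tower (S k)] to the given series doubles 24 to 48; the rounding and the 2 k are
    absorbed by a geometric series through Bernoulli's inequality [1 + k/2 <= (3/2)^k]. *)
Lemma ex_series_steps : ex_series (fun k => growth Phi (tower k) * / 2 ^ k) ->
  ex_series (fun k => INR (multiplicity Phi k) * (24 / 2 ^ k)).
Proof.
  intro Hs. apply (ex_series_shift_iff _ 1) in Hs.
  apply (@ex_series_le R_AbsRing R_CompleteNormedModule _ (fun k => 48 * (growth Phi (tower (k + 1)) * / 2 ^ (k + 1)) + 96 * (3 / 4) ^ k)).
  - intro k. unfold norm; simpl. unfold abs; simpl. pose proof (two_pow_pos k) as Pk.
    rewrite Rabs_pos_eq.
    2: { apply Rmult_le_pos; [apply pos_INR|]. apply Rlt_le, Rdiv_lt_0_compat; lra. }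
    unfold multiplicity. rewrite plus_INR, mult_INR. simpl (INR 2).
    rewrite Nat.add_1_r.
    pose proof (nceil_bounds _ (growth_nonneg Phi Phi_pos Phi_incr (tower (S k)))) as B.
    set (g := growth Phi (tower (S k))) in *.
    pose proof (poly k (1 / 2) ltac:(lra)) as Pl.
    replace (1 + 1 / 2) with (3 / 2) in Pl by field.
    assert (E : (3 / 4) ^ k = (3 / 2) ^ k * / 2 ^ k).
    { rewrite <- pow_inv, <- Rpow_mult_distr. f_equal. field. }
    rewrite E. simpl pow. rewrite Rinv_mult. unfold Rdiv.
    pose proof (Rinv_0_lt_compat _ Pk) as IP.
    replace (48 * (g * (/ 2 * / 2 ^ k)) + 96 * ((3 * / 2) ^ k * / 2 ^ k)) with ((24 * g + 96 * (3 * / 2) ^ k) * / 2 ^ k) by (field; lra).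
    replace ((INR (nceil g) + (1 + 1) * INR k) * (24 * / 2 ^ k)) with (24 * (INR (nceil g) + 2 * INR k) * / 2 ^ k) by ring.
    apply Rmult_le_compat_r; [lra|]. unfold Rdiv in Pl. lra.
  - apply (ex_series_plus (fun k => 48 * (growth Phi (tower (k + 1)) * / 2 ^ (k + 1))) (fun k => 96 * (3 / 4) ^ k)).
    + apply (ex_series_scal 48 (fun k => growth Phi (tower (k + 1)) * / 2 ^ (k + 1)) Hs).
    + apply (ex_series_scal 96 (fun k => (3 / 4) ^ k)). apply ex_series_geom. rewrite Rabs_pos_eq; lra.
Qed.

Lemma Rsum_eventually_zero (u : nat -> R) (n0 n : nat) : (forall i, 0 <= u i) -> (forall i, (n0 <= i)%nat -> u i = 0) ->
  Rsum u n <= Rsum u n0.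
Proof.
  intros Hu Hz. destruct (Nat.le_ge_cases n n0) as [L|L].
  - apply Rsum_mono; auto.
  - induction L as [|n L IH]; [lra|]. simpl. rewrite (Hz n L). lra.
Qed.

(** The list of steps may grow with N, but [S] and the total length may not. Only the levels from
    [k0] on are smoothed, so that the tail of the step series fits into H / 4; smaller n contribute
    a fixed finite sum. *)
Lemma smoothing_exists : ex_series (fun k => growth Phi (tower k) * / 2 ^ k) ->
  exists S, 0 <= S /\ forall N, exists hs, all_pos hs /\ list_sum_R hs <= H / 4 /\
    Rsum (fun i => Phi (Datatypes.S i) / (INR (Datatypes.S i) + alpha) * Cmod (averages hs (freq alpha (Datatypes.S i)))) N <= S.
Proof.
  intro Hs. pose proof (ex_series_steps Hs) as Hst.
  assert (Hpos : forall k, 0 <= INR (multiplicity Phi k) * (24 / 2 ^ k)).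
  { intro k. apply Rmult_le_pos; [apply pos_INR|]. apply Rlt_le, Rdiv_lt_0_compat; [lra | apply two_pow_pos]. }
  destruct (series_tail _ (H / 4) Hpos Hst ltac:(lra)) as [k1 Hk1].
  (* [k1] controls the total length; the other summand gives [ln alpha <= 2^k / 4], because
     [k <= 2^k]. *)
  set (k0 := (k1 + nceil (4 * Rabs (ln alpha)))%nat).
  assert (Hk0 : forall k, (k0 <= k)%nat -> ln alpha <= 2 ^ k / 4).
  { intros k Hk. pose proof (nceil_bounds (4 * Rabs (ln alpha))) as B.
    pose proof (Rabs_pos (ln alpha)). pose proof (Rle_abs (ln alpha)).
    assert (INR (nceil (4 * Rabs (ln alpha))) <= INR k) by (apply le_INR; unfold k0 in Hk; lia).
    pose proof (poly k 1 ltac:(lra)) as Pl. replace (1 + 1) with 2 in Pl by ring. lra. }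
  set (n0 := tower k0).
  (* Trivial bound below [n0], where no decay of the multipliers is used. *)
  set (u := fun n => if le_lt_dec n0 n then 0 else Phi (Nat.max 1 n) / alpha).
  assert (Hu : forall i, 0 <= u i).
  { intro i. unfold u. destruct (le_lt_dec n0 i); [lra|]. apply Rlt_le, Rdiv_lt_0_compat; auto. apply Phi_pos. lia. }
  pose proof (Phi_pos 1%nat ltac:(lia)) as P1.
  exists (Rsum u n0 + 4 * Phi 1%nat * Series logweight). split.
  { apply Rplus_le_le_0_compat. - apply Rsum_nonneg; auto.
    - apply Rmult_le_pos; [lra|]. pose proof (Rsum_le_Series logweight 0 logweight_nonneg ex_series_logweight). simpl in *. lra. }
  (* These levels reach every index up to N, since [k < tower k]. *)
  intro N. set (hs := flat_map (smoothing Phi) (seq k0 (Datatypes.S N))).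
  assert (Hall : all_pos hs).
  { intros h Hh. apply in_flat_map in Hh. destruct Hh as [k [_ Hk]]. apply (smoothing_pos k h Hk). }
  exists hs. split; [exact Hall|]. split.
  { unfold hs, smoothing. rewrite (list_sum_R_flat_map (fun k => 24 / 2 ^ k) (multiplicity Phi)).
    apply Hk1. unfold k0. lia. }
  apply (Rle_trans _ (Rsum (fun i => u i + 4 * Phi 1%nat * logweight i) (Datatypes.S N))).
  - replace (Rsum (fun i => u i + 4 * Phi 1%nat * logweight i) (Datatypes.S N)) with
      (Rsum (fun i => u (i + 1)%nat + 4 * Phi 1%nat * logweight (i + 1)) N + (u 0%nat + 4 * Phi 1%nat * logweight 0)).
    2: { rewrite (Rsum_shift (fun i => u i + 4 * Phi 1%nat * logweight i) 1), Nat.add_1_r. simpl. ring. }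
    assert (0 <= u 0%nat + 4 * Phi 1%nat * logweight 0).
    { pose proof (Hu 0%nat). pose proof (logweight_nonneg 0). nra. }
    match goal with |- ?a <= ?b + ?c => assert (a <= b); [|lra] end.
    apply Rsum_le. intros i Hi. rewrite Nat.add_1_r. set (n := Datatypes.S i).
    pose proof (logweight_nonneg n) as W. pose proof (Hu n) as Un.
    pose proof (Phi_pos n ltac:(lia)) as Pn. pose proof (pos_INR n) as In0.
    pose proof (Cmod_ge_0 (averages hs (freq alpha n))).
    destruct (le_lt_dec n0 n) as [L|L].
    + pose proof (tower_ge_2 k0) as T2. destruct (tower_bracket n ltac:(unfold n0 in L; lia)) as [k Hk].
      assert (Kk : (k0 <= k)%nat).
      { destruct (Nat.le_gt_cases k0 k) as [|G]; auto. pose proof (tower_mono (Datatypes.S k) k0 G). unfold n0 in L. lia. }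
      assert (KN : (k < k0 + Datatypes.S N)%nat).
      { destruct (Nat.lt_ge_cases k (k0 + Datatypes.S N)) as [|G]; auto. pose proof (tower_mono _ _ G).
        pose proof (tower_gt (k0 + Datatypes.S N)). lia. }
      pose proof (smoothing_decay k n (Hk0 k Kk) Hk) as D.
      assert (M : Cmod (averages hs (freq alpha n)) <= Cmod (averages (smoothing Phi k) (freq alpha n))).
      { apply averages_flat_map_le; [apply smoothing_pos|]. apply in_seq. lia. }
      assert (PQ : 0 < Phi n / (INR n + alpha)) by (apply Rdiv_lt_0_compat; lra).
      pose proof (Rmult_le_compat_l _ _ _ (Rlt_le _ _ PQ) M). lra.
    + pose proof (averages_le_1 hs (freq alpha n) Hall).
      assert (Q : Phi n / (INR n + alpha) <= u n).
      { unfold u. destruct (le_lt_dec n0 n); [lia|]. rewrite Nat.max_r by lia.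
        apply Rmult_le_compat_l; [lra|]. apply Rinv_le_contravar; lra. }
      assert (0 < Phi n / (INR n + alpha)) by (apply Rdiv_lt_0_compat; lra). nra.
  - rewrite Rsum_plus, Rsum_scal. apply Rplus_le_compat.
    + apply Rsum_eventually_zero; auto. intros i Hi. unfold u. destruct (le_lt_dec n0 i); [auto | lia].
    + apply Rmult_le_compat_l; [lra|]. apply Rsum_le_Series; [apply logweight_nonneg | apply ex_series_logweight].
Qed.

Lemma freq_mono (m n : nat) : (m <= n)%nat -> freq alpha m <= freq alpha n.
Proof.
  intro Hmn. unfold freq. apply le_INR in Hmn. pose proof (pos_INR m).
  rewrite !ln_div by lra. apply Rplus_le_compat_r.
  destruct Hmn as [L|L]; [left; apply ln_increasing; lra | rewrite L; lra].
Qed.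

Lemma freq_0 : freq alpha 0 = 0.
Proof. unfold freq. replace ((INR 0 + alpha) / alpha) with 1 by (simpl; field; lra). apply ln_1. Qed.

Lemma freq_1_pos : 0 < freq alpha 1.
Proof.
  unfold freq. rewrite <- ln_1. apply ln_increasing; [lra|].
  apply (Rmult_lt_reg_r alpha); auto. unfold Rdiv. rewrite Rmult_assoc, Rinv_l by lra. simpl. lra.
Qed.

(** The interval is spent as H/4 on passing from the mean square to a sup bound, H/4 on the
    smoothing and H/2 on [phi]. Pairing the smoothed sum with [phi] gives an integral [J], bounded
    above by [Msup * I] and below by A/2, since [phi] keeps the constant term and nearly kills the
    others. *)
Lemma mean_square_lower_bound : ex_series (fun k => growth Phi (tower k) * / 2 ^ k) ->
  exists l, 0 < l /\ forall N a, admissible Phi N a -> l <= mean_square alpha H N a.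
Proof.
  intro Hs. destruct (smoothing_exists Hs) as [S [HS0 HS]].
  set (A := / alpha). assert (HA : 0 < A) by (apply Rinv_0_lt_compat; auto).
  (* The errors are [A * kap] from frequency 0 and [2 * kap * S] from the rest; each is at most A/4,
     so A/2 survives. *)
  set (kap := Rmin (1 / 4) (A / (8 * (S + 1)))).
  assert (Hk0 : 0 < kap) by (apply Rmin_pos; [lra | apply Rdiv_lt_0_compat; lra]).
  assert (Hk1 : kap <= 1 / 4) by apply Rmin_l.
  assert (Hk2 : kap * S <= A / 8).
  { apply (Rle_trans _ (A / (8 * (S + 1)) * (S + 1))).
    - apply Rmult_le_compat; try lra. apply Rmin_r.
    - right. field. lra. }
  pose proof freq_1_pos as F1.
  (* [freq alpha 1] is the least nonzero frequency, so this y gives [exp (- (y * nu n)) <= kap] for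
     all n >= 1. *)
  set (y := / kap / freq alpha 1).
  assert (Hy : 0 < y) by (apply Rdiv_lt_0_compat; auto; apply Rinv_0_lt_compat; auto).
  assert (Ey : forall x, freq alpha 1 <= x -> exp (- (y * x)) <= kap).
  { intros x Hx. rewrite exp_Ropp. rewrite <- (Rinv_inv kap). 
    apply Rinv_le_contravar. { apply Rinv_0_lt_compat; auto. }
    assert (/ kap <= y * x).
    { replace (/ kap) with (y * freq alpha 1) by (unfold y; field; lra). apply Rmult_le_compat_l; lra. }
    pose proof (exp_ineq1_le (y * x)). lra. }
  destruct (half_line_approximation (H / 2) y kap) as [phi [Pc Pa]]; auto; try lra.
  set (I := RInt (fun x => Cmod (phi x)) 0 (H / 2) + 1).
  assert (HI : 0 < I).
  { unfold I. assert (0 <= RInt (fun x => Cmod (phi x)) 0 (H / 2)); [|lra].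
    apply RInt_ge_0; [lra| |]. - apply Rcont_ex_RInt, Rcont_Cmod, Pc. - intros; apply Cmod_ge_0. }
  set (c0 := A / (2 * I)). assert (Hc0 : 0 < c0) by (apply Rdiv_lt_0_compat; lra).
  exists (H * c0 ^ 2 / 4). split.
  { apply Rdiv_lt_0_compat; [|lra]. apply Rmult_lt_0_compat; [auto | apply pow_lt; auto]. }
  intros N a Ha. rewrite mean_square_expsum by auto.
  destruct (HS N) as [hs [Hp [Hsum HN]]].
  set (c := coef alpha a). set (nu := freq alpha).
  set (E := RInt (fun t => Cmod (expsum nu c (Datatypes.S N) t) ^ 2) 0 H).
  (* The free parameter of [expsum_average_L2] is taken to be [c0]: then [c0 <= Msup] forces
     [E >= H * c0^2 / 4]. *)
  set (Msup := c0 / 2 + E / (2 * c0 * (H / 4))).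
  set (c' := fun i => (c i * average (H / 4) (nu i) * averages hs (nu i))%C).
  assert (Sup : forall t, 0 <= t <= H / 2 -> Cmod (expsum nu c' (Datatypes.S N) t) <= Msup).
  { intros t Ht. apply (expsum_averages_sup nu _ Msup hs Hp (fun i => c i * average (H / 4) (nu i))%C (H - H / 4)); [|lra].
    apply expsum_average_L2; lra. }
  set (J := CI (fun x => phi x * expsum nu c' (Datatypes.S N) x)%C 0 (H / 2)).
  assert (HMs : 0 <= Msup) by (eapply Rle_trans; [apply Cmod_ge_0 | apply (Sup 0); lra]).
  assert (UJ : Cmod J <= Msup * I).
  { apply (Rle_trans _ (Msup * RInt (fun x => Cmod (phi x)) 0 (H / 2))).
    - rewrite <- RInt_scal_R by auto with cont. apply CI_le; auto with cont; [lra|].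
      intros t Ht. rewrite Cmod_mult, Rmult_comm. apply Rmult_le_compat_r; [apply Cmod_ge_0 | auto].
    - apply Rmult_le_compat_l; auto. unfold I. lra. }
  set (D := fun n => CI (fun x => phi x * cis (x * nu n))%C 0 (H / 2)).
  assert (Pcn : forall s, Ccont (fun x => phi x * cis (x * s))%C).
  { intro s. apply Ccont_mult; auto. apply Ccont_cis. auto with cont. }
  assert (EJ : J = Csum (fun i => c' i * D i)%C (Datatypes.S N)).
  { unfold J, D. 
    rewrite (CI_ext _ (fun x => Csum (fun i => c' i * (phi x * cis (x * nu i)))%C (Datatypes.S N))); [|lra|].
    - rewrite (CI_Csum (fun i x => c' i * (phi x * cis (x * nu i)))%C).
      + apply Csum_ext. intros i _. apply CI_scal. apply Pcn.
      + intro i. apply Ccont_mult; auto with cont.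
    - intros t _. unfold expsum. rewrite <- Csum_scal. apply Csum_ext. intros i _.
      rewrite (Rmult_comm t). ring. }
  assert (Fnn : forall n, 0 <= nu n) by (intro n; rewrite <- freq_0; apply freq_mono; lia).
  rewrite Csum_shift in EJ.
  assert (C0 : c' 0%nat = RtoC A).
  { unfold c', nu. rewrite freq_0, average_0, averages_0 by (auto; lra). unfold c, coef. fold A. ring. }
  assert (D0 : Cmod (D 0%nat - 1)%C <= kap).
  { pose proof (Pa (nu 0%nat) (Fnn _)) as Q. unfold nu in Q at 2. rewrite freq_0, Rmult_0_r, Ropp_0, exp_0 in Q. exact Q. }
  assert (Rest : Cmod (Csum (fun i => c' (Datatypes.S i) * D (Datatypes.S i))%C N) <= 2 * kap * S).
  { eapply Rle_trans; [apply Cmod_Csum|].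
    apply (Rle_trans _ (2 * kap * Rsum (fun i => Phi (Datatypes.S i) / (INR (Datatypes.S i) + alpha) * Cmod (averages hs (freq alpha (Datatypes.S i)))) N)).
    2: { apply Rmult_le_compat_l; [lra|]. exact HN. }
    rewrite <- Rsum_scal. apply Rsum_le. intros i Hi. set (n := Datatypes.S i).
    rewrite Cmod_mult, (Rmult_comm (2 * kap)). apply Rmult_le_compat; auto using Cmod_ge_0.
    - unfold c'. rewrite !Cmod_mult. fold (nu n). apply Rmult_le_compat_r; [apply Cmod_ge_0|].
      assert (Q1 : Cmod (c n) <= Phi n / (INR n + alpha)).
      { unfold c, coef, n. fold n. pose proof (pos_INR n).
        rewrite Cmod_div. 2: { intro G. apply RtoC_inj in G. lra. }
        rewrite Cmod_R, Rabs_pos_eq by lra. apply Rmult_le_compat_r.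
        - apply Rlt_le, Rinv_0_lt_compat. lra.
        - apply Ha. unfold n. lia. }
      pose proof (average_le_1 (H / 4) (nu n) ltac:(lra)). pose proof (Cmod_ge_0 (c n)).
      pose proof (Cmod_ge_0 (average (H / 4) (nu n))). nra.
    - replace (D n) with ((D n - RtoC (exp (- (y * nu n)))) + RtoC (exp (- (y * nu n))))%C by ring.
      eapply Rle_trans; [apply Cmod_triangle|].
      pose proof (Pa (nu n) (Fnn n)) as Q. fold (D n) in Q.
      rewrite Cmod_R, Rabs_pos_eq by (apply Rlt_le, exp_pos).
      pose proof (Ey (nu n) (freq_mono 1 n ltac:(unfold n; lia))). lra. }
  assert (LJ : A / 2 <= Cmod J).
  { assert (T : RtoC A = (J - RtoC A * (D 0%nat - 1) - Csum (fun i => c' (Datatypes.S i) * D (Datatypes.S i)) N)%C).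
    { rewrite EJ, C0. ring. }
    assert (T2 : A <= Cmod J + A * kap + 2 * kap * S).
    { rewrite <- (Rabs_pos_eq A) at 1 by lra. rewrite <- Cmod_R, T.
      eapply Rle_trans; [apply Cmod_triangle|]. rewrite Cmod_opp. apply Rplus_le_compat; [|exact Rest].
      eapply Rle_trans; [apply Cmod_triangle|]. rewrite Cmod_opp, Cmod_mult, Cmod_R, Rabs_pos_eq by lra.
      apply Rplus_le_compat_l, Rmult_le_compat_l; lra. }
    nra. }
  assert (K : c0 <= Msup).
  { apply (Rmult_le_reg_r I); auto. replace (c0 * I) with (A / 2) by (unfold c0; field; lra). lra. }
  unfold Msup in K.
  apply (Rmult_le_compat_r (c0 * H / 2)) in K; [|nra].
  replace ((c0 / 2 + E / (2 * c0 * (H / 4))) * (c0 * H / 2)) with (c0 ^ 2 * H / 4 + E) in K by (field; lra).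
  fold E. nra.
Qed.

End Lower.

(** * Approximating sums *)

Definition circle_term (x : R) (p : R * R) : R := 3 * snd p ^ 2 / (snd p ^ 2 + (x - fst p) ^ 2 / 100).

Definition center_term (y : R) (p : R * R) : R := snd p * y / (8 * ((snd p + y) ^ 2 + fst p ^ 2)).

Lemma circle_bound_le_exp (L : list (R * R)) (x : R) : positive_radii L ->
  circle_bound L x <= exp (list_sum_R (map (circle_term x) L)).
Proof.
  induction L as [|[c e] L IH]; intro H.
  - unfold list_sum_R. simpl. rewrite exp_0. lra.
  - apply positive_radii_inv in H. destruct H as [He H].
    change (exp (list_sum_R (map (circle_term x) ((c, e) :: L))))
      with (exp (circle_term x (c, e) + list_sum_R (map (circle_term x) L))).
    rewrite exp_plus. cbn [circle_bound].
    pose proof (circle_term_bounds c e x He) as T.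
    change (3 * e ^ 2 / (e ^ 2 + (x - c) ^ 2 / 100)) with (circle_term x (c, e)) in *.
    pose proof (exp_ineq1_le (circle_term x (c, e))). pose proof (circle_bound_bounds L x H).
    apply Rmult_le_compat; auto; lra.
Qed.

(** Keeping only the linear part of the product suffices, because the sum itself will be made
    arbitrarily large. *)
Lemma center_bound_ge_sum (L : list (R * R)) (y : R) : 0 < y -> positive_radii L ->
  1 + list_sum_R (map (center_term y) L) <= center_bound y L.
Proof.
  intro Hy. induction L as [|[c e] L IH]; intro H.
  - unfold list_sum_R. simpl. lra.
  - apply positive_radii_inv in H. destruct H as [He H].
    change (list_sum_R (map (center_term y) ((c, e) :: L)))
      with (center_term y (c, e) + list_sum_R (map (center_term y) L)).
    cbn [center_bound]. pose proof (center_term_pos y c e Hy He) as T.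
    change (e * y / (8 * ((e + y) ^ 2 + c ^ 2))) with (center_term y (c, e)) in *.
    pose proof (center_bound_ge_1 y L Hy H). specialize (IH H). nra.
Qed.

Lemma list_sum_R_map_flat_map (f : R * R -> R) (g : nat -> list (R * R)) (a n : nat) :
  list_sum_R (map f (flat_map g (seq a n))) = Rsum (fun i => list_sum_R (map f (g (i + a)%nat))) n.
Proof.
  induction n as [|n IH]; [reflexivity|].
  rewrite seq_S, flat_map_app, map_app, list_sum_R_app, IH. cbn [flat_map Rsum].
  rewrite app_nil_r, (Nat.add_comm a n). reflexivity.
Qed.

(** Spacing and radius are both 1/j. On the line the j terms then add up to O(1) near the grid and
    to O(1 / (j d^2)) at distance d, so multiplicities up to j are harmless far away. At the center
    they add up to about y / j^2. *)
Definition grid (j m : nat) : list (R * R) :=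
  flat_map (fun i => repeat (INR j + INR i / INR j, / INR j) m) (seq 0 j).

Definition net (m : nat -> nat) (J0 n : nat) : list (R * R) := flat_map (fun j => grid j (m j)) (seq J0 n).

Lemma net_positive (m : nat -> nat) (J0 n : nat) : (1 <= J0)%nat -> positive_radii (net m J0 n).
Proof.
  intros HJ c e H. apply in_flat_map in H. destruct H as [j [Hj H]]. apply in_seq in Hj.
  apply in_flat_map in H. destruct H as [i [_ H]]. apply repeat_spec in H. injection H; intros; subst.
  apply Rinv_0_lt_compat, lt_0_INR. lia.
Qed.

Lemma grid_sum (f : R * R -> R) (j m : nat) :
  list_sum_R (map f (grid j m)) = INR m * Rsum (fun i => f (INR j + INR i / INR j, / INR j)) j.
Proof.
  unfold grid. rewrite list_sum_R_map_flat_map, <- Rsum_scal. apply Rsum_ext. intros i _.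
  rewrite map_repeat, list_sum_R_repeat, Nat.add_0_r. reflexivity.
Qed.

Lemma atan_step (x : R) : / (1 + x ^ 2) <= 3 * (atan (x + 1) - atan x).
Proof.
  destruct (MVT_cor2 atan (fun u => / (1 + u ^ 2)) x (x + 1)) as [c [E Hc]]; [lra| |].
  - intros c _. apply derivable_pt_lim_atan.
  - rewrite E. replace (x + 1 - x) with 1 by ring. rewrite Rmult_1_r.
    pose proof (pow2_ge_0 c). pose proof (pow2_ge_0 x).
    replace (3 * / (1 + c ^ 2)) with (/ ((1 + c ^ 2) / 3)) by (field; lra).
    assert ((c - x) ^ 2 <= 1) by nra. pose proof (pow2_ge_0 (x - (c - x))).
    apply Rinv_le_contravar; lra.
Qed.

(** Telescoping [atan_step] leaves three times a difference of arctangents, at most 3 PI <= 12,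
    uniformly in s and n. *)
Lemma lattice_sum (s : R) (n : nat) : Rsum (fun i => / (1 + (s - INR i) ^ 2)) n <= 12.
Proof.
  assert (T : Rsum (fun i => / (1 + (s - INR i) ^ 2)) n <= 3 * (atan (s + 1) - atan (s + 1 - INR n))).
  { induction n as [|n IH].
    - simpl. rewrite !Rminus_0_r. lra.
    - rewrite Rsum_S, S_INR. pose proof (atan_step (s - INR n)) as A.
      replace (s - INR n + 1) with (s + 1 - INR n) in A by ring.
      replace (s + 1 - (INR n + 1)) with (s - INR n) by ring. lra. }
  pose proof (atan_bound (s + 1)). pose proof (atan_bound (s + 1 - INR n)). pose proof PI_4. lra.
Qed.

(** After scaling by j the centers become integers; replacing the denominator [1 + s^2/100] by
    [(1 + s^2)/100] gives 300 times a lattice sum. *)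
Lemma grid_circle_le (j : nat) (x : R) : (1 <= j)%nat ->
  Rsum (fun i => circle_term x (INR j + INR i / INR j, / INR j)) j <= 3600.
Proof.
  intro Hj. assert (J : 0 < INR j) by (apply lt_0_INR; lia).
  apply (Rle_trans _ (Rsum (fun i => 300 * / (1 + (INR j * (x - INR j) - INR i) ^ 2)) j)).
  - apply Rsum_le. intros i _. unfold circle_term; cbn [fst snd].
    set (s := INR j * (x - INR j) - INR i).
    replace (x - (INR j + INR i / INR j)) with (s / INR j) by (unfold s; field; lra).
    assert (0 <= s ^ 2) by apply pow2_ge_0.
    replace (3 * (/ INR j) ^ 2 / ((/ INR j) ^ 2 + (s / INR j) ^ 2 / 100)) with (3 * / (1 + s ^ 2 / 100)) by (field; nra).
    replace (300 * / (1 + s ^ 2)) with (3 * / ((1 + s ^ 2) / 100)) by (field; lra).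
    apply Rmult_le_compat_l; [lra|]. apply Rinv_le_contravar; lra.
  - rewrite Rsum_scal. pose proof (lattice_sum (INR j * (x - INR j)) j). lra.
Qed.

(** A center lies at offset v in [0, 1] from j, so distance at least 3 keeps [|d - v| >= 2/3 |d|].
    Then [(1 + d^2) / 250] is at most [(4/9) d^2 / 100], with equality at d^2 = 9, which gives 750 =
    3 * 250. *)
Lemma grid_circle_far (j : nat) (x : R) : (1 <= j)%nat -> 3 <= Rabs (x - INR j) ->
  INR j * Rsum (fun i => circle_term x (INR j + INR i / INR j, / INR j)) j <= 750 * / (1 + (x - INR j) ^ 2).
Proof.
  intros Hj Hx. assert (J : 0 < INR j) by (apply lt_0_INR; lia).
  set (d := x - INR j) in *.
  assert (Hd : 9 <= d ^ 2).
  { rewrite <- pow2_abs. pose proof (Rabs_pos d). nra. }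
  assert (B : forall i, (i < j)%nat -> circle_term x (INR j + INR i / INR j, / INR j) <= 750 * / (1 + d ^ 2) * (/ INR j) ^ 2).
  { intros i Hi. unfold circle_term; cbn [fst snd].
    set (v := INR i / INR j).
    assert (Hv : 0 <= v <= 1).
    { pose proof (pos_INR i). apply lt_INR in Hi. unfold v. split.
      - apply Rle_mult_inv_pos; auto.
      - apply (Rmult_le_reg_r (INR j)); auto. unfold Rdiv. rewrite Rmult_assoc, Rinv_l by lra. lra. }
    replace (x - (INR j + v)) with (d - v) by (unfold d; ring).
    assert (Q : 4 / 9 * d ^ 2 <= (d - v) ^ 2).
    { unfold Rabs in Hx. destruct (Rcase_abs d); nra. }
    set (e2 := (/ INR j) ^ 2). assert (He : 0 < e2) by (apply pow_lt, Rinv_0_lt_compat; auto).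
    replace (750 * / (1 + d ^ 2) * e2) with (3 * e2 * / ((1 + d ^ 2) / 250)) by (field; lra).
    unfold Rdiv at 1. apply Rmult_le_compat_l; [lra|]. apply Rinv_le_contravar; lra. }
  apply Rsum_le in B.
  assert (E : Rsum (fun _ => 750 * / (1 + d ^ 2) * (/ INR j) ^ 2) j = INR j * (750 * / (1 + d ^ 2) * (/ INR j) ^ 2)).
  { generalize (750 * / (1 + d ^ 2) * (/ INR j) ^ 2). intro c. clear. induction j as [|j IH].
    - simpl. ring.
    - rewrite Rsum_S, IH, S_INR. ring. }
  rewrite E in B. apply (Rmult_le_compat_l (INR j)) in B; [|lra].
  replace (INR j * (INR j * (750 * / (1 + d ^ 2) * (/ INR j) ^ 2))) with (750 * / (1 + d ^ 2)) in B by (field; lra).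
  exact B.
Qed.

(* [10 * 3600 * 12], from [grid_circle_le] and [lattice_sum]. *)
Definition net_const : R := 432000.

(** Only grids within distance 3 of x need their multiplicity bounded by [mu]; the others cost O(1)
    in total because [m j <= j]. Near terms join the same lattice sum through
    [1 / (1 + d^2) >= 1/10]. The case mu = 0 covers x away from all grids. *)
Lemma net_circle_bound (m : nat -> nat) (J0 n : nat) (x mu : R) : (1 <= J0)%nat ->
  (forall j, (m j <= j)%nat) -> 0 <= mu ->
  (forall j, (J0 <= j < J0 + n)%nat -> Rabs (x - INR j) < 3 -> INR (m j) <= mu) ->
  circle_bound (net m J0 n) x <= exp (net_const * (1 + mu)).
Proof.
  intros HJ Hm Hmu H.
  eapply Rle_trans; [apply circle_bound_le_exp, net_positive, HJ|].
  assert (S : list_sum_R (map (circle_term x) (net m J0 n)) <= net_const * (1 + mu)).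
  { unfold net. rewrite list_sum_R_map_flat_map.
    apply (Rle_trans _ (Rsum (fun i => 36000 * (1 + mu) * / (1 + (x - INR J0 - INR i) ^ 2)) n)).
    - apply Rsum_le. intros i Hi. rewrite grid_sum. set (j := (i + J0)%nat).
      assert (Hj : (1 <= j)%nat) by (unfold j; lia).
      replace (x - INR J0 - INR i) with (x - INR j) by (unfold j; rewrite plus_INR; ring).
      assert (T0 : 0 <= Rsum (fun i0 => circle_term x (INR j + INR i0 / INR j, / INR j)) j).
      { apply Rsum_nonneg. intros i0 _. apply circle_term_bounds, Rinv_0_lt_compat, lt_0_INR. lia. }
      assert (P : 0 <= (x - INR j) ^ 2) by apply pow2_ge_0.
      assert (IP : 0 < / (1 + (x - INR j) ^ 2)) by (apply Rinv_0_lt_compat; lra).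
      pose proof (pos_INR (m j)) as Mp.
      destruct (Rlt_le_dec (Rabs (x - INR j)) 3) as [Near|Far].
      + pose proof (H j ltac:(unfold j; lia) Near) as Mj.
        pose proof (grid_circle_le j x Hj) as G.
        assert (I10 : / 10 <= / (1 + (x - INR j) ^ 2)).
        { apply Rinv_le_contravar; [lra|]. rewrite <- pow2_abs. pose proof (Rabs_pos (x - INR j)). nra. }
        apply (Rle_trans _ (mu * 3600)).
        * apply Rmult_le_compat; auto.
        * assert (36000 * (1 + mu) * / 10 <= 36000 * (1 + mu) * / (1 + (x - INR j) ^ 2)); [|lra].
          apply Rmult_le_compat_l; lra.
      + pose proof (grid_circle_far j x Hj Far) as G.
        pose proof (le_INR _ _ (Hm j)) as Mj.
        apply (Rle_trans _ (INR j * Rsum (fun i0 => circle_term x (INR j + INR i0 / INR j, / INR j)) j)).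
        * apply Rmult_le_compat_r; auto.
        * eapply Rle_trans; [exact G|]. apply Rmult_le_compat_r; lra.
    - rewrite Rsum_scal. pose proof (lattice_sum (x - INR J0) n). unfold net_const.
      assert (36000 * (1 + mu) * Rsum (fun i => / (1 + (x - INR J0 - INR i) ^ 2)) n <= 36000 * (1 + mu) * 12).
      { apply Rmult_le_compat_l; lra. }
      lra. }
  destruct S as [S|S]; [left; apply exp_increasing, S | rewrite S; lra].
Qed.

(** With radius and y at most 1 and centers at most 2 j, each denominator is at most 8 * 8 j^2:
    hence 64. *)
Lemma net_center_bound (m : nat -> nat) (J0 n : nat) (y : R) : (1 <= J0)%nat -> 0 < y <= 1 ->
  1 + y / 64 * Rsum (fun i => INR (m (i + J0)%nat) * / INR (i + J0) ^ 2) n <= center_bound y (net m J0 n).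
Proof.
  intros HJ Hy. eapply Rle_trans; [|apply center_bound_ge_sum; [lra | apply net_positive, HJ]].
  apply Rplus_le_compat_l. unfold net. rewrite list_sum_R_map_flat_map, <- Rsum_scal.
  apply Rsum_le. intros i _. rewrite grid_sum. set (j := (i + J0)%nat).
  assert (J : 1 <= INR j) by (apply (le_INR 1); unfold j; lia).
  replace (y / 64 * (INR (m j) * / INR j ^ 2)) with (INR (m j) * (INR j * (y / 64 * / INR j ^ 3))) by (field; lra).
  apply Rmult_le_compat_l; [apply pos_INR|].
  assert (E : INR j * (y / 64 * / INR j ^ 3) = Rsum (fun _ => y / 64 * / INR j ^ 3) j).
  { generalize (y / 64 * / INR j ^ 3). intro c. clearbody j. clear. induction j as [|j IH].
    - simpl. ring.
    - rewrite Rsum_S, <- IH, S_INR. ring. }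
  rewrite E. apply Rsum_le. intros i0 Hi. unfold center_term; cbn [fst snd].
  set (v := INR i0 / INR j).
  assert (Hv : 0 <= v <= 1).
  { pose proof (pos_INR i0). apply lt_INR in Hi. unfold v. split.
    - apply Rle_mult_inv_pos; lra.
    - apply (Rmult_le_reg_r (INR j)); [lra|]. unfold Rdiv. rewrite Rmult_assoc, Rinv_l by lra. lra. }
  set (N := INR j) in *.
  assert (HN : 0 < / N <= 1).
  { split. apply Rinv_0_lt_compat; lra. rewrite <- Rinv_1. apply Rinv_le_contravar; lra. }
  replace (y / 64 * / N ^ 3) with (/ N * y * / (8 * (8 * N ^ 2))) by (field; lra).
  unfold Rdiv. apply Rmult_le_compat_l; [apply Rmult_le_pos; lra|].
  apply Rinv_le_contravar.
  - pose proof (pow2_ge_0 (N + v)). nra.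
  - assert ((/ N + y) ^ 2 <= 4) by nra. assert ((N + v) ^ 2 <= 4 * N ^ 2) by nra. nra.
Qed.

Lemma nfloor_bounds (x : R) : 0 <= x -> x - 1 <= INR (pred (nceil x)) <= x.
Proof.
  intro Hx. pose proof (nceil_bounds x Hx) as B. destruct (nceil x) as [|k].
  - simpl in *. lra.
  - rewrite S_INR in B. simpl pred. lra.
Qed.

(** * Divergent series: admissible sums with small mean square *)

Section Upper.
Variables alpha H : R.
Variable Phi : nat -> R.
Hypothesis alpha_pos : 0 < alpha.
Hypothesis Phi_pos : forall n : nat, (1 <= n)%nat -> 0 < Phi n.
Hypothesis Phi_incr : forall m n : nat, (1 <= m <= n)%nat -> Phi m <= Phi n.
Hypothesis H_pos : 0 < H.

(** The predecessor leaves room for [near_tower_le]: centers near the cell of n then see only values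
    of [Phi] up to n. The cap keeps multiplicities below j and [phi] below e^{nu/2} up to
    constants. *)
Definition capped (k : nat) : R := Rmin (growth Phi (tower (pred k))) (2 ^ k).

Lemma capped_nonneg (k : nat) : 0 <= capped k.
Proof. unfold capped. apply Rmin_glb; [apply growth_nonneg; auto | apply pow_le; lra]. Qed.

(** If the capped series converged, its terms would tend to 0, so the cap would eventually be
    inactive; the terms would then be half of those of the original series, shifted by one. *)
Lemma capped_unbounded : ~ ex_series (fun k => growth Phi (tower k) * / 2 ^ k) ->
  forall B, exists K, B <= Rsum (fun k => capped k * / 2 ^ k) K.
Proof.
  intros Hd B. destruct (excluded_middle_informative (exists K, B <= Rsum (fun k => capped k * / 2 ^ k) K)) as [|Hn]; auto.
  exfalso. apply Hd.
  assert (Hs : ex_series (fun k => capped k * / 2 ^ k)).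
  { apply (ex_series_of_bound _ B).
    - intro k. apply Rmult_le_pos; [apply capped_nonneg|]. apply Rlt_le, Rinv_0_lt_compat, two_pow_pos.
    - intro n. destruct (Rle_lt_dec (Rsum (fun k => capped k * / 2 ^ k) n) B); auto.
      exfalso. apply Hn. exists n. lra. }
  pose proof (ex_series_lim_0 _ Hs) as L. apply is_lim_seq_spec in L.
  destruct (L (mkposreal 1 Rlt_0_1)) as [K1 HK]. simpl in HK.
  apply (ex_series_shift_iff _ K1).
  apply (ex_series_shift_iff _ (S K1)) in Hs.
  apply (ex_series_ext (fun k => 2 * (capped (k + S K1) * / 2 ^ (k + S K1)))).
  2: { apply (ex_series_scal 2 (fun k => capped (k + S K1) * / 2 ^ (k + S K1)) Hs). }
  intro k. specialize (HK (k + S K1)%nat ltac:(lia)).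
  rewrite Rminus_0_r in HK. apply Rabs_lt_between in HK.
  pose proof (two_pow_pos (k + S K1)) as P.
  assert (Q : capped (k + S K1) < 2 ^ (k + S K1)).
  { destruct HK as [_ HK]. apply (Rmult_lt_compat_r (2 ^ (k + S K1))) in HK; auto.
    rewrite Rmult_assoc, Rinv_l in HK by lra. lra. }
  assert (E : capped (k + S K1) = growth Phi (tower (k + K1))).
  { unfold capped in *. replace (pred (k + S K1)) with (k + K1)%nat in * by lia.
    unfold Rmin in *. destruct (Rle_dec _ _); lra. }
  rewrite E. replace (k + S K1)%nat with (S (k + K1)) by lia. simpl pow.
  match goal with |- @eq _ ?x ?y => change (@eq R x y) end.
  field. pose proof (two_pow_pos (k + K1)). lra.
Qed.

(** Rounding down after division by [net_const] keeps the exponent [net_const * net_mult j] of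
    [net_circle_bound] below [capped]. *)
Definition net_mult (j : nat) : nat := pred (nceil (capped (Nat.log2 j) / net_const)).

Lemma net_mult_bounds (j : nat) :
  capped (Nat.log2 j) / net_const - 1 <= INR (net_mult j) /\ net_const * INR (net_mult j) <= capped (Nat.log2 j).
Proof.
  assert (0 < net_const) by (unfold net_const; lra).
  pose proof (nfloor_bounds (capped (Nat.log2 j) / net_const)
    ltac:(apply Rle_mult_inv_pos; [apply capped_nonneg | auto])) as [B1 B2].
  split; auto. apply (Rmult_le_compat_l net_const) in B2; [|lra].
  replace (net_const * (capped (Nat.log2 j) / net_const)) with (capped (Nat.log2 j)) in B2 by (field; lra). exact B2.
Qed.

Lemma pow2_log2_le (j : nat) : (1 <= j)%nat -> 2 ^ Nat.log2 j <= INR j.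
Proof.
  intro Hj. pose proof (Nat.log2_spec j ltac:(lia)) as [A _]. apply le_INR in A.
  rewrite pow_INR in A. exact A.
Qed.

Lemma net_mult_le (j : nat) : (net_mult j <= j)%nat.
Proof.
  destruct (Nat.eq_dec j 0) as [->|].
  - unfold net_mult. apply INR_le. change (INR 0) with 0.
    pose proof (net_mult_bounds 0) as [_ B]. unfold net_mult in B.
    assert (capped (Nat.log2 0) <= 1) by (unfold capped; simpl; apply Rmin_r).
    destruct (pred (nceil (capped (Nat.log2 0) / net_const))) as [|k]; [simpl; lra|].
    rewrite S_INR in B. pose proof (pos_INR k). unfold net_const in B. lra.
  - apply INR_le. pose proof (net_mult_bounds j) as [_ B]. pose proof (pow2_log2_le j ltac:(lia)).
    pose proof (Rmin_r (growth Phi (tower (pred (Nat.log2 j)))) (2 ^ Nat.log2 j)). fold (capped (Nat.log2 j)) in *.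
    pose proof (pos_INR (net_mult j)). unfold net_const in B. lra.
Qed.

(** The block has 2^k indices j, each with [1 / j^2 >= 1 / 4^(k+1)]. Rounding down loses at most 1
    per multiplicity, hence at most 2^{-k} / 4, a geometric term. *)
Lemma net_mult_block (k : nat) :
  capped k * / 2 ^ k / (4 * net_const) - / 4 * (/ 2) ^ k
  <= Rsum (fun j => INR (net_mult j) * / INR j ^ 2) (2 ^ S k) - Rsum (fun j => INR (net_mult j) * / INR j ^ 2) (2 ^ k).
Proof.
  replace (2 ^ S k)%nat with (2 ^ k + 2 ^ k)%nat by (simpl; lia).
  rewrite <- Rsum_shift. pose proof (two_pow_pos k) as P.
  assert (C : 0 < net_const) by (unfold net_const; lra).
  set (c := (capped k / net_const - 1) * / (2 * 2 ^ k) ^ 2).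
  destruct (Rle_lt_dec (capped k / net_const - 1) 0) as [Neg|Pos].
  - apply (Rle_trans _ 0).
    + rewrite pow_inv. pose proof (Rinv_0_lt_compat _ P).
      replace (capped k * / 2 ^ k / (4 * net_const) - / 4 * / 2 ^ k) with (/ 4 * / 2 ^ k * (capped k / net_const - 1)) by (field; lra). nra.
    + apply Rsum_nonneg. intros i _. apply Rmult_le_pos; [apply pos_INR|].
      destruct (Req_dec (INR (i + 2 ^ k) ^ 2) 0) as [E|E]. * rewrite E, Rinv_0. lra.
      * apply Rlt_le, Rinv_0_lt_compat. pose proof (pow2_ge_0 (INR (i + 2 ^ k))). lra.
  - apply (Rle_trans _ (Rsum (fun _ => c) (2 ^ k))).
    + assert (E : forall n, Rsum (fun _ => c) n = INR n * c).
      { induction n as [|n IH]. - simpl. ring. - rewrite Rsum_S, IH, S_INR. ring. }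
      rewrite E, pow_INR. unfold c. change (INR 2) with 2. rewrite pow_inv. right. field. lra.
    + apply Rsum_le. intros i Hi. set (j := (i + 2 ^ k)%nat).
      assert (Hl : Nat.log2 j = k).
      { apply Nat.log2_unique; [lia|]. unfold j. simpl. lia. }
      pose proof (net_mult_bounds j) as [B _]. rewrite Hl in B.
      unfold c. apply Rmult_le_compat; [lra| |exact B|].
      * apply Rlt_le, Rinv_0_lt_compat, pow_lt. lra.
      * assert (J : 1 <= INR j). { apply (le_INR 1). unfold j. pose proof (Nat.pow_nonzero 2 k). lia. }
        apply Rinv_le_contravar; [nra|]. apply pow_incr. split; [lra|].
        apply (Rle_trans _ (INR (2 ^ k + 2 ^ k))).
        -- apply le_INR. unfold j. lia.
        -- rewrite plus_INR, pow_INR. change (INR 2) with 2. lra.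
Qed.

Lemma net_mult_unbounded (k0 : nat) (B : R) : ~ ex_series (fun k => growth Phi (tower k) * / 2 ^ k) ->
  exists n, B <= Rsum (fun i => INR (net_mult (i + 2 ^ k0)) * / INR (i + 2 ^ k0) ^ 2) n.
Proof.
  intro Hd. set (f := fun j => INR (net_mult j) * / INR j ^ 2).
  assert (C : 0 < net_const) by (unfold net_const; lra).
  assert (Step : forall K, Rsum (fun k => capped k * / 2 ^ k) K / (4 * net_const) - / 4 * Rsum (fun k => (/ 2) ^ k) K <= Rsum f (2 ^ K) - Rsum f 1).
  { induction K as [|K IH].
    - change (2 ^ 0)%nat with 1%nat. cbn [Rsum]. unfold Rdiv. lra.
    - rewrite !(Rsum_S _ K). pose proof (net_mult_block K) as Q. fold f in Q.
      unfold Rdiv in *. rewrite Rmult_plus_distr_r. lra. }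
  assert (Geo : forall K, Rsum (fun k => (/ 2) ^ k) K <= 2).
  { intro K. assert (E : Rsum (fun k => (/ 2) ^ k) K = 2 - 2 * (/ 2) ^ K).
    { induction K as [|K IH]; [simpl; ring|]. rewrite Rsum_S, IH. simpl. field. }
    rewrite E. pose proof (pow_lt (/ 2) K ltac:(lra)). lra. }
  (* The target uses [Rmax B 0], so that the partial sum up to 2^K exceeds the one up to 2^k0 even
     for negative B; this forces [2^k0 <= 2^K]. *)
  destruct (capped_unbounded Hd (4 * net_const * (Rmax B 0 + 1 + Rsum f (2 ^ k0) - Rsum f 1))) as [K HK].
  assert (Hbig : Rmax B 0 + / 2 + Rsum f (2 ^ k0) <= Rsum f (2 ^ K)).
  { specialize (Step K). specialize (Geo K).
    apply (Rmult_le_compat_r (/ (4 * net_const))) in HK. 2: { apply Rlt_le, Rinv_0_lt_compat. lra. }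
    rewrite (Rmult_comm (4 * net_const)), Rmult_assoc, Rinv_r, Rmult_1_r in HK by lra. unfold Rdiv in Step. lra. }
  assert (f_nonneg : forall i, 0 <= f i).
  { intro i. apply Rmult_le_pos; [apply pos_INR|]. destruct (Req_dec (INR i ^ 2) 0) as [E|E].
    - rewrite E, Rinv_0. lra.
    - apply Rlt_le, Rinv_0_lt_compat. pose proof (pow2_ge_0 (INR i)). lra. }
  assert (Hlt : (2 ^ k0 <= 2 ^ K)%nat).
  { destruct (Nat.le_gt_cases (2 ^ k0) (2 ^ K)) as [|G]; auto.
    pose proof (Rsum_mono f (2 ^ K) (2 ^ k0) f_nonneg ltac:(lia)). pose proof (Rmax_r B 0). lra. }
  exists (2 ^ K - 2 ^ k0)%nat. change (B <= Rsum (fun i => f (i + 2 ^ k0)%nat) (2 ^ K - 2 ^ k0)).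
  rewrite Rsum_shift. replace (2 ^ K - 2 ^ k0 + 2 ^ k0)%nat with (2 ^ K)%nat by lia.
  pose proof (Rmax_l B 0). lra.
Qed.

(** Cell lengths are of order 1/n, and e^{freq} = (n + alpha) / alpha converts this into decay
    e^{-freq}. *)
Lemma freq_step (n : nat) : (1 <= n)%nat ->
  0 <= freq alpha (S n) - freq alpha n <= / (INR n + alpha) /\
  / (INR n + alpha) <= (1 + alpha) / alpha ^ 2 * exp (- freq alpha (S n)).
Proof.
  intro Hn. apply (le_INR 1) in Hn. change (INR 1) with 1 in Hn. unfold freq. rewrite S_INR.
  set (x := INR n) in *. split.
  - assert (E : ln ((x + 1 + alpha) / alpha) - ln ((x + alpha) / alpha) = ln ((x + 1 + alpha) / (x + alpha))).
    { rewrite !ln_div by lra. ring. }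
    rewrite E. set (q := (x + 1 + alpha) / (x + alpha)).
    assert (Hq : q = 1 + / (x + alpha)) by (unfold q; field; lra).
    assert (0 < / (x + alpha)) by (apply Rinv_0_lt_compat; lra).
    split.
    + rewrite <- ln_1. destruct (Rle_lt_or_eq_dec 1 q ltac:(lra)) as [L|L]; [left; apply ln_increasing; lra | rewrite L; lra].
    + pose proof (exp_ineq1_le (ln q)) as Ex. rewrite exp_ln in Ex by lra. lra.
  - rewrite exp_Ropp, exp_ln by (apply Rdiv_lt_0_compat; lra).
    apply (Rmult_le_reg_r ((x + alpha) * alpha * (x + 1 + alpha))).
    { apply Rmult_lt_0_compat; [apply Rmult_lt_0_compat|]; lra. }
    replace (/ (x + alpha) * ((x + alpha) * alpha * (x + 1 + alpha))) with (alpha * (x + 1 + alpha)) by (field; lra).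
    replace ((1 + alpha) / alpha ^ 2 * / ((x + 1 + alpha) / alpha) * ((x + alpha) * alpha * (x + 1 + alpha)))
      with ((1 + alpha) * (x + alpha)) by (field; lra).
    nra.
Qed.

Lemma CI_cells (f : R -> C) (nu : nat -> R) (N : nat) : Ccont f ->
  CI f (nu 1%nat) (nu (S N)) = Csum (fun i => CI f (nu (S i)) (nu (S (S i)))) N.
Proof.
  intro Hf. induction N as [|N IH].
  - simpl. rewrite (CI_ext f (fun _ => f (nu 1%nat))); [|lra|].
    + rewrite CI_const, Rminus_diag. ring.
    + intros t Ht. replace t with (nu 1%nat) by lra. reflexivity.
  - simpl Csum. rewrite <- IH, CI_Chasles by auto. reflexivity.
Qed.

(** A lower Riemann sum for the integral of e^{-x/2} over a part of [0, oo), which is at most 2. *)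
Lemma exp_telescope (nu : nat -> R) (N : nat) : (forall n, nu n <= nu (S n)) -> 0 <= nu 1%nat ->
  Rsum (fun i => (nu (S (S i)) - nu (S i)) * exp (- (nu (S (S i)) / 2))) N <= 2.
Proof.
  intros Hm H0.
  assert (T : Rsum (fun i => (nu (S (S i)) - nu (S i)) * exp (- (nu (S (S i)) / 2))) N
    <= 2 * (exp (- (nu 1%nat / 2)) - exp (- (nu (S N) / 2)))).
  { induction N as [|N IH]; [simpl; lra|]. rewrite Rsum_S. 
    set (a := nu (S N)) in *. set (b := nu (S (S N))) in *.
    assert (E : exp (- (a / 2)) = exp (- (b / 2)) * exp ((b - a) / 2)) by (rewrite <- exp_plus; f_equal; field).
    pose proof (exp_ineq1_le ((b - a) / 2)). pose proof (exp_pos (- (b / 2))).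
    rewrite E in IH.
    assert ((b - a) / 2 * exp (- (b / 2)) <= exp (- (b / 2)) * exp ((b - a) / 2) - exp (- (b / 2))) by nra.
    lra. }
  pose proof (exp_pos (- (nu (S N) / 2))).
  assert (exp (- (nu 1%nat / 2)) <= 1).
  { rewrite <- exp_0. destruct (Req_dec (nu 1%nat) 0) as [E|E].
    - rewrite E. right. f_equal. field.
    - left. apply exp_increasing. lra. }
  lra.
Qed.

(* A center [j] within 3 of the cell of [n] only uses values of [Phi] at indices at most [n]. *)
Lemma near_tower_le (n j : nat) (x : R) : (1 <= n)%nat ->
  2 * ln ((2 + alpha) / alpha) + 6 <= INR j -> (2 <= j)%nat ->
  x <= freq alpha (S n) -> Rabs (x - INR j) < 3 ->
  (tower (pred (Nat.log2 j)) <= n)%nat.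
Proof.
  intros Hn Hb Hj Hx Hnear. set (b := ln ((2 + alpha) / alpha)) in *.
  assert (Hn' : 1 <= INR n) by (apply (le_INR 1); auto).
  assert (F : freq alpha (S n) <= ln (INR n) + b).
  { unfold freq, b. rewrite <- ln_mult; [|lra|apply Rdiv_lt_0_compat; lra].
    assert (Q : (INR (S n) + alpha) / alpha <= INR n * ((2 + alpha) / alpha)).
    { rewrite S_INR. apply (Rmult_le_reg_r alpha); auto.
      replace ((INR n + 1 + alpha) / alpha * alpha) with (INR n + 1 + alpha) by (field; lra).
      replace (INR n * ((2 + alpha) / alpha) * alpha) with (INR n * (2 + alpha)) by (field; lra). nra. }
    destruct Q as [Q|Q]; [left; apply ln_increasing; auto|rewrite Q; lra].
    apply Rdiv_lt_0_compat; auto. pose proof (pos_INR (S n)). lra. }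
  apply Rabs_lt_between in Hnear.
  assert (L : (1 <= Nat.log2 j)%nat) by (apply (Nat.log2_le_mono 2 j); auto).
  pose proof (pow2_log2_le j ltac:(lia)) as P.
  destruct (Nat.log2 j) as [|k]; [lia|]. simpl pred. simpl pow in P.
  apply INR_le. apply Rnot_lt_le. intro G.
  apply ln_increasing in G; [|lra]. rewrite ln_tower in G. pose proof ln_2_bounds.
  pose proof (two_pow_pos k). nra.
Qed.

Lemma freq_nonneg (n : nat) : 0 <= freq alpha n.
Proof. rewrite <- (freq_0 alpha alpha_pos). apply freq_mono; auto. lia. Qed.

Lemma freq_unbounded (B : R) : exists N, B <= freq alpha (S N).
Proof.
  exists (nceil (alpha * exp B)).
  assert (P : 0 < alpha * exp B) by (apply Rmult_lt_0_compat; auto; apply exp_pos).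
  pose proof (nceil_bounds _ (Rlt_le _ _ P)) as [Q _].
  unfold freq. rewrite S_INR. set (n := INR _) in *.
  rewrite <- (ln_exp B) at 1. left. apply ln_increasing; [apply exp_pos|].
  apply (Rmult_lt_reg_r alpha); auto.
  replace ((n + 1 + alpha) / alpha * alpha) with (n + 1 + alpha) by (field; lra). lra.
Qed.

Lemma exp_le_mono (a b : R) : a <= b -> exp a <= exp b.
Proof. intros [L|L]; [left; apply exp_increasing, L | rewrite L; lra]. Qed.

(** Alpha times the sum equals (1 - e^{-yt}) - (J - e^{-yt}) plus the errors of freezing e^{ixt} on
    each cell. These are at most e1, 2 e1 and e1, whence [e1 = alpha * e0 / 4]; the first bound
    requires [y * H <= e1]. *)
Lemma mean_square_small : ~ ex_series (fun k => growth Phi (tower k) * / 2 ^ k) ->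
  forall d, 0 < d -> exists N a, admissible Phi N a /\ mean_square alpha H N a <= d.
Proof.
  intros Hd d Hdp.
  assert (C0p : 0 < net_const) by (unfold net_const; lra).
  pose proof (Phi_pos 1%nat ltac:(lia)) as P1.
  set (e0 := Rmin 1 (d / H)).
  assert (He0 : 0 < e0 <= 1) by (split; [apply Rmin_pos; [lra | apply Rdiv_lt_0_compat; lra] | apply Rmin_l]).
  assert (He0' : H * e0 ^ 2 <= d).
  { assert (H * e0 <= d).
    { replace d with (H * (d / H)) by (field; lra). apply Rmult_le_compat_l; [lra | apply Rmin_r]. }
    nra. }
  set (e1 := alpha * e0 / 4). assert (He1 : 0 < e1) by (unfold e1; nra).
  set (y := Rmin 1 (e1 / H)).
  assert (Hy : 0 < y <= 1) by (split; [apply Rmin_pos; [lra | apply Rdiv_lt_0_compat; lra] | apply Rmin_l]).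
  assert (HyH : y * H <= e1).
  { replace e1 with (e1 / H * H) by (field; lra). apply Rmult_le_compat_r; [lra | apply Rmin_r]. }
  set (Ca := (1 + alpha) / alpha ^ 2 * exp (3 / 2)).
  assert (HCa : 0 < Ca).
  { apply Rmult_lt_0_compat; [|apply exp_pos]. apply Rdiv_lt_0_compat; nra. }
  (* [phi] will carry a factor 1 / Q. The summands serve, in order, the error of the representation,
     the bound [Cmod (a m) <= Phi m], and the cell errors. *)
  set (Q := / e1 + / (alpha * Phi 1%nat) + 2 * H * Ca / e1).
  assert (HQ1 : 0 < / e1) by (apply Rinv_0_lt_compat; auto).
  assert (HQ2 : 0 < / (alpha * Phi 1%nat)) by (apply Rinv_0_lt_compat; nra).
  assert (HQ3 : 0 < 2 * H * Ca / e1) by (apply Rdiv_lt_0_compat; auto; nra).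
  assert (HQ : 0 < Q) by (unfold Q; lra).
  set (b := ln ((2 + alpha) / alpha)).
  set (nu := freq alpha).
  (* The grids start beyond [nu 1] by at least 6 and far enough for [near_tower_le]. *)
  set (k0 := nceil (2 * Rabs b + 6 + nu 1%nat)).
  pose proof (freq_nonneg 1) as Hnu1. fold nu in Hnu1.
  assert (Hk0 : 2 * Rabs b + 6 + nu 1%nat <= INR (2 ^ k0)).
  { pose proof (Rabs_pos b). pose proof (nceil_bounds (2 * Rabs b + 6 + nu 1%nat) ltac:(lra)) as [B _].
    fold k0 in B. pose proof (Nat.pow_gt_lin_r 2 k0 ltac:(lia)) as G. apply lt_INR in G. lra. }
  set (J0 := (2 ^ k0)%nat) in *.
  assert (HJ6 : 6 <= INR J0) by (pose proof (Rabs_pos b); lra).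
  assert (HJ2 : (2 <= J0)%nat) by (apply INR_le; simpl; lra).
  (* With [center_bound y L >= Gt] the bound on [phi] becomes [exp (net_const * mu / 2) / Q]. *)
  set (Gt := exp net_const * Q ^ 2 / y ^ 2).
  destruct (net_mult_unbounded k0 (64 / y * Gt) Hd) as [n Hn]. fold J0 in Hn.
  set (L := net net_mult J0 n).
  assert (HL : positive_radii L) by (apply net_positive; lia).
  set (g0 := center_bound y L).
  assert (Hg0 : Gt <= g0).
  { pose proof (net_center_bound net_mult J0 n y ltac:(lia) Hy) as B. fold L g0 in B.
    apply (Rmult_le_compat_l (y / 64)) in Hn; [|lra].
    replace (y / 64 * (64 / y * Gt)) with Gt in Hn by (field; lra). lra. }
  assert (HGt : 0 < Gt).
  { unfold Gt. apply Rdiv_lt_0_compat; [|nra]. apply Rmult_lt_0_compat; [apply exp_pos | nra]. }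
  (* The interval ends at least 3 beyond the last grid index, so [net_circle_bound] applies with mu
     = 0 off it. *)
  destruct (freq_unbounded (INR (J0 + n) + 3)) as [N HN]. fold nu in HN.
  assert (Hmono : forall i, nu i <= nu (S i)) by (intro i; apply freq_mono; auto).
  assert (HAB : nu 1%nat < nu (S N)).
  { pose proof (le_INR J0 (J0 + n) ltac:(lia)). pose proof (Rabs_pos b). lra. }
  destruct (exponential_representation L y (nu 1%nat) (nu (S N)) (exp net_const) e1) as [phi [Pc [Pb Pt]]]; auto; try lra.
  { intros x Hx. replace (exp net_const) with (exp (net_const * (1 + 0))) by (f_equal; ring).
    apply net_circle_bound; auto; [lia | apply net_mult_le | lra|].
    intros j Hj Hnear. exfalso. apply Rabs_lt_between in Hnear.
    pose proof (Rabs_pos b).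
    assert (INR J0 <= INR j) by (apply le_INR; lia). assert (INR j <= INR (J0 + n)) by (apply le_INR; lia).
    destruct Hx; lra. }
  fold g0 in Pb, Pt.
  assert (Bphi : forall i x mu, nu (S i) <= x <= nu (S (S i)) -> (i < N)%nat -> 0 <= mu ->
    (forall j, (J0 <= j < J0 + n)%nat -> Rabs (x - INR j) < 3 -> INR (net_mult j) <= mu) ->
    Cmod (phi x) <= exp (net_const * mu / 2) / Q).
  { intros i x mu Hx Hi Hmu Hj. apply Cmod_le_sqr. { apply Rlt_le, Rdiv_lt_0_compat; auto. apply exp_pos. }
    assert (nu 1%nat <= nu (S i)) by (apply freq_mono; auto; lia).
    assert (nu (S (S i)) <= nu (S N)) by (apply freq_mono; auto; lia).
    eapply Rle_trans; [apply Pb; lra|].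
    pose proof (net_circle_bound net_mult J0 n x mu ltac:(lia) net_mult_le Hmu Hj) as CB. fold L in CB.
    replace ((exp (net_const * mu / 2) / Q) ^ 2) with (exp (net_const * (1 + mu)) * / (Gt * y ^ 2)).
    2: { unfold Gt. replace (net_const * (1 + mu)) with (net_const + (net_const * mu / 2 + net_const * mu / 2)) by field. rewrite !exp_plus.
         field. pose proof (exp_pos net_const). repeat split; lra. }
    assert (Hy2 : 0 < y ^ 2) by nra.
    unfold Rdiv. apply Rmult_le_compat; auto.
    - pose proof (circle_bound_bounds L x HL). lra.
    - apply Rlt_le, Rinv_0_lt_compat. nra.
    - apply Rinv_le_contravar; [nra|]. apply Rmult_le_compat_r; lra. }
  assert (Bcell : forall i x, nu (S i) <= x <= nu (S (S i)) -> (i < N)%nat ->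
    Cmod (phi x) <= Phi (S i) / (Phi 1%nat * Q) /\ Cmod (phi x) <= exp ((nu (S (S i)) + 3) / 2) / Q).
  { intros i x Hx Hi.
    pose proof (growth_nonneg Phi Phi_pos Phi_incr (S i)) as Gp.
    pose proof (freq_nonneg (S (S i))) as Fp. fold nu in Fp.
    (* The first entry yields domination by [Phi], hence admissibility; the second bounds [phi] by a
       multiple of e^{nu/2}, which the squared cell length in the freezing error beats. *)
    set (mu := Rmin (growth Phi (S i)) (nu (S (S i)) + 3) / net_const).
    assert (M0 : 0 <= Rmin (growth Phi (S i)) (nu (S (S i)) + 3)) by (apply Rmin_glb; lra).
    assert (Hmu : 0 <= mu) by (apply Rle_mult_inv_pos; auto).
    assert (Emu : net_const * mu = Rmin (growth Phi (S i)) (nu (S (S i)) + 3)) by (unfold mu; field; lra).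
    assert (B : Cmod (phi x) <= exp (net_const * mu / 2) / Q).
    { apply (Bphi i); auto. intros j Hj Hnear.
      apply (Rmult_le_reg_l net_const); auto. rewrite Emu.
      pose proof (net_mult_bounds j) as [_ Bj]. eapply Rle_trans; [exact Bj|].
      assert (HjJ : INR J0 <= INR j) by (apply le_INR; lia). pose proof (Rle_abs b). pose proof (Rabs_pos b).
      apply Rmin_glb.
      - eapply Rle_trans; [apply Rmin_l|]. apply growth_mono; auto.
        apply (near_tower_le (S i) j x); auto; try lia; try (fold b; lra). apply Hx.
      - eapply Rle_trans; [apply Rmin_r|]. pose proof (pow2_log2_le j ltac:(lia)).
        apply Rabs_lt_between in Hnear. lra. }
    rewrite Emu in B.
    pose proof (Rmin_l (growth Phi (S i)) (nu (S (S i)) + 3)). pose proof (Rmin_r (growth Phi (S i)) (nu (S (S i)) + 3)).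
    pose proof (Rinv_0_lt_compat _ HQ).
    split; eapply Rle_trans; try exact B.
    - rewrite (Phi_growth Phi Phi_pos (S i)) by lia.
      replace (Phi 1%nat * exp (growth Phi (S i)) / (Phi 1%nat * Q)) with (exp (growth Phi (S i)) / Q) by (field; lra).
      apply Rmult_le_compat_r; [lra|]. apply exp_le_mono. lra.
    - apply Rmult_le_compat_r; [lra|]. apply exp_le_mono. lra. }
  set (cell := fun i => CI phi (nu (S i)) (nu (S (S i)))).
  (* The factor [/ alpha * (INR (S i) + alpha)] cancels the denominator in [coef], so the effective
     coefficient is [- cell i / alpha]. *)
  set (a := fun m : nat => match m return C with O => 0%C | S i => (- (RtoC (/ alpha * (INR (S i) + alpha)) * cell i))%C end).
  exists N, a. split.
  - intros m Hm. destruct m as [|i]; [lia|]. unfold a. pose proof (pos_INR (S i)) as Pi.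
    rewrite Cmod_opp, Cmod_mult, Cmod_R.
    assert (Ia : 0 < / alpha) by (apply Rinv_0_lt_compat; auto).
    rewrite Rabs_pos_eq by nra.
    destruct (freq_step (S i) ltac:(lia)) as [[F1 F2] _]. fold nu in F1, F2.
    assert (B : Cmod (cell i) <= (nu (S (S i)) - nu (S i)) * (Phi (S i) / (Phi 1%nat * Q))).
    { apply CI_le_const; auto. intros t Ht. apply Bcell; auto. lia. }
    pose proof (Phi_pos (S i) ltac:(lia)) as Pp.
    assert (Z : 0 < Phi (S i) / (Phi 1%nat * Q)) by (apply Rdiv_lt_0_compat; auto; nra).
    apply (Rle_trans _ (/ alpha * (INR (S i) + alpha) * (/ (INR (S i) + alpha) * (Phi (S i) / (Phi 1%nat * Q))))).
    + apply Rmult_le_compat_l; [nra|]. eapply Rle_trans; [exact B|]. apply Rmult_le_compat_r; lra.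
    + replace (/ alpha * (INR (S i) + alpha) * (/ (INR (S i) + alpha) * (Phi (S i) / (Phi 1%nat * Q))))
        with (Phi (S i) * (/ (alpha * Phi 1%nat) / Q)) by (field; lra).
      assert (/ (alpha * Phi 1%nat) / Q <= 1).
      { apply (Rmult_le_reg_r Q); auto. unfold Rdiv. rewrite Rmult_assoc, Rinv_l by lra. unfold Q. lra. }
      nra.
  - rewrite mean_square_expsum by auto.
    assert (Small : forall t, 0 <= t <= H -> Cmod (expsum (freq alpha) (coef alpha a) (S N) t) <= e0).
    { intros t Ht. fold nu.
      assert (Pct : Ccont (fun x => phi x * cis (x * t))%C).
      { apply Ccont_mult; auto. apply Ccont_cis. auto with cont. }
      set (J := CI (fun x => phi x * cis (x * t))%C (nu 1%nat) (nu (S N))).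
      set (Dc := fun i => CI (fun x => phi x * (cis (x * t) - cis (nu (S i) * t)))%C (nu (S i)) (nu (S (S i)))).
      assert (Pcd : forall i, Ccont (fun x => phi x * (cis (x * t) - cis (nu (S i) * t)))%C).
      { intro i. apply Ccont_mult; auto. auto with cont. }
      assert (E : (RtoC alpha * expsum nu (coef alpha a) (S N) t)%C =
        (RtoC (1 - exp (- (y * t))) + (- (J - RtoC (exp (- (y * t)))) + Csum Dc N))%C).
      { unfold expsum. rewrite Csum_shift, Cmult_plus_distr_l, <- Csum_scal.
        unfold J. rewrite (CI_cells _ nu N Pct).
        assert (E1 : Csum (fun i => RtoC alpha * (coef alpha a (S i) * cis (nu (S i) * t)))%C N
          = (Csum Dc N - Csum (fun i => CI (fun x => phi x * cis (x * t))%C (nu (S i)) (nu (S (S i)))) N)%C).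
        { rewrite <- Csum_minus. apply Csum_ext. intros i Hi. unfold Dc, coef, a.
          pose proof (pos_INR (S i)) as Pi.
          assert (Ec : CI (fun x => phi x * (cis (x * t) - cis (nu (S i) * t)))%C (nu (S i)) (nu (S (S i)))
            = (CI (fun x => phi x * cis (x * t))%C (nu (S i)) (nu (S (S i))) - cis (nu (S i) * t) * cell i)%C).
          { unfold cell. rewrite <- CI_scal, <- CI_minus; auto with cont.
            apply CI_ext; [apply Hmono|]. intros x _. ring. }
          rewrite Ec, RtoC_mult, RtoC_inv by lra. field. split.
          - intro G. apply RtoC_inj in G. lra.
          - intro G. apply RtoC_inj in G. lra. }
        rewrite E1. simpl coef. unfold nu at 1. rewrite (freq_0 alpha alpha_pos), Rmult_0_l, cis_0, RtoC_inv, RtoC_minus by lra.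
        field. intro G. apply RtoC_inj in G. lra. }
      assert (B1 : Rabs (1 - exp (- (y * t))) <= e1).
      { pose proof (exp_neg_sub_le 0 (y * t) ltac:(nra)) as Ex. rewrite Ropp_0, exp_0 in Ex. nra. }
      assert (B2 : Cmod (J - RtoC (exp (- (y * t))))%C <= 2 * e1).
      { eapply Rle_trans; [apply Pt; lra|].
        assert (S1 : exp net_const / g0 <= e1 ^ 2).
        { apply (Rle_trans _ (exp net_const / Gt)).
          - apply Rmult_le_compat_l; [apply Rlt_le, exp_pos|]. apply Rinv_le_contravar; auto.
          - replace (exp net_const / Gt) with ((y / Q) ^ 2) by (unfold Gt; field; pose proof (exp_pos net_const); repeat split; lra).
            apply pow_incr. split; [apply Rle_mult_inv_pos; lra|].
            apply (Rmult_le_reg_r Q); auto. replace (y / Q * Q) with y by (field; lra).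
            apply (Rle_trans _ (e1 * / e1)); [rewrite Rinv_r; lra|]. apply Rmult_le_compat_l; [lra|]. unfold Q. lra. }
        apply sqrt_le_1_alt in S1. rewrite sqrt_pow2 in S1 by lra. lra. }
      assert (B3 : Cmod (Csum Dc N) <= e1).
      { eapply Rle_trans; [apply Cmod_Csum|].
        apply (Rle_trans _ (H * Ca / Q * Rsum (fun i => (nu (S (S i)) - nu (S i)) * exp (- (nu (S (S i)) / 2))) N)).
        - rewrite <- Rsum_scal. apply Rsum_le. intros i Hi.
          destruct (freq_step (S i) ltac:(lia)) as [[F1 F2] F3]. fold nu in F1, F2, F3.
          set (D := nu (S (S i)) - nu (S i)) in *.
          assert (Hb2 : Cmod (Dc i) <= D * (exp ((nu (S (S i)) + 3) / 2) / Q * (D * H))).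
          { apply CI_le_const; auto. intros x Hx. rewrite Cmod_mult.
            apply Rmult_le_compat; auto using Cmod_ge_0.
            - apply Bcell; auto.
            - eapply Rle_trans; [apply Cmod_cis_sub|].
              replace (x * t - nu (S i) * t) with ((x - nu (S i)) * t) by ring.
              rewrite Rabs_mult, !Rabs_pos_eq by lra. apply Rmult_le_compat; unfold D; lra. }
          eapply Rle_trans; [exact Hb2|].
          (* One of the two cell lengths absorbs the growth e^{nu/2} and leaves e^{-nu/2}; the other
             makes the total a Riemann sum. *)
          assert (Key : D * exp ((nu (S (S i)) + 3) / 2) <= Ca * exp (- (nu (S (S i)) / 2))).
          { set (v := nu (S (S i))) in *.
            apply (Rle_trans _ ((1 + alpha) / alpha ^ 2 * exp (- v) * exp ((v + 3) / 2))).
            - apply Rmult_le_compat_r; [apply Rlt_le, exp_pos | lra].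
            - unfold Ca. rewrite !Rmult_assoc, <- !exp_plus. right. do 2 f_equal. field. }
          replace (D * (exp ((nu (S (S i)) + 3) / 2) / Q * (D * H)))
            with (H / Q * D * (D * exp ((nu (S (S i)) + 3) / 2))) by (field; lra).
          replace (H * Ca / Q * (D * exp (- (nu (S (S i)) / 2))))
            with (H / Q * D * (Ca * exp (- (nu (S (S i)) / 2)))) by (field; lra).
          apply Rmult_le_compat_l; auto. apply Rmult_le_pos; [|lra]. apply Rle_mult_inv_pos; lra.
        - pose proof (exp_telescope nu N Hmono Hnu1) as T.
          assert (Z : 0 <= H * Ca / Q) by (apply Rle_mult_inv_pos; auto; nra).
          apply (Rmult_le_compat_l _ _ _ Z) in T. eapply Rle_trans; [exact T|].
          apply (Rmult_le_reg_r (Q / e1)); [apply Rdiv_lt_0_compat; auto|].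
          replace (H * Ca / Q * 2 * (Q / e1)) with (2 * H * Ca / e1) by (field; lra).
          replace (e1 * (Q / e1)) with Q by (field; lra). unfold Q. lra. }
      assert (B : alpha * Cmod (expsum nu (coef alpha a) (S N) t) <= 4 * e1).
      { apply (Rle_trans _ (Cmod (RtoC alpha * expsum nu (coef alpha a) (S N) t)%C)).
        { rewrite Cmod_mult, Cmod_R, (Rabs_pos_eq alpha) by lra. lra. }
        rewrite E.
        eapply Rle_trans; [apply Cmod_triangle|]. rewrite Cmod_R.
        pose proof (Cmod_triangle (- (J - RtoC (exp (- (y * t))))) (Csum Dc N)) as Tr. rewrite Cmod_opp in Tr. lra. }
      apply (Rmult_le_reg_l alpha); auto. unfold e1 in B. lra. }
    eapply Rle_trans; [|exact He0'].
    replace (H * e0 ^ 2) with (RInt (fun _ => e0 ^ 2) 0 H).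
    2: { rewrite RInt_const. unfold scal; simpl; unfold mult; simpl. ring. }
    apply RInt_le; [lra| | |].
    + apply Rcont_ex_RInt, Rcont_Cmod_sqr, Ccont_expsum.
    + apply Rcont_ex_RInt, Rcont_const.
    + intros t Ht. apply pow_incr. split; [apply Cmod_ge_0|]. apply Small. lra.
Qed.

End Upper.

(** * The series criterion and the equivalence *)

(** [ln Phi] and [growth Phi] differ by the constant [ln (Phi 1)], and the weights alone are
    summable. *)
Lemma criterion_series (Phi : nat -> R) :
  (ex_series (fun k : nat => ln (Phi (k + 2)%nat) / (INR (k + 2) * ln (INR (k + 2)) ^ 2)))
  <-> ex_series (fun i => growth Phi i * logweight i).
Proof.
  rewrite <- (ex_series_shift_iff (fun i => growth Phi i * logweight i) 2).
  pose proof (proj2 (ex_series_shift_iff logweight 2) ex_series_logweight) as W.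
  pose proof (ex_series_scal (ln (Phi 1%nat)) _ W) as W1.
  assert (E : forall k, ln (Phi (k + 2)%nat) / (INR (k + 2) * ln (INR (k + 2)) ^ 2)
    = growth Phi (k + 2) * logweight (k + 2) + ln (Phi 1%nat) * logweight (k + 2)).
  { intro k. unfold growth, logweight, Rdiv. rewrite Nat.max_r by lia. ring. }
  split; intro Hs.
  - apply (ex_series_ext (fun k => ln (Phi (k + 2)%nat) / (INR (k + 2) * ln (INR (k + 2)) ^ 2) - ln (Phi 1%nat) * logweight (k + 2))).
    + intro k. rewrite E. match goal with |- @eq _ ?x ?y => change (@eq R x y) end. ring.
    + apply (ex_series_minus _ _ Hs W1).
  - apply (ex_series_ext (fun k => growth Phi (k + 2) * logweight (k + 2) + ln (Phi 1%nat) * logweight (k + 2))).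
    + intro k. rewrite E. reflexivity.
    + apply (ex_series_plus _ _ Hs W1).
Qed.

Theorem theorem6 (alpha H : R) (Phi : nat -> R)
  (alpha_pos : 0 < alpha)
  (Phi_pos : forall n : nat, (1 <= n)%nat -> 0 < Phi n)
  (Phi_incr : forall m n : nat, (1 <= m <= n)%nat -> Phi m <= Phi n)
  (H_pos : 0 < H) :
  exists (mu : nat -> R) (l : R),
    (forall N : nat, is_min_over (admissible Phi N) (mean_square alpha H N) (mu N)) /\
    is_lim_seq mu (Finite l) /\
    (0 < l <->
     ex_series (fun k : nat =>
       ln (Phi (k + 2)%nat) / (INR (k + 2) * ln (INR (k + 2)) ^ 2))).
Proof.
  pose proof (fun N => mean_square_min alpha H Phi N alpha_pos H_pos Phi_pos) as Hmin.
  set (mu := fun N => proj1_sig (constructive_indefinite_description _ (Hmin N))).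
  assert (Hmu : forall N, is_min_over (admissible Phi N) (mean_square alpha H N) (mu N)).
  { intro N. unfold mu. apply (proj2_sig (constructive_indefinite_description _ (Hmin N))). }
  assert (Hnn : forall N, 0 <= mu N).
  { intro N. destruct (Hmu N) as [[a [_ <-]] _]. apply RInt_ge_0; [lra| |].
    - apply (ex_RInt_ext (fun t => Cmod (expsum (freq alpha) (coef alpha a) (S N) t) ^ 2)).
      + intros t _. rewrite hurwitz_poly_expsum, Cmod_mult, Cmod_cis, Rmult_1_l by auto. reflexivity.
      + apply Rcont_ex_RInt, Rcont_Cmod_sqr, Ccont_expsum.
    - intros t _. apply pow2_ge_0. }
  assert (Hdec : forall N, mu (S N) <= mu N).
  { intro N. destruct (Hmu N) as [[a [Ha <-]] _]. destruct (Hmu (S N)) as [_ Hle].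
    (* Extending a minimiser by a zero coefficient is admissible and keeps the value, so the minima
       are nonincreasing and the limit exists. *)
    set (a' := fun n => (if Nat.leb n N then a n else 0%C) : C).
    replace (mean_square alpha H N a) with (mean_square alpha H (S N) a').
    - apply Hle. intros n Hn. unfold a'. destruct (Nat.leb_spec n N).
      + apply Ha. lia.
      + rewrite Cmod_0. apply Rlt_le, Phi_pos. lia.
    - rewrite !mean_square_expsum by auto. apply RInt_ext. intros t _. f_equal. f_equal.
      change (expsum (freq alpha) (coef alpha a') (S (S N)) t) with
        (expsum (freq alpha) (coef alpha a') (S N) t + coef alpha a' (S N) * cis (freq alpha (S N) * t))%C.
      assert (Z : coef alpha a' (S N) = RtoC 0).
      { unfold coef, a'. destruct (Nat.leb_spec (S N) N); [lia|]. apply Cmult_0_l. }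
      rewrite Z, Cmult_0_l, Cplus_0_r. unfold expsum. apply Csum_ext. intros i Hi.
      unfold coef, a'. destruct i as [|i]; auto. destruct (Nat.leb_spec (S i) N); [reflexivity | lia]. }
  destruct (ex_finite_lim_seq_decr mu 0 Hdec Hnn) as [l Hl].
  exists mu, l. split; [exact Hmu|]. split; [exact Hl|].
  rewrite criterion_series, (tower_condensation (growth Phi)).
  2: { intro i. apply growth_nonneg; auto. }
  2: { intros i j Hij. apply growth_mono; auto. lia. }
  split.
  - intro Hl0. destruct (excluded_middle_informative (ex_series (fun k => growth Phi (tower k) * / 2 ^ k))) as [|Hd]; auto.
    exfalso. destruct (mean_square_small alpha H Phi alpha_pos Phi_pos Phi_incr H_pos Hd (l / 2) ltac:(lra)) as [N [a [Ha Hs]]].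
    destruct (Hmu N) as [_ Hle]. specialize (Hle a Ha).
    pose proof (is_lim_seq_decr_compare mu l Hl Hdec N). lra.
  - intro Hs. destruct (mean_square_lower_bound alpha H Phi alpha_pos Phi_pos Phi_incr H_pos Hs) as [l0 [Hl0 Hb]].
    assert (L : Rbar_le l0 l).
    { apply (is_lim_seq_le (fun _ => l0) mu l0 l).
      - intro N. destruct (Hmu N) as [[a [Ha <-]] _]. apply Hb, Ha.
      - apply is_lim_seq_const.
      - exact Hl. }
    simpl in L. lra.
Qed.
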